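(* For any $T\in\mathcal{H}_n^{nd}$, $$\frac{b_\pi(T;s)}{\prod_{i=0}^{n-1}\left(1-(-1)^iq^{-s+i}\right)}=\chi_\pi(\det T)^{n-1}\,\left|\det(T/2)\right|^{s-n}\times\frac{b_\pi(T;2n-s)}{\prod_{i=0}^{n-1}\left(1-(-1)^iq^{-(2n-s)+i}\right)},$$ as an identity of meromorphic functions of $s$.
   Context: Let $k$ be a non-archimedean local field of characteristic $0$ with prime element $\pi$, ring of integers $\mathcal{O}_k$, normalized valuation $v_\pi$, residue field of cardinality $q$, normalized absolute value $|\cdot|$ ($|\pi|=q^{-1}$). Let $k'$ be its unramified quadratic extension, $\mathcal{O}_{k'}$ its ring of integers, $a\mapsto a^*$ the nontrivial automorphism. $\mathcal{H}_n(k')$: hermitian $n\times n$ matrices over $k'$ (w.r.t. $*$); $\mathcal{H}_n^{nd}$: invertible ones (so $\det T\in k^\times$). $\chi_\pi(a)=(-1)^{v_\pi(a)}$ for $a\in k^\times$. $\psi$ is an additive character of $k$ of conductor $\mathcal{O}_k$. For $R\in\mathcal{H}_n(k')$, $\nu_\pi(R)=q^{e_1+\cdots+e_r}$ if the elementary divisors of $R$ with negative $\pi$-power are $\pi^{-e_1},\dots,\pi^{-e_r}$, and $\nu_\pi(R)=1$ otherwise. The hermitian Siegel series is $b_\pi(T;s)=\int_{\mathcal{H}_n(k')}\nu_\pi(R)^{-s}\psi(\mathrm{tr}(TR))\,dR$ (limit over $\mathcal{H}_n(k')\cap M_n(\pi^{-e}\mathcal{O}_{k'})$ as $e\to\infty$,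 with $dR$ the canonical Haar measure), convergent for $\mathrm{Re}(s)$ large and extended meromorphically (as a rational function of $q^{-s}$) to all $s$.
   Formalization: The residue cardinality q is assumed odd. For even q the identity as printed fails: for n=1, T=(1) one has b(T;s)=1-q^{-s}, so the left side is 1 while the right side is |2|^{1-s}, which is not identically 1. *)

(* Defs.v *)
From HB Require Import structures.
From mathcomp Require Export all_boot all_order all_algebra all_field.
From mathcomp Require Export complex.
From mathcomp Require Export all_classical all_reals all_analysis.

Set Implicit Arguments.
Unset Strict Implicit.
Unset Printing Implicit Defensive.

Export Order.TTheory GRing.Theory Num.Theory numFieldNormedType.Exports.

Local Open Scope classical_set_scope.
Local Open Scope ring_scope.
Local Open Scope complex_scope.

(* A valuation is given as a function v : F -> int that is only meaningful on
   nonzero elements; [v_ge v N x] is "v(x) >= N" with v(0) = +oo. *)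
Definition v_ge (F : fieldType) (v : F -> int) (N : int) (x : F) : Prop :=
  x = 0 \/ N <= v x.

Record normalized_valuation (F : fieldType) (v : F -> int) : Prop := {
  valuationM : forall x y, x != 0 -> y != 0 -> v (x * y) = v x + v y;
  valuationD : forall x y N, v_ge v N x -> v_ge v N y -> v_ge v N (x + y);
  valuation_onto : exists2 x, x != 0 & v x = 1 }.

Definition valuation_complete (F : fieldType) (v : F -> int) : Prop :=
  forall u : nat -> F,
    (forall N : int, exists m : nat, forall i j : nat,
        (m <= i)%N -> (m <= j)%N -> v_ge v N (u i - u j)) ->
    exists l : F, forall N : int, exists m : nat, forall i : nat,
        (m <= i)%N -> v_ge v N (u i - l).

Definition residue_field (F : fieldType) (v : F -> int) : set (set F) :=
  [set [set y | v_ge v 1 (y - x)] | x in [set x | v_ge v 0 x]].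

(* non-archimedean local field of characteristic 0 with residue field of
   cardinality q *)
Record local_field0 (k : fieldType) (v : k -> int) (q : nat) : Prop := {
  local_field_pchar : [pchar k] =i pred0;
  local_field_valuation : normalized_valuation v;
  local_field_complete : valuation_complete v;
  local_field_residue : (residue_field v #= `I_q)%card }.

(* k' is quadratic over k, with a normalized valuation w extending v: the
   ramification index is 1.  The residue field of k being perfect, this says
   that k'/k is unramified. *)
Record unramified_quadratic (k : fieldType) (v : k -> int)
    (k' : fieldExtType k) (w : k' -> int) : Prop := {
  unramified_degree : \dim {:k'} = 2%N;
  unramified_valuation : normalized_valuation w;
  unramified_extends : forall a : k, a != 0 -> w a%:A = v a }.

(* The element of k equal to x, when x lies in the subfield k of k'. *)
Definition in_base (k : fieldType) (k' : fieldExtType k) (x : k') : k :=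
  xget 0 [set a | a%:A = x].

Section Complex.
Variable R : realType.

(* a ^ s for a positive real number a and a complex number s *)
Definition cpow (a : R) (s : R[i]) : R[i] :=
  (expR (complex.Re s * ln a))%:C *
  (cos (complex.Im s * ln a) +i* sin (complex.Im s * ln a)).

Definition cintegral d (T : measurableType d) (mu : {measure set T -> \bar R})
    (D : set T) (f : T -> R[i]) : R[i] :=
  (\int[mu]_(x in D) complex.Re (f x)) +i*
  (\int[mu]_(x in D) complex.Im (f x)).

Definition ccvg (u : nat -> R[i]) (l : R[i]) : Prop :=
  (fun e => complex.Re (u e)) @ \oo --> complex.Re l /\
  (fun e => complex.Im (u e)) @ \oo --> complex.Im l.

Variables (k : fieldType) (v : k -> int) (q : nat).

Definition absval (a : k) : R := if a == 0 then 0 else q%:R ^ (- v a).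

Definition chi (a : k) : R[i] := (-1) ^ v a.

(* Continuity follows from triviality on the ring of integers. *)
Record character_conductor_O (psi : k -> R[i]) : Prop := {
  characterD : forall x y, psi (x + y) = psi x * psi y;
  character_norm1 : forall x, `|psi x| = 1;
  character_trivial : forall x, v_ge v 0 x -> psi x = 1;
  character_nontrivial : exists2 x, v_ge v (-1) x & psi x != 1 }.

End Complex.

Section HermitianMatrices.
Variables (k : fieldType) (k' : fieldExtType k) (star : {lrmorphism k' -> k'}).
Variable n : nat.

Definition is_herm : {pred 'M[k']_n} :=
  [pred A | A \is hermitianmx n false star].

Lemma is_hermE A : (A \in is_herm) = (A == map_mx star A^T).
Proof. by rewrite inE qualifE /= expr0 scale1r. Qed.

Fact is_herm_zmod_closed : zmod_closed is_herm.
Proof.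
split=> [|A B]; rewrite !is_hermE; first by rewrite trmx0 map_mx0.
by move=> /eqP hA /eqP hB; rewrite linearB /= map_mxB -hA -hB.
Qed.

HB.instance Definition _ :=
  GRing.isZmodClosed.Build _ is_herm is_herm_zmod_closed.

Definition herm : Type := {A : 'M[k']_n | A \in is_herm}.

HB.instance Definition _ := SubChoice.on herm.
HB.instance Definition _ := [SubChoice_isSubZmodule of herm by <:].
HB.instance Definition _ := isPointed.Build herm 0.

End HermitianMatrices.

Section SiegelSeries.
Variables (R : realType) (k : fieldType) (v : k -> int) (q : nat) (varpi : k).
Variables (k' : fieldExtType k) (w : k' -> int).
Variables (star : {lrmorphism k' -> k'}) (n : nat).
Local Notation H := (herm star n).

(* \val A lies in M_n(pi^N O_{k'}) *)
Definition herm_ge (N : int) (A : H) : Prop :=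
  forall i j, v_ge w N (\val A i j).

Definition herm_open : set (set H) :=
  [set U | forall A, U A -> exists N, forall B, herm_ge N (B - A) -> U B].

(* the Borel sigma-algebra of H_n(k') *)
Definition herm_borel := g_sigma_algebraType herm_open.

(* The canonical Haar measure: the volume of H_n(O_{k'}) is 1, so that the
   measure is self-dual for psi(tr(TR)). *)
Record canonical_haar (mu : {measure set herm_borel -> \bar R}) : Prop := {
  haar_translation : forall (A : H) (X : set herm_borel), measurable X ->
    mu [set (A + B : H) | B in X] = mu X;
  haar_normalized : mu [set A | herm_ge 0 A] = 1%E }.

Definition integral_mx (A : 'M[k']_n) : Prop := forall i j, v_ge w 0 (A i j).

Definition GL_integral (U : 'M[k']_n) : Prop :=
  [/\ U \in unitmx, integral_mx U & integral_mx (invmx U)].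

(* A has elementary divisors pi^e for d i = Some e, and 0 for d i = None. *)
Definition elementary_divisors (A : 'M[k']_n) (d : 'I_n -> option int) : Prop :=
  exists U V, [/\ GL_integral U, GL_integral V &
    A = U *m diag_mx (\row_i if d i is Some e then varpi%:A ^ e else 0) *m V].

(* The exponents d exist and are unique up to order, so that the value chosen
   by xget is the only possible one. *)
Definition nu (A : 'M[k']_n) : nat :=
  xget 1%N [set N | exists2 d, elementary_divisors A d &
    N = (q ^ \sum_i (if d i is Some (Negz m) then m.+1 else 0))%N].

Variables (mu : {measure set herm_borel -> \bar R}) (psi : k -> R[i]) (T : H).

Definition siegel_integral (s : R[i]) (e : nat) : R[i] :=
  cintegral mu [set A | herm_ge (- e%:Z) A]
    (fun A => cpow (nu (\val A))%:R (- s) *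
              psi (in_base (\tr (\val T *m \val A)))).

(* P(q^{-s}) / Q(q^{-s}) is the meromorphic continuation of the Siegel series.
   The rational function P / Q is determined by T: its values at all small
   nonzero complex numbers are prescribed. *)
Definition siegel_continuation (P Q : {poly R[i]}) : Prop :=
  Q != 0 /\ exists sigma : R, forall s : R[i], sigma < complex.Re s ->
    Q.[cpow q%:R (- s)] != 0 /\
    ccvg (siegel_integral s) (P.[cpow q%:R (- s)] / Q.[cpow q%:R (- s)]).

End SiegelSeries.

(* Main.v *)
From HB Require Import structures.
From mathcomp Require Import finmap fingroup perm.
Require Import Defs.
From mathcomp Require Import ring lra zify.

Set Implicit Arguments.
Unset Strict Implicit.
Unset Printing Implicit Defensive.

Local Open Scope classical_set_scope.
Local Open Scope ring_scope.

(* If T is not integral, translating R by an integral hermitian S with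
   psi(tr(TS)) <> 1 shows that the integrals vanish once e is large.  If T is
   integral, the integrals are finite sums B_n(T; X) of X^ord(R) psi(tr(TR))
   over H_n(k') / H_n(O), with X = q^-s and nu(R) = q^ord(R), and they are
   constant for large e, so that b(T; s) is a polynomial in X.

   T is equivalent to a diagonal matrix, and the functional equation follows by
   induction on n.  Put p = -q and T = t + T' with v(t) at least every valuation
   of T' and l' = v(det T').  A quadratic Gauss sum gives
     B_n(pi^2 t + T'; X) - B_n(t + T'; X)
       = p^l' B_(n-1)(T'; X) (B_1(pi^2 t; u) - B_1(t; u)),  u = p^(n-1) X,
   and the substitution R -> pi R pi in the first coordinate gives
     B_n(pi^2 t + T'; X) - x^2 B_n(t + T'; X)
       = (1 - X) (1 - p X) B_(n-1)(T'; q^2 X),  x = -p^n X.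
   Subtracting, (1 - x^2) B_n(t + T'; X) is expressed through B_(n-1)(T'; X) and
   B_(n-1)(T'; q^2 X), and the two functional equations of B_(n-1)(T') combine
   into that of B_n; a density argument removes the factor 1 - x^2. *)

(** * Sums over finite quotients of abelian groups *)

(** That v(t) dominates the valuations of T' serves both relations. A corner r that distinguishes t
    from pi^2 t has a denominator beyond pi^v(t), hence beyond the elementary divisors of T', so
    that the off-diagonal rows sum to a complete Gauss sum. In the dilation relation the mean of
    psi(pi^2 t S[c]) over integral columns c appears; it differs from 1 only at S whose denominator
    is large compared with T', and there the averaging of [hsum_vanish] permits replacing it by 1.
    The induction closes because duality shifts with the size. If Xt = q^(-2n) / X is the dual of X
    in size n, the equation in size n - 1 pairs q^2 X with Xt, and X with q^2 Xt. It therefore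
    exchanges the two terms in the expression of B_n, while x becomes 1 / x. The sign in p = -q
    comes from the norm form of the unramified extension, which is anisotropic modulo pi. Odd
    residual characteristic makes 2 a unit; this gives integral diagonalization of hermitian
    matrices and integral coordinates of k' over k. *)

Section CosetReps.
Variable V : zmodType.
Implicit Types A B : {pred V}.

(** [choose] returns the same element for extensionally equal predicates, so for a subgroup B the
    representative depends only on the coset of x. *)
Definition coset_rep B (x : V) : V := choose [pred y | y - x \in B] x.

Definition coset_reps_set A B : set V := [set coset_rep B x | x in [set x | x \in A]].

Definition fin_index A B : Prop := finite_set (coset_reps_set A B).

Definition coset_reps A B : seq V := fset_set (coset_reps_set A B).

Lemma coset_reps_uniq A B : uniq (coset_reps A B).
Proof. exact: fset_uniq. Qed.

(* The sum of f over A / B, meant for B-invariant f; it is 0 when A / B is infinite. *)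
Definition qsum (W : nmodType) A B (f : V -> W) : W :=
  \sum_(x <- coset_reps A B) f x.

End CosetReps.

Section CosetRepsTheory.
Variable V : zmodType.
Implicit Types A B C : zmodClosed V.

Lemma coset_repP B x : coset_rep B x - x \in B.
Proof.
rewrite /coset_rep.
by apply: (@chooseP _ [pred y | y - x \in B] x); rewrite inE subrr rpred0.
Qed.

Lemma coset_rep_eq B x y : x - y \in B -> coset_rep B x = coset_rep B y.
Proof.
move=> xyB; rewrite /coset_rep.
have e : [pred z | z - x \in B] =1 [pred z | z - y \in B].
  move=> z /=; have -> : z - y = (z - x) + (x - y) by rewrite addrA subrK.
  rewrite [in RHS]rpredDr //.
rewrite (eq_choose e); apply: (@choose_id _ [pred z | z - y \in B]) => //=.
by rewrite subrr rpred0.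
Qed.

Lemma coset_rep_inj B x y : coset_rep B x = coset_rep B y -> x - y \in B.
Proof.
move=> e; have := coset_repP B x; have := coset_repP B y; rewrite -e => h1 h2.
have -> : x - y = (coset_rep B x - y) - (coset_rep B x - x).
  by rewrite opprB [RHS]addrC addrA subrK.
exact: rpredB.
Qed.

Lemma coset_rep_in A B x : {subset B <= A} -> x \in A -> coset_rep B x \in A.
Proof.
move=> sBA xA; rewrite -[coset_rep B x](subrK x) rpredD //.
exact/sBA/coset_repP.
Qed.

Lemma fin_index_cover A B (s : seq V) :
  (forall x, x \in A -> exists2 y, y \in s & x - y \in B) -> fin_index A B.
Proof.
move=> cov; apply: (@sub_finite_set _ _ [set` map (coset_rep B) s]); last first.
  exact: finite_seq.
move=> _ [x xA <-] /=; have [y ys xy] := cov x xA.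
by rewrite (coset_rep_eq xy); apply: map_f.
Qed.

Lemma coset_repsP A B x : fin_index A B ->
  reflect (exists2 y, y \in A & x = coset_rep B y) (x \in coset_reps A B).
Proof.
move=> fAB; rewrite /coset_reps in_fset_set //.
apply: (iffP idP); first by rewrite inE => -[y yA <-]; exists y.
by move=> [y yA ->]; rewrite inE; exists y.
Qed.

Lemma coset_reps_sub A B x : fin_index A B -> {subset B <= A} ->
  x \in coset_reps A B -> x \in A.
Proof. by move=> fAB sBA /(coset_repsP _ fAB)[y yA ->]; exact: coset_rep_in. Qed.

Lemma coset_reps_eq A B x y : fin_index A B ->
  x \in coset_reps A B -> y \in coset_reps A B -> x - y \in B -> x = y.
Proof.
move=> fAB /(coset_repsP _ fAB)[a aA ->] /(coset_repsP _ fAB)[b bA ->] h.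
rewrite -[LHS](coset_rep_eq (coset_repP B a)) -[RHS](coset_rep_eq (coset_repP B b)).
exact: coset_rep_eq.
Qed.

Lemma fin_index_seq A B : fin_index A B ->
  exists s : seq V, forall x, x \in A -> exists2 y, y \in s & x - y \in B.
Proof.
move=> fAB; exists (coset_reps A B) => x xA; exists (coset_rep B x).
  by apply/coset_repsP => //; exists x.
by rewrite -opprB rpredN coset_repP.
Qed.

Lemma fin_index_sub (A A' B B' : zmodClosed V) :
  {subset A' <= A} -> {in A', forall x, x \in B -> x \in B'} ->
  fin_index A B -> fin_index A' B'.
Proof.
move=> sA sB /fin_index_seq[s hs].
(* The entries of s may lie outside A'. Each is replaced by an element of A' in its coset of B; the
   default 0 is harmless where there is none. *)
pose g (y : V) := xget 0 [set x | x \in A' /\ x - y \in B].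
apply: (@fin_index_cover _ _ (map g s)) => x xA'.
have [y ys xy] := hs _ (sA _ xA'); exists (g y); first exact: map_f.
have [gA gy] : [set x | x \in A' /\ x - y \in B] (g y).
  by apply: (@xgetPex _ 0); exists x.
apply: sB; first exact: rpredB.
have -> : x - g y = (x - y) - (g y - y) by rewrite opprB addrA subrK.
exact: rpredB.
Qed.

Lemma fin_index_tower A B C : fin_index A B -> fin_index B C -> fin_index A C.
Proof.
move=> /fin_index_seq[s hs] /fin_index_seq[t ht].
apply: (@fin_index_cover _ _ [seq x + y | x <- s, y <- t]) => x xA.
have [y ys xy] := hs _ xA; have [z zt yz] := ht _ xy.
by exists (y + z); [exact: allpairs_f | rewrite opprD addrA].
Qed.

End CosetRepsTheory.

Lemma fin_index_image (V V2 : zmodType) (A B : zmodClosed V)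
    (A2 B2 : zmodClosed V2) (phi : V -> V2) :
  (forall x y, x \in A -> y \in A -> x - y \in B -> phi x - phi y \in B2) ->
  {subset B <= A} ->
  (forall z, z \in A2 -> exists2 x, x \in A & z - phi x \in B2) ->
  fin_index A B -> fin_index A2 B2.
Proof.
move=> h1 sBA h2 fAB.
apply: (@fin_index_cover _ _ _ (map phi (coset_reps A B))) => z /h2[x xA zx].
have rA : coset_rep B x \in A by exact: coset_rep_in.
exists (phi (coset_rep B x)).
  by apply/map_f/coset_repsP => //; exists x.
rewrite -[z](subrK (phi x)) -addrA rpredD // h1 //.
by rewrite -opprB rpredN coset_repP.
Qed.

Section QSum.
Variables (V : zmodType) (W : nmodType).
Implicit Types A B C : zmodClosed V.

Lemma qsum_pred (A A' B B' : zmodClosed V) (f : V -> W) :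
  A =i A' -> B =i B' -> qsum A B f = qsum A' B' f.
Proof.
move=> eA eB; rewrite /qsum /coset_reps; congr (\sum_(x <- _) _).
congr (fset_set _ : seq V); rewrite /coset_reps_set.
have -> : [set x | x \in A] = [set x | x \in A'].
  by apply/seteqP; split=> x /=; rewrite eA.
apply: eq_imagel => x _; by apply: eq_choose => y /=; rewrite eB.
Qed.

Lemma eq_qsum A B (f g : V -> W) : fin_index A B -> {subset B <= A} ->
  {in A, f =1 g} -> qsum A B f = qsum A B g.
Proof.
move=> fAB sBA fg; apply: eq_big_seq => x /(coset_repsP _ fAB)[y yA ->].
by apply: fg; exact: coset_rep_in.
Qed.

Lemma eq_qsumr A B (f g : V -> W) :
  (forall x, f x = g x) -> qsum A B f = qsum A B g.
Proof. by move=> fg; apply: eq_bigr => x _. Qed.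

Lemma qsumD A B (f g : V -> W) :
  qsum A B (fun x => f x + g x) = qsum A B f + qsum A B g.
Proof. exact: big_split. Qed.

Lemma qsum0 A B : qsum A B (fun _ => 0 : W) = 0.
Proof. exact: big1. Qed.

End QSum.

Section QSumReindex.
Variables (V1 V2 V : zmodType) (W : nmodType).

(* Covers both a tower of subgroups (phi x y = x + y) and a product. *)
Lemma qsum_fiber (A1 B1 : zmodClosed V1) (A2 B2 : zmodClosed V2)
    (A B : zmodClosed V) (phi : V1 -> V2 -> V) (f : V -> W) :
  {subset B1 <= A1} -> {subset B2 <= A2} ->
  fin_index A1 B1 -> fin_index A2 B2 -> fin_index A B ->
  (forall x y, x \in A1 -> y \in A2 -> phi x y \in A) ->
  (forall x, x \in A -> exists2 x1, x1 \in A1 & forall y1, y1 \in A1 ->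
     y1 - x1 \in B1 -> exists2 x2, x2 \in A2 & x - phi y1 x2 \in B) ->
  (forall x1 x2 y1 y2, x1 \in A1 -> y1 \in A1 -> x2 \in A2 -> y2 \in A2 ->
     phi x1 x2 - phi y1 y2 \in B -> x1 - y1 \in B1) ->
  (forall x1 x2 y2, x1 \in A1 -> x2 \in A2 -> y2 \in A2 ->
     (phi x1 x2 - phi x1 y2 \in B) = (x2 - y2 \in B2)) ->
  (forall x y, x \in A -> y \in B -> f (x + y) = f x) ->
  qsum A B f = qsum A1 B1 (fun x => qsum A2 B2 (fun y => f (phi x y))).
Proof.
move=> s1 s2 f1 f2 fA pA pE p1 p2 fB.
have finv x : x \in A -> f (coset_rep B x) = f x.
  by move=> xA; rewrite -[coset_rep B x](subrK x) addrC fB // coset_repP.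
pose g (z : V1 * V2) := coset_rep B (phi z.1 z.2).
pose s := [seq (i1, i2) | i1 <- coset_reps A1 B1, i2 <- coset_reps A2 B2].
have sP z : z \in s -> [/\ z.1 \in coset_reps A1 B1 & z.2 \in coset_reps A2 B2].
  by case/allpairsP=> -[a b] /= [? ? ->].
have in1 x : x \in coset_reps A1 B1 -> x \in A1 by exact: coset_reps_sub.
have in2 x : x \in coset_reps A2 B2 -> x \in A2 by exact: coset_reps_sub.
have us : uniq s.
  by apply: allpairs_uniq; rewrite ?coset_reps_uniq // => -[a b] [c d].
transitivity (\sum_(x <- map g s) f x).
  apply: perm_big; apply: uniq_perm; first exact: coset_reps_uniq.
    rewrite map_inj_in_uniq // => -[a b] [c d] /sP[/= a1 b2] /sP[/= c1 d2].
    rewrite /g /= => /coset_rep_inj h.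
    have ac : a = c.
      by apply: (coset_reps_eq f1) => //; apply: p1 h; auto.
    by move: h; rewrite -ac p2; auto => /(coset_reps_eq f2 b2 d2) ->.
  move=> x; apply/idP/idP.
    case/(coset_repsP _ fA)=> y yA ->; have [x1 x1A hx1] := pE y yA.
    have r1 : coset_rep B1 x1 \in A1 by exact: coset_rep_in.
    have [x2 x2A hx2] := hx1 _ r1 (coset_repP B1 x1).
    have r2 : coset_rep B2 x2 \in A2 by exact: coset_rep_in.
    apply/mapP; exists (coset_rep B1 x1, coset_rep B2 x2).
      by apply: allpairs_f; apply/coset_repsP => //; [exists x1 | exists x2].
    rewrite /g /=; apply: coset_rep_eq.
    rewrite -(subrK (phi (coset_rep B1 x1) x2) y) -addrA rpredD // p2 //.
    by rewrite -opprB rpredN coset_repP.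
  case/mapP=> -[a b] /sP[/= /in1 a1 /in2 b2] ->; apply/coset_repsP => //.
  by exists (phi a b) => //; exact: pA.
rewrite big_map big_seq.
transitivity (\sum_(z <- s | z \in s) f (phi z.1 z.2)).
  by apply: eq_bigr => -[a b] /sP[/= /in1 a1 /in2 b2]; rewrite /g finv //=; exact: pA.
by rewrite -big_seq /s big_allpairs /= /qsum.
Qed.

End QSumReindex.

Section QSumTheory.
Variables (W : nmodType).

Lemma qsum_tower (V : zmodType) (A B C : zmodClosed V) (f : V -> W) :
  {subset C <= B} -> {subset B <= A} -> fin_index A B -> fin_index B C ->
  (forall x y, x \in A -> y \in C -> f (x + y) = f x) ->
  qsum A C f = qsum A B (fun x => qsum B C (fun y => f (x + y))).
Proof.
move=> sCB sBA fAB fBC fC.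
apply: qsum_fiber => //.
- exact: fin_index_tower fAB fBC.
- by move=> x y xA /sBA yA; exact: rpredD.
- move=> x xA; exists x => // y yA yx; exists (x - y).
    by rewrite -opprB rpredN.
  by rewrite [y + _]addrC subrK subrr rpred0.
- move=> x1 x2 y1 y2 _ _ x2B y2B; rewrite opprD addrACA => /sCB h.
  by rewrite -[x1 - y1](addrK (x2 - y2)) rpredB // rpredB.
- by move=> x1 x2 y2 _ _ _; rewrite opprD addrACA subrr add0r.
Qed.

Lemma qsum_reindex (V V2 : zmodType) (A B : zmodClosed V)
    (A2 B2 : zmodClosed V2) (phi : V -> V2) (f : V2 -> W) :
  {subset B <= A} -> fin_index A B ->
  (forall x, x \in A -> phi x \in A2) ->
  (forall x y, x \in A -> y \in A -> (phi x - phi y \in B2) = (x - y \in B)) ->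
  (forall z, z \in A2 -> exists2 x, x \in A & z - phi x \in B2) ->
  (forall x y, x \in A2 -> y \in B2 -> f (x + y) = f x) ->
  qsum A2 B2 f = qsum A B (fun x => f (phi x)).
Proof.
move=> sBA fAB pA pB pE fB.
have fA2 : fin_index A2 B2.
  by apply: (@fin_index_image _ _ A B A2 B2 phi) => // x y xA yA; rewrite pB.
have finv x : x \in A2 -> f (coset_rep B2 x) = f x.
  by move=> xA; rewrite -[coset_rep B2 x](subrK x) addrC fB // coset_repP.
have inA x : x \in coset_reps A B -> x \in A by exact: coset_reps_sub.
transitivity (\sum_(x <- map (fun x => coset_rep B2 (phi x)) (coset_reps A B)) f x).
  apply: perm_big; apply: uniq_perm; first exact: coset_reps_uniq.
    rewrite map_inj_in_uniq ?coset_reps_uniq // => x y xs ys /coset_rep_inj.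
    by rewrite pB ?inA //; exact: (coset_reps_eq fAB xs ys).
  move=> x; apply/idP/idP.
    case/(coset_repsP _ fA2)=> y yA ->; have [z zA yz] := pE y yA.
    apply/mapP; exists (coset_rep B z); first by apply/coset_repsP => //; exists z.
    apply: coset_rep_eq; have rA : coset_rep B z \in A by exact: coset_rep_in.
    rewrite -(subrK (phi z) y) -addrA rpredD // pB //.
    by rewrite -opprB rpredN coset_repP.
  by case/mapP=> y /inA /pA yA ->; apply/coset_repsP => //; exists (phi y).
rewrite big_map big_seq [in RHS]/qsum [in RHS]big_seq; apply: eq_bigr => x /inA /pA.
exact: finv.
Qed.

Lemma qsum_translate (V : zmodType) (A B : zmodClosed V) (x0 : V) (f : V -> W) :
  {subset B <= A} -> fin_index A B -> x0 \in A ->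
  (forall x y, x \in A -> y \in B -> f (x + y) = f x) ->
  qsum A B f = qsum A B (fun x => f (x + x0)).
Proof.
move=> sBA fAB x0A fB; apply: qsum_reindex => //.
- by move=> x xA; exact: rpredD.
- by move=> x y _ _; rewrite opprD addrACA subrr addr0.
- by move=> z zA; exists (z - x0); [exact: rpredB | rewrite subrK subrr rpred0].
Qed.

Lemma qsum_restrict (V : zmodType) (A A' B : zmodClosed V) (f : V -> W) :
  {subset B <= A'} -> {subset A' <= A} -> fin_index A B ->
  (forall x, x \in A -> x \notin A' -> f x = 0) ->
  qsum A B f = qsum A' B f.
Proof.
move=> sB sA fAB f0.
have fA' : fin_index A' B by apply: fin_index_sub fAB.
rewrite /qsum (bigID [pred x | x \in A']) /= [X in _ + X]big1_seq ?addr0; last first.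
  move=> x /andP[xA' xs]; apply: f0 => //; apply: coset_reps_sub xs => //.
  by move=> y /sB /sA.
rewrite -big_filter; apply: perm_big; apply: uniq_perm.
- by rewrite filter_uniq // coset_reps_uniq.
- exact: coset_reps_uniq.
move=> x; rewrite mem_filter; apply/andP/idP => [[/= xA']|xs].
  move/(coset_repsP _ fAB)=> [y yA xy]; apply/coset_repsP => //; exists y => //.
  by rewrite -[y](subKr x) rpredB // xy sB // coset_repP.
split=> /=; first by apply: coset_reps_sub xs.
by case/(coset_repsP _ fA'): xs => y yA ->; apply/coset_repsP => //; exists y => //; exact: sA.
Qed.

Lemma qsum_trivial (V : zmodType) (A B : zmodClosed V) (f : V -> W) :
  {subset A <= B} -> {subset B <= A} ->
  (forall x, x \in A -> f x = f 0) -> qsum A B f = f 0.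
Proof.
move=> sAB sBA h.
have fAB : fin_index A B.
  by apply: (@fin_index_cover _ _ _ [:: 0]) => x /sAB xA; exists 0; rewrite ?inE ?subr0.
rewrite /qsum (perm_big [:: coset_rep B 0]) /=.
  by rewrite big_seq1 h // coset_rep_in // rpred0.
apply: uniq_perm => //; first exact: coset_reps_uniq.
move=> x; rewrite inE; apply/idP/eqP => [|->].
  by case/(coset_repsP _ fAB)=> y yA ->; apply: coset_rep_eq; rewrite subr0 sAB.
by apply/coset_repsP => //; exists 0 => //; exact: rpred0.
Qed.

Lemma qsum_exchange (V V2 : zmodType) (A B : zmodClosed V) (A2 B2 : zmodClosed V2)
    (f : V -> V2 -> W) :
  qsum A B (fun x => qsum A2 B2 (fun y => f x y)) =
  qsum A2 B2 (fun y => qsum A B (fun x => f x y)).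
Proof. exact: exchange_big. Qed.

End QSumTheory.

Section PairIndex.
Variables V1 V2 : zmodType.

Definition pair_pred (A1 : {pred V1}) (A2 : {pred V2}) : {pred V1 * V2} :=
  [pred z | (z.1 \in A1) && (z.2 \in A2)].

Fact pair_zmod_closed (A1 : zmodClosed V1) (A2 : zmodClosed V2) :
  zmod_closed (pair_pred A1 A2).
Proof.
split=> [|x y /andP[x1 x2] /andP[y1 y2]]; first by rewrite inE /= !rpred0.
by rewrite inE /= !rpredB.
Qed.

HB.instance Definition _ (A1 : zmodClosed V1) (A2 : zmodClosed V2) :=
  GRing.isZmodClosed.Build (V1 * V2)%type (pair_pred A1 A2) (pair_zmod_closed A1 A2).

Lemma fin_index_pair (A1 B1 : zmodClosed V1) (A2 B2 : zmodClosed V2) :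
  fin_index A1 B1 -> fin_index A2 B2 -> fin_index (pair_pred A1 A2) (pair_pred B1 B2).
Proof.
move=> /fin_index_seq[s hs] /fin_index_seq[t ht].
apply: (@fin_index_cover _ _ _ [seq (x, y) | x <- s, y <- t]) => -[x y] /andP[/= xA yA].
have [a as_ xa] := hs _ xA; have [b bt yb] := ht _ yA.
by exists (a, b); [exact: allpairs_f | rewrite inE /= xa].
Qed.

Lemma qsum_pair (W : nmodType) (A1 B1 : zmodClosed V1) (A2 B2 : zmodClosed V2) (f : V1 * V2 -> W) :
  {subset B1 <= A1} -> {subset B2 <= A2} -> fin_index A1 B1 -> fin_index A2 B2 ->
  (forall x y, x \in pair_pred A1 A2 -> y \in pair_pred B1 B2 -> f (x + y) = f x) ->
  qsum (pair_pred A1 A2) (pair_pred B1 B2) f =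
  qsum A1 B1 (fun x => qsum A2 B2 (fun y => f (x, y))).
Proof.
move=> s1 s2 f1 f2 fB; apply: (@qsum_fiber _ _ _ _ A1 B1 A2 B2 _ _ (fun x y => (x, y))) => //.
- exact: fin_index_pair.
- by move=> x y xA yA; rewrite inE /= xA.
- move=> [x y] /andP[/= xA yA]; exists x => // x' x'A xx'; exists y => //.
  by rewrite inE /= subrr rpred0 andbT -opprB rpredN.
- by move=> x1 x2 y1 y2 _ _ _ _ /andP[].
- by move=> x1 x2 y2 _ _ _; rewrite inE /= subrr rpred0.
Qed.

End PairIndex.

Section QSumRing.
Variable W : pzRingType.

Lemma qsum_mulr (V : zmodType) (A B : zmodClosed V) (f : V -> W) (a : W) :
  qsum A B (fun x => a * f x) = a * qsum A B f.
Proof. by rewrite /qsum mulr_sumr. Qed.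

Lemma qsum_mull (V : zmodType) (A B : zmodClosed V) (f : V -> W) (a : W) :
  qsum A B (fun x => f x * a) = qsum A B f * a.
Proof. by rewrite /qsum mulr_suml. Qed.

Lemma qsumB (V : zmodType) (A B : zmodClosed V) (f g : V -> W) :
  qsum A B (fun x => f x - g x) = qsum A B f - qsum A B g.
Proof. by rewrite /qsum sumrB. Qed.

Lemma qsum_const (V : zmodType) (A B : zmodClosed V) (a : W) :
  qsum A B (fun=> a) = qsum A B (fun=> 1) * a.
Proof. by rewrite -qsum_mull; apply: eq_bigr => x _; rewrite mul1r. Qed.

End QSumRing.

Section QSumTwist.
Variable (W : idomainType).

(** Translation by x0 permutes the cosets and multiplies the sum by z. The vanishing of the
    character sums below is derived from this form of orthogonality. *)
Lemma qsum_twist0 (V : zmodType) (A B : zmodClosed V) (x0 : V) (z : W) (f : V -> W) :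
  {subset B <= A} -> fin_index A B -> x0 \in A ->
  (forall x y, x \in A -> y \in B -> f (x + y) = f x) ->
  (forall x, x \in A -> f (x + x0) = z * f x) -> z != 1 -> qsum A B f = 0.
Proof.
move=> sBA fAB x0A fB fx z1.
have : qsum A B f = z * qsum A B f.
  rewrite -qsum_mulr {1}(qsum_translate sBA fAB x0A fB).
  exact: eq_qsum.
move/eqP; rewrite -{1}[qsum A B f]mul1r -subr_eq0 -mulrBl mulf_eq0 subr_eq0.
by rewrite eq_sym (negPf z1) => /eqP.
Qed.

End QSumTwist.

(** * Balls of scalars and matrices *)

(* The base field is the fixed field of [hs_star]; [hs_theta] is a unit
   generating k' over k, of trace zero. *)
Record herm_setting : Type := HermSetting {
  hs_K : fieldType;
  hs_w : hs_K -> int;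
  hs_star : {rmorphism hs_K -> hs_K};
  hs_pi : hs_K;
  hs_theta : hs_K;
  hs_q : nat;
  hs_reps : seq hs_K;
  hs_C : numClosedFieldType;
  hs_psi : hs_K -> hs_C;
  hs_wM : forall x y, x != 0 -> y != 0 -> hs_w (x * y) = hs_w x + hs_w y;
  hs_wD : forall N x y, (x == 0) || (N <= hs_w x) -> (y == 0) || (N <= hs_w y) ->
    (x + y == 0) || (N <= hs_w (x + y));
  hs_starK : involutive hs_star;
  hs_w_star : forall x, hs_w (hs_star x) = hs_w x;
  hs_pi_neq0 : hs_pi != 0;
  hs_w_pi : hs_w hs_pi = 1;
  hs_star_pi : hs_star hs_pi = hs_pi;
  hs_2_neq0 : 2%:R != 0 :> hs_K;
  hs_w2 : hs_w 2%:R = 0;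
  hs_theta_neq0 : hs_theta != 0;
  hs_w_theta : hs_w hs_theta = 0;
  hs_star_theta : hs_star hs_theta = - hs_theta;
  hs_q_gt1 : (1 < hs_q)%N;
  hs_reps_uniq : uniq hs_reps;
  hs_reps_size : size hs_reps = hs_q;
  hs_reps_fixed : forall x, x \in hs_reps ->
    hs_star x = x /\ (x == 0) || (0 <= hs_w x);
  hs_reps_inj : forall x y, x \in hs_reps -> y \in hs_reps ->
    (x - y == 0) || (1 <= hs_w (x - y)) -> x = y;
  hs_reps_cover : forall x, hs_star x = x -> (x == 0) || (0 <= hs_w x) ->
    exists2 y, y \in hs_reps & (x - y == 0) || (1 <= hs_w (x - y));
  hs_psiD : forall x y, hs_star x = x -> hs_star y = y ->
    hs_psi (x + y) = hs_psi x * hs_psi y;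
  hs_psi_norm : forall x, hs_star x = x -> `|hs_psi x| = 1;
  hs_psi_int : forall x, hs_star x = x -> (x == 0) || (0 <= hs_w x) -> hs_psi x = 1;
  hs_psi_nontrivial : exists x, [/\ hs_star x = x, (x == 0) || (-1 <= hs_w x) &
    hs_psi x != 1] }.

Section Balls.
Variable D : herm_setting.
Local Notation K := (hs_K D).
Local Notation w := (@hs_w D).
Local Notation star := (@hs_star D).
Local Notation pi := (hs_pi D).
Local Notation theta := (hs_theta D).

Definition pball (N : int) : {pred K} := [pred x | (x == 0) || (N <= w x)].

Lemma w1 : w 1 = 0.
Proof.
have := @hs_wM D 1 1 (oner_neq0 _) (oner_neq0 _); rewrite mulr1.
by move/eqP; rewrite -subr_eq0 opprD addrA subrr sub0r oppr_eq0 => /eqP.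
Qed.

Lemma wN x : w (- x) = w x.
Proof.
have [->|x0] := eqVneq x 0; first by rewrite oppr0.
have m1 : (-1 : K) != 0 by rewrite oppr_eq0 oner_neq0.
have wm1 : w (-1) = 0.
  have := @hs_wM D (-1) (-1) m1 m1; rewrite mulrNN mulr1 w1 => /esym/eqP.
  by rewrite -mulr2n mulrn_eq0 /= => /eqP.
by rewrite -mulN1r hs_wM // wm1 add0r.
Qed.

Lemma wV x : x != 0 -> w x^-1 = - w x.
Proof.
move=> x0; apply/eqP; rewrite -addr_eq0 -hs_wM ?invr_eq0 // mulVf //.
by rewrite w1.
Qed.

Fact pball_zmod_closed N : zmod_closed (pball N).
Proof.
split=> [|x y]; first by rewrite inE eqxx.
rewrite !inE => hx hy; apply: hs_wD => //.
by rewrite oppr_eq0 wN.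
Qed.

HB.instance Definition _ N := GRing.isZmodClosed.Build K (pball N) (pball_zmod_closed N).

Lemma in_pball N x : (x \in pball N) = (x == 0) || (N <= w x).
Proof. by []. Qed.

Lemma pball_w x : x \in pball (w x).
Proof. by rewrite in_pball lexx orbT. Qed.

Lemma pball_mono M N : N <= M -> {subset pball M <= pball N}.
Proof.
move=> NM x; rewrite !in_pball => /orP[->//|h]; apply/orP; right.
exact: le_trans h.
Qed.

Lemma pballM M N x y : x \in pball M -> y \in pball N -> x * y \in pball (M + N).
Proof.
rewrite !in_pball; have [->|x0] /= := eqVneq x 0; first by rewrite mul0r eqxx.
have [->|y0] /= := eqVneq y 0; first by rewrite mulr0 eqxx.
by move=> hx hy; rewrite hs_wM // lerD // orbT.
Qed.

Lemma pball0M x y N : x \in pball 0 -> y \in pball N -> x * y \in pball N.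
Proof. by move=> hx hy; rewrite -[N]add0r; exact: pballM. Qed.

Lemma pballM0 x y N : x \in pball N -> y \in pball 0 -> x * y \in pball N.
Proof. by move=> hx hy; rewrite mulrC; exact: pball0M. Qed.

Lemma pball1 : 1 \in pball 0. Proof. by rewrite in_pball w1 lexx orbT. Qed.

Lemma pball_star N x : (star x \in pball N) = (x \in pball N).
Proof. by rewrite !in_pball hs_w_star fmorph_eq0. Qed.

Lemma pball_mulE N x y : x != 0 -> (x * y \in pball (w x + N)) = (y \in pball N).
Proof.
move=> x0; rewrite !in_pball mulf_eq0 (negPf x0) /=.
by have [->|y0] //= := eqVneq y 0; rewrite hs_wM // lerD2l.
Qed.

Lemma piX_neq0 (z : int) : pi ^ z != 0. Proof. exact/expfz_neq0/hs_pi_neq0. Qed.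

Lemma w_piX (z : int) : w (pi ^ z) = z.
Proof.
have h (m : nat) : w (pi ^+ m) = m%:Z.
  elim: m => [|m IH]; first by rewrite expr0 w1.
  by rewrite exprS hs_wM ?expf_neq0 ?hs_pi_neq0 // IH hs_w_pi.
case: z => m; first exact: h.
by rewrite NegzE -exprnN wV ?expf_neq0 ?hs_pi_neq0 // h.
Qed.

Lemma star_piX (z : int) : star (pi ^ z) = pi ^ z.
Proof. by rewrite rmorphXz ?unitfE ?hs_pi_neq0 // hs_star_pi. Qed.

Lemma pball_piX (z N : int) x : (pi ^ z * x \in pball N) = (x \in pball (N - z)).
Proof. by have := @pball_mulE (N - z) (pi ^ z) x (piX_neq0 z); rewrite w_piX addrC subrK. Qed.

Lemma piX_ball (z : int) : pi ^ z \in pball z.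
Proof. by rewrite -{2}(w_piX z) pball_w. Qed.

Lemma pball_half N x : (2%:R^-1 * x \in pball N) = (x \in pball N).
Proof.
have := @pball_mulE N 2%:R^-1 x; rewrite invr_eq0 => /(_ (hs_2_neq0 D)).
by rewrite wV ?hs_2_neq0 // hs_w2 oppr0 add0r.
Qed.

Lemma star_half : star 2%:R^-1 = 2%:R^-1.
Proof. by rewrite fmorphV rmorph_nat. Qed.

Definition fball (N : int) : {pred K} := [pred x | (star x == x) && (x \in pball N)].

Fact fball_zmod_closed N : zmod_closed (fball N).
Proof.
split=> [|x y]; first by rewrite inE rmorph0 eqxx rpred0.
rewrite !inE => /andP[/eqP sx hx] /andP[/eqP sy hy].
by rewrite rmorphB sx sy eqxx; exact: (@rpredB _ (pball N)).
Qed.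

HB.instance Definition _ N := GRing.isZmodClosed.Build K (fball N) (fball_zmod_closed N).

Lemma in_fball N x : (x \in fball N) = (star x == x) && (x \in pball N).
Proof. by []. Qed.

Lemma fball_fix N x : x \in fball N -> star x = x.
Proof. by case/andP=> /eqP. Qed.

Lemma fball_pball N x : x \in fball N -> x \in pball N.
Proof. by case/andP. Qed.

Lemma fball_mono M N : N <= M -> {subset fball M <= fball N}.
Proof. by move=> NM x /andP[sx hx]; rewrite in_fball sx; exact: pball_mono hx. Qed.

Lemma fball_piX (z N : int) x : (pi ^ z * x \in fball N) = (x \in fball (N - z)).
Proof.
by rewrite !in_fball pball_piX rmorphM /= star_piX (inj_eq (mulfI (piX_neq0 z))).
Qed.

Definition adjmx m n (A : 'M[K]_(m, n)) : 'M[K]_(n, m) := map_mx star A^T.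

Lemma adjmxE m n (A : 'M[K]_(m, n)) i j : adjmx A i j = star (A j i).
Proof. by rewrite !mxE. Qed.

Lemma adjmxK m n (A : 'M[K]_(m, n)) : adjmx (adjmx A) = A.
Proof. by apply/matrixP=> i j; rewrite !adjmxE hs_starK. Qed.

Lemma adjmxM m n p (A : 'M[K]_(m, n)) (B : 'M[K]_(n, p)) :
  adjmx (A *m B) = adjmx B *m adjmx A.
Proof. by rewrite /adjmx trmx_mul map_mxM. Qed.

Lemma adjmxD m n (A B : 'M[K]_(m, n)) : adjmx (A + B) = adjmx A + adjmx B.
Proof. by apply/matrixP=> i j; rewrite !mxE rmorphD. Qed.

Lemma adjmxB m n (A B : 'M[K]_(m, n)) : adjmx (A - B) = adjmx A - adjmx B.
Proof. by apply/matrixP=> i j; rewrite !mxE rmorphB. Qed.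

Lemma adjmx0 m n : adjmx (0 : 'M[K]_(m, n)) = 0.
Proof. by apply/matrixP=> i j; rewrite !mxE rmorph0. Qed.

Lemma adjmxZ m n a (A : 'M[K]_(m, n)) : adjmx (a *: A) = star a *: adjmx A.
Proof. by apply/matrixP=> i j; rewrite !mxE rmorphM. Qed.

Lemma adjmx_scalar n a : adjmx (a%:M : 'M[K]_n) = (star a)%:M.
Proof. by rewrite /adjmx tr_scalar_mx map_scalar_mx. Qed.

Lemma adjmx1 n : adjmx (1%:M : 'M[K]_n) = 1%:M.
Proof. by rewrite adjmx_scalar (rmorph1 star). Qed.

Lemma adjmx_inv n (A : 'M[K]_n) : adjmx (invmx A) = invmx (adjmx A).
Proof. by rewrite /adjmx trmx_inv map_invmx. Qed.

Lemma adjmx_unit n (A : 'M[K]_n) : (adjmx A \in unitmx) = (A \in unitmx).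
Proof. by rewrite /adjmx map_unitmx unitmx_tr. Qed.

Lemma adjmx_diag n (d : 'rV[K]_n) : adjmx (diag_mx d) = diag_mx (map_mx star d).
Proof. by rewrite /adjmx tr_diag_mx map_diag_mx. Qed.

Lemma adjmx_block m1 m2 n1 n2 (A : 'M[K]_(m1, n1)) (B : 'M[K]_(m1, n2)) (C : 'M[K]_(m2, n1)) (E : 'M[K]_(m2, n2)) :
  adjmx (block_mx A B C E) = block_mx (adjmx A) (adjmx C) (adjmx B) (adjmx E).
Proof. by rewrite /adjmx tr_block_mx map_block_mx. Qed.

Lemma tr_adj n (A : 'M[K]_n) : \tr (adjmx A) = star (\tr A).
Proof. by rewrite /adjmx trace_map_mx mxtrace_tr. Qed.

Definition mball m n (N : int) : {pred 'M[K]_(m, n)} :=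
  [pred A : 'M[K]_(m, n) | [forall i, forall j, A i j \in pball N]].
Arguments mball : clear implicits.

Lemma mballP m n N (A : 'M[K]_(m, n)) :
  reflect (forall i j, A i j \in pball N) (A \in mball m n N).
Proof.
apply: (iffP forallP) => h i; first by move=> j; exact: (forallP (h i)).
by apply/forallP.
Qed.

Fact mball_zmod_closed m n N : zmod_closed (mball m n N).
Proof.
split=> [|A B /mballP hA /mballP hB]; apply/mballP=> i j; rewrite !mxE ?rpred0 //.
exact: (@rpredB _ (pball N)).
Qed.

HB.instance Definition _ m n N :=
  GRing.isZmodClosed.Build 'M[K]_(m, n) (mball m n N) (mball_zmod_closed m n N).

Lemma mball_mono m n M N : N <= M -> {subset mball m n M <= mball m n N}.
Proof. by move=> NM A /mballP hA; apply/mballP=> i j; exact: pball_mono (hA i j). Qed.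

Lemma mballM m n p M N (A : 'M[K]_(m, n)) (B : 'M[K]_(n, p)) :
  A \in mball m n M -> B \in mball n p N -> A *m B \in mball m p (M + N).
Proof.
move=> /mballP hA /mballP hB; apply/mballP=> i j; rewrite mxE.
by apply: (@rpred_sum _ (pball (M + N))) => l _; exact: pballM.
Qed.

Lemma mball0M m n p N (A : 'M[K]_(m, n)) (B : 'M[K]_(n, p)) :
  A \in mball m n 0 -> B \in mball n p N -> A *m B \in mball m p N.
Proof. by move=> hx hy; rewrite -[N]add0r; exact: mballM. Qed.

Lemma mballM0 m n p N (A : 'M[K]_(m, n)) (B : 'M[K]_(n, p)) :
  A \in mball m n N -> B \in mball n p 0 -> A *m B \in mball m p N.
Proof. by move=> hx hy; rewrite -[N]addr0; exact: mballM. Qed.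

Lemma mballZ m n M N a (A : 'M[K]_(m, n)) :
  a \in pball M -> A \in mball m n N -> a *: A \in mball m n (M + N).
Proof. by move=> ha /mballP hA; apply/mballP=> i j; rewrite mxE; exact: pballM. Qed.

Lemma mball_piX m n (z N : int) (A : 'M[K]_(m, n)) :
  (pi ^ z *: A \in mball m n N) = (A \in mball m n (N - z)).
Proof.
by apply/mballP/mballP => h i j; move: (h i j); rewrite mxE pball_piX.
Qed.

Lemma mball_adj m n N (A : 'M[K]_(m, n)) : (adjmx A \in mball n m N) = (A \in mball m n N).
Proof.
by apply/mballP/mballP => h i j; move: (h j i); rewrite adjmxE pball_star.
Qed.

Lemma mball_tr n N (A : 'M[K]_n) : A \in mball n n N -> \tr A \in pball N.
Proof. by move/mballP=> hA; apply: (@rpred_sum _ (pball N)). Qed.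

Lemma mball_block m1 m2 n1 n2 N (A : 'M[K]_(m1, n1)) (B : 'M[K]_(m1, n2)) (C : 'M[K]_(m2, n1)) (E : 'M[K]_(m2, n2)) :
  (block_mx A B C E \in mball _ _ N) =
  [&& A \in mball _ _ N, B \in mball _ _ N, C \in mball _ _ N & E \in mball _ _ N].
Proof.
apply/mballP/and4P => [h|[/mballP hA /mballP hB /mballP hC /mballP hE] i j].
  split; apply/mballP=> i j.
  - by move: (h (lshift _ i) (lshift _ j)); rewrite block_mxEul.
  - by move: (h (lshift _ i) (rshift _ j)); rewrite block_mxEur.
  - by move: (h (rshift _ i) (lshift _ j)); rewrite block_mxEdl.
  - by move: (h (rshift _ i) (rshift _ j)); rewrite block_mxEdr.
by case: (split_ordP i) => i' ->; case: (split_ordP j) => j' ->;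
  rewrite ?block_mxEul ?block_mxEur ?block_mxEdl ?block_mxEdr.
Qed.

Lemma mball_col m1 m2 n N (A : 'M[K]_(m1, n)) (B : 'M[K]_(m2, n)) :
  (col_mx A B \in mball _ _ N) = (A \in mball _ _ N) && (B \in mball _ _ N).
Proof.
apply/mballP/andP => [h|[/mballP hA /mballP hB] i j].
  split; apply/mballP=> i j.
  - by move: (h (lshift _ i) j); rewrite col_mxEu.
  - by move: (h (rshift _ i) j); rewrite col_mxEd.
by case: (split_ordP i) => i' ->; rewrite ?col_mxEu ?col_mxEd.
Qed.

Lemma mball_scalar n N a : a \in pball N -> (a%:M : 'M[K]_n) \in mball n n N.
Proof.
by move=> ha; apply/mballP=> i j; rewrite mxE; case: eqP; rewrite ?mulr1n ?mulr0n // rpred0.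
Qed.

Lemma mball_scalar1 N a : ((a%:M : 'M[K]_1) \in mball 1 1 N) = (a \in pball N).
Proof.
by apply/idP/idP => [/mballP/(_ 0 0)|]; [rewrite mxE mulr1n | exact: mball_scalar].
Qed.

Lemma mball1 n : (1%:M : 'M[K]_n) \in mball n n 0.
Proof. exact/mball_scalar/pball1. Qed.

Lemma mball_bound m n (A : 'M[K]_(m, n)) : exists e : nat, A \in mball m n (- e%:Z).
Proof.
exists (\sum_i \sum_j `|w (A i j)|%N)%N; apply/mballP=> i j.
apply: pball_mono (pball_w _).
rewrite (bigD1 i) //= (bigD1 j) //= -addnA.
apply: le_trans (_ : - `|w (A i j)|%:Z <= _).
  by rewrite lerN2 lez_nat leq_addr.
by rewrite abszE lerNl -normrN ler_norm.
Qed.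

Definition hball n (N : int) : {pred 'M[K]_n} :=
  [pred A : 'M[K]_n | (adjmx A == A) && (A \in mball n n N)].
Arguments hball : clear implicits.

Fact hball_zmod_closed n N : zmod_closed (hball n N).
Proof.
split=> [|A B]; first by rewrite inE adjmx0 eqxx rpred0.
move=> /andP[/eqP sx hx] /andP[/eqP sy hy].
by rewrite inE adjmxB sx sy eqxx; exact: (@rpredB _ (mball n n N)).
Qed.

HB.instance Definition _ n N :=
  GRing.isZmodClosed.Build 'M[K]_n (hball n N) (hball_zmod_closed n N).

Lemma in_hball n N (A : 'M[K]_n) : (A \in hball n N) = (adjmx A == A) && (A \in mball n n N).
Proof. by []. Qed.

Lemma hball_adj n N (A : 'M[K]_n) : A \in hball n N -> adjmx A = A.
Proof. by case/andP=> /eqP. Qed.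

Lemma hball_mball n N : {subset hball n N <= mball n n N}.
Proof. by move=> A /andP[]. Qed.

Lemma hball_mono n M N : N <= M -> {subset hball n M <= hball n N}.
Proof. by move=> NM A /andP[sx hx]; rewrite in_hball sx; exact: mball_mono hx. Qed.

Lemma hball_congr n m N (U : 'M[K]_(m, n)) (A : 'M[K]_n) :
  U \in mball m n 0 -> A \in hball n N -> U *m A *m adjmx U \in hball m N.
Proof.
move=> hU /andP[/eqP sA hA]; rewrite in_hball !adjmxM adjmxK sA mulmxA eqxx /=.
by apply: mballM0; [exact: mball0M | rewrite mball_adj].
Qed.

Definition gl n : {pred 'M[K]_n} :=
  [pred U : 'M[K]_n | [&& U \in unitmx, U \in mball n n 0 & invmx U \in mball n n 0]].
Arguments gl : clear implicits.

Lemma glP n (U : 'M[K]_n) :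
  reflect [/\ U \in unitmx, U \in mball n n 0 & invmx U \in mball n n 0] (U \in gl n).
Proof. exact: and3P. Qed.

Lemma gl1 n : 1%:M \in gl n.
Proof. by apply/glP; rewrite unitmx1 invmx1 mball1. Qed.

Lemma glV n (U : 'M[K]_n) : U \in gl n -> invmx U \in gl n.
Proof. by move=> /glP[h1 h2 h3]; apply/glP; rewrite unitmx_inv invmxK. Qed.

Lemma gl_adj n (U : 'M[K]_n) : U \in gl n -> adjmx U \in gl n.
Proof. by move=> /glP[h1 h2 h3]; apply/glP; rewrite adjmx_unit -adjmx_inv !mball_adj. Qed.

Lemma gl_intro n (U V : 'M[K]_n) :
  U *m V = 1%:M -> U \in mball n n 0 -> V \in mball n n 0 -> U \in gl n.
Proof.
move=> UV hU hV; have uU : U \in unitmx by case: (mulmx1_unit UV).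
apply/glP; split=> //; suff -> : invmx U = V by [].
by rewrite -[LHS]mulmx1 -UV mulmxA mulVmx // mul1mx.
Qed.

Lemma glM n (U V : 'M[K]_n) : U \in gl n -> V \in gl n -> U *m V \in gl n.
Proof.
move=> /glP[u1 u2 u3] /glP[v1 v2 v3].
apply: (@gl_intro _ _ (invmx V *m invmx U)); [|exact: mball0M..].
by rewrite mulmxA -(mulmxA U) mulmxV // mulmx1 mulmxV.
Qed.

Lemma gl_ball n (U : 'M[K]_n) : U \in gl n -> U \in mball n n 0.
Proof. by case/glP. Qed.

Lemma gl_unit n (U : 'M[K]_n) : U \in gl n -> U \in unitmx.
Proof. by case/glP. Qed.

Lemma gl_perm n (s : 'S_n) : perm_mx s \in gl n.
Proof.
have h (t : 'S_n) : perm_mx t \in mball n n 0.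
  apply/mballP=> i j; rewrite !mxE; case: eqP => _; rewrite ?rpred0 //.
  exact: pball1.
apply: (@gl_intro _ _ (perm_mx s^-1)%g) => //.
by rewrite -perm_mxM mulgV perm_mx1.
Qed.

Lemma det_ball n (A : 'M[K]_n) : A \in mball n n 0 -> \det A \in pball 0.
Proof.
move=> /mballP hA; rewrite /determinant; apply: (@rpred_sum _ (pball 0)) => s _.
have prodP (F : 'I_n -> K) : (forall i, F i \in pball 0) -> \prod_i F i \in pball 0.
  move=> hF; apply: (big_ind (fun x => x \in pball 0)) => //; first exact: pball1.
  by move=> *; exact: pball0M.
apply: pball0M; last exact: prodP.
by case: odd_perm; rewrite ?expr1 ?expr0 ?(@rpredN _ (pball 0)) pball1.
Qed.

(** By the adjugate formula: cofactors of an integral matrix are integral, and the determinant is a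
    unit. *)
Lemma gl_det n (A : 'M[K]_n) : A \in mball n n 0 -> \det A != 0 -> w (\det A) = 0 ->
  A \in gl n.
Proof.
move=> hA d0 wd; have uA : A \in unitmx by rewrite unitmxE unitfE.
apply/glP; split=> //; rewrite /invmx uA -[0]addr0; apply: mballZ.
  by rewrite in_pball wV // wd oppr0 lexx orbT.
apply/mballP=> i j; rewrite !mxE /cofactor; apply: pball0M.
  elim: (_ + _)%N => [|e IH]; first by rewrite expr0 pball1.
  by rewrite exprS mulN1r (@rpredN _ (pball 0)).
by apply: det_ball; move/mballP: hA => hA; apply/mballP=> a b; rewrite !mxE.
Qed.

Lemma w_add_small x y : x != 0 -> y \in pball (w x + 1) -> x + y != 0 /\ w (x + y) = w x.
Proof.
move=> x0 hy.
have notx : x \notin pball (w x + 1).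
  by rewrite in_pball (negPf x0) /= -ltNge ltrDl.
have nxy : x + y \notin pball (w x + 1) by rewrite (@rpredDr _ (pball (w x + 1))).
have hxy : x + y \in pball (w x).
  rewrite (@rpredD _ (pball (w x))) ?pball_w //; apply: pball_mono hy.
  by rewrite lerDl.
move: nxy hxy; rewrite !in_pball negb_or => /andP[h0 h1].
rewrite (negPf h0) /= => h2; split=> //; apply/eqP; rewrite eq_le h2 andbT.
by rewrite -ltzD1 ltNge.
Qed.

Lemma det_congr n (A B : 'M[K]_n) : A \in mball n n 0 -> B \in mball n n 0 ->
  A - B \in mball n n 1 -> \det A - \det B \in pball 1.
Proof.
move=> /mballP hA /mballP hB /mballP hAB; rewrite /determinant -sumrB.
apply: (@rpred_sum _ (pball 1)) => s _; rewrite -mulrBr; apply: pball0M.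
  by case: odd_perm; rewrite ?expr1 ?expr0 ?(@rpredN _ (pball 0)) pball1.
pose P (a b : K) := [/\ a \in pball 0, b \in pball 0 & a - b \in pball 1].
suff [] : P (\prod_i A i (s i)) (\prod_i B i (s i)) by [].
apply: (big_ind2 P).
- by split; rewrite ?pball1 // subrr rpred0.
- move=> a b c d [a1 b1 ab] [c1 d1 cd]; split; try exact: pball0M.
  have -> : a * c - b * d = a * (c - d) + (a - b) * d.
    by rewrite mulrBr mulrBl addrA subrK.
  by apply: (@rpredD _ (pball 1)); [exact: pball0M | exact: pballM0].
- by move=> i _; split=> //; have := hAB i (s i); rewrite !mxE.
Qed.

(** The determinant is congruent to 1 modulo pi, hence a unit. *)
Lemma gl_near1 n (Z : 'M[K]_n) : Z \in mball n n 1 -> 1%:M + Z \in gl n.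
Proof.
move=> hZ.
have h1 : 1%:M + Z \in mball n n 0.
  rewrite (@rpredD _ (mball n n 0)) ?mball1 //; exact: mball_mono hZ.
have := @det_congr _ (1%:M + Z) 1%:M h1 (mball1 n); rewrite addrC addKr det1 => /(_ hZ) h.
have [d0 wd] : \det (1%:M + Z) != 0 /\ w (\det (1%:M + Z)) = w 1.
  rewrite -[\det _](subrK 1) addrC; apply: w_add_small; first exact: oner_neq0.
  by rewrite w1 add0r.
by apply: gl_det => //; rewrite wd w1.
Qed.

End Balls.
Arguments mball {D} m n N.
Arguments hball {D} n N.
Arguments gl {D} n.
Arguments pball {D} N.
Arguments fball {D} N.

Lemma qsum_transversal (V : zmodType) (W : nmodType) (A B : zmodClosed V) (s : seq V) (f : V -> W) :
  uniq s -> {subset s <= A} -> {in s &, forall x y, x - y \in B -> x = y} ->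
  (forall x, x \in A -> exists2 y, y \in s & x - y \in B) ->
  (forall x y, x \in A -> y \in B -> f (x + y) = f x) ->
  qsum A B f = \sum_(x <- s) f x.
Proof.
move=> us sA sB cov fB; have fAB : fin_index A B by exact: fin_index_cover cov.
have finv x : x \in A -> f (coset_rep B x) = f x.
  by move=> xA; rewrite -[coset_rep B x](subrK x) addrC fB // coset_repP.
rewrite /qsum (perm_big (map (coset_rep B) s)) /=; last first.
  apply: uniq_perm; first exact: coset_reps_uniq.
    rewrite map_inj_in_uniq // => x y xs ys /coset_rep_inj; exact: sB.
  move=> x; apply/(coset_repsP _ fAB)/mapP => -[y yA ->].
    by have [z zs yz] := cov y yA; exists z => //; exact: coset_rep_eq.
  by exists y => //; exact: sA.
by rewrite big_map big_seq [RHS]big_seq; apply: eq_bigr => x /sA; exact: finv.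
Qed.

(** * Finiteness and cardinality of the quotients of balls *)

Section Finiteness.
Variable D : herm_setting.
Local Notation K := (hs_K D).
Local Notation C := (hs_C D).
Local Notation w := (@hs_w D).
Local Notation star := (@hs_star D).
Local Notation pi := (hs_pi D).
Local Notation theta := (hs_theta D).
Local Notation q := (hs_q D).

Lemma fin_fball01 : fin_index (fball 0 : {pred K}) (fball 1).
Proof.
apply: (@fin_index_cover _ _ _ (hs_reps D)) => x /andP[/eqP sx hx].
have [y ys xy] := hs_reps_cover sx hx; exists y => //.
have [sy hy] := hs_reps_fixed ys.
by rewrite in_fball rmorphB /= sx sy eqxx.
Qed.

Lemma count_fball01 : qsum (fball 0 : {pred K}) (fball 1) (fun=> 1 : C) = q%:R.
Proof.
rewrite (@qsum_transversal _ _ _ _ (hs_reps D)) //.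
- by rewrite big_const_seq count_predT hs_reps_size iter_addr_0.
- exact: hs_reps_uniq.
- by move=> x /hs_reps_fixed[sx hx]; rewrite in_fball sx eqxx.
- by move=> x y xs ys /andP[_]; exact: hs_reps_inj.
- move=> x /andP[/eqP sx hx].
  have [y ys xy] := hs_reps_cover sx hx; exists y => //.
  have [sy hy] := hs_reps_fixed ys.
  by rewrite in_fball rmorphB /= sx sy eqxx.
Qed.

Lemma qsum_fball_shift (W : nmodType) (M N z : int) (f : K -> W) :
  M <= N -> fin_index (fball M : {pred K}) (fball N) ->
  (forall x y, x \in fball (M + z) -> y \in fball (N + z) -> f (x + y) = f x) ->
  qsum (fball (M + z)) (fball (N + z)) f = qsum (fball M) (fball N) (fun x => f (pi ^ z * x)).
Proof.
move=> MN fMN fB; apply: qsum_reindex => //.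
- exact: fball_mono.
- by move=> x hx; rewrite fball_piX addrK.
- by move=> x y _ _; rewrite -mulrBr fball_piX addrK.
- move=> x hx; exists (pi ^ (- z) * x); first by rewrite fball_piX opprK.
  by rewrite mulrA -expfzDr ?hs_pi_neq0 // subrr expr0z mul1r subrr rpred0.
Qed.

(** Each layer is a dilate of O / pi O, and a tower of |N - M| layers ends inside the ball of
    exponent N, whichever of M and N is larger. *)
Lemma fin_fball M N : fin_index (fball M : {pred K}) (fball N).
Proof.
have step z : fin_index (fball z : {pred K}) (fball (z + 1)).
  apply: (@fin_index_image _ _ (fball 0) (fball 1) _ _ (fun x => pi ^ z * x)).
  - by move=> x y _ _ h; rewrite -mulrBr fball_piX addrAC subrr add0r.
  - exact: fball_mono.
  - move=> x hx; exists (pi ^ (- z) * x); first by rewrite fball_piX sub0r opprK.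
    by rewrite mulrA -expfzDr ?hs_pi_neq0 // subrr expr0z mul1r subrr rpred0.
  - exact: fin_fball01.
have h (n : nat) z : fin_index (fball z : {pred K}) (fball (z + n%:Z)).
  elim: n z => [|n IH] z.
    apply: (@fin_index_cover _ _ _ [:: 0]) => x hx; exists 0; rewrite ?inE //.
    by rewrite subr0 addr0.
  apply: fin_index_tower (step z) _; have := IH (z + 1).
  by rewrite -addrA -[1 + _]/(1 + n%:Z) -intS.
have := h `|N - M|%N M; apply: fin_index_sub => // x _; apply: fball_mono.
by rewrite -lerBlDl abszE ler_norm.
Qed.

Lemma count_fball M (n : nat) :
  qsum (fball M : {pred K}) (fball (M + n%:Z)) (fun=> 1 : C) = q%:R ^+ n.
Proof.
elim: n M => [|n IH] M.
  by rewrite expr0 qsum_trivial // => x; rewrite addr0.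
rewrite (@qsum_tower _ _ (fball M) (fball (M + 1)) (fball (M + n.+1%:Z))); first last.
- by [].
- exact: fin_fball.
- exact: fin_fball.
- by apply: fball_mono; rewrite lerDl.
- by apply: fball_mono; rewrite lerD2l.
have -> : M + n.+1%:Z = (M + 1) + n%:Z by rewrite -addrA -intS.
under eq_qsumr do rewrite IH.
rewrite exprS -count_fball01 -qsum_mull -{1}[M]add0r [M + 1]addrC.
rewrite (qsum_fball_shift (M := 0) (N := 1)) //; last exact: fin_fball.
by apply: eq_bigr => x _; rewrite mul1r.
Qed.

(** Coordinates in the basis 1, [theta] of K over the fixed field. As 2 and [theta] are units, x
    lies in a ball exactly when both coordinates do, so sums over K become double sums over the
    fixed field. *)
Definition repart (x : K) := 2%:R^-1 * (x + star x).
Definition impart (x : K) := 2%:R^-1 * (theta^-1 * (x - star x)).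

Lemma repart_impart x : x = repart x + theta * impart x.
Proof.
by rewrite /repart /impart; field; rewrite hs_2_neq0 hs_theta_neq0.
Qed.

Lemma repart_fball N x : x \in pball N -> repart x \in fball N.
Proof.
move=> hx; rewrite in_fball /repart rmorphM star_half rmorphD /= hs_starK addrC eqxx /=.
by rewrite pball_half (@rpredD _ (pball N)) // pball_star.
Qed.

Lemma impart_fball N x : x \in pball N -> impart x \in fball N.
Proof.
move=> hx; rewrite in_fball /impart rmorphM star_half rmorphM rmorphB /= hs_starK.
rewrite fmorphV hs_star_theta invrN mulNr -mulrN opprB eqxx /=.
rewrite pball_half; apply: pball0M.
  by rewrite in_pball wV ?hs_theta_neq0 // hs_w_theta oppr0 lexx orbT.
by rewrite (@rpredB _ (pball N)) // pball_star.
Qed.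

Lemma theta_comb_pball N a b : star a = a -> star b = b ->
  (a + theta * b \in pball N) = (a \in fball N) && (b \in fball N).
Proof.
move=> sa sb; apply/idP/andP => [h|[/fball_pball ha /fball_pball hb]]; last first.
  rewrite (@rpredD _ (pball N)) // pball0M // in_pball hs_w_theta lexx orbT //.
have := repart_fball h; have := impart_fball h.
rewrite /repart /impart rmorphD rmorphM /= sa sb hs_star_theta mulNr.
have -> : 2%:R^-1 * (a + theta * b + (a - theta * b)) = a by field; exact: hs_2_neq0.
have -> // : 2%:R^-1 * (theta^-1 * (a + theta * b - (a - theta * b))) = b.
by field; rewrite hs_2_neq0 hs_theta_neq0.
Qed.

Lemma fin_pball M N : fin_index (pball M : {pred K}) (pball N).
Proof.
have [s hs] := fin_index_seq (fin_fball M N).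
apply: (@fin_index_cover _ _ _ [seq a + theta * b | a <- s, b <- s]) => x hx.
have [a as_ ha] := hs _ (repart_fball hx).
have [b bs hb] := hs _ (impart_fball hx).
exists (a + theta * b); first exact: allpairs_f.
rewrite {1}[x]repart_impart opprD addrACA -mulrBr theta_comb_pball ?(fball_fix ha) ?(fball_fix hb) //.
by rewrite ha hb.
Qed.

Lemma qsum_pball (W : nmodType) M N (f : K -> W) : M <= N ->
  (forall x y, x \in pball M -> y \in pball N -> f (x + y) = f x) ->
  qsum (pball M) (pball N) f =
  qsum (fball M) (fball N) (fun a => qsum (fball M) (fball N) (fun b => f (a + theta * b))).
Proof.
move=> MN fB; apply: qsum_fiber => //; try exact: fball_mono; try exact: fin_fball.
- exact: fin_pball.
- by move=> x y hx hy; rewrite theta_comb_pball ?(fball_fix hx) ?(fball_fix hy) // hx.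
- move=> x hx; exists (repart x); first exact: repart_fball.
  move=> y hy h; exists (impart x); first exact: impart_fball.
  rewrite {1}[x]repart_impart opprD addrACA subrr addr0 -opprB (@rpredN _ (pball N)).
  exact: fball_pball.
- move=> a b c d ha hc hb hd; rewrite opprD addrACA -mulrBr theta_comb_pball.
  + by case/andP.
  + by rewrite rmorphB /= (fball_fix ha) (fball_fix hc).
  + by rewrite rmorphB /= (fball_fix hb) (fball_fix hd).
- move=> a b c ha hb hc; rewrite opprD addrACA -mulrBr theta_comb_pball.
  + by rewrite subrr rpred0.
  + by rewrite rmorphB /= (fball_fix ha).
  + by rewrite rmorphB /= (fball_fix hb) (fball_fix hc).
Qed.

Lemma count_pball M (n : nat) :
  qsum (pball M : {pred K}) (pball (M + n%:Z)) (fun=> 1 : C) = (q ^ 2)%:R ^+ n.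
Proof.
rewrite qsum_pball ?lerDl //; under eq_qsumr do rewrite count_fball.
by rewrite qsum_const count_fball natrX -exprM mulnC exprM expr2.
Qed.

Lemma fin_mball m n M N : fin_index (mball m n M : {pred 'M[K]_(m, n)}) (mball m n N).
Proof.
have [s hs] := fin_index_seq (fin_pball M N).
pose F (f : {ffun 'I_m * 'I_n -> 'I_(size s)}) : 'M[K]_(m, n) := \matrix_(i, j) s`_(f (i, j)).
apply: (@fin_index_cover _ _ _ (map F (enum {ffun 'I_m * 'I_n -> 'I_(size s)}))).
move=> A /mballP hA.
have lt i j : (find (fun y => (A i j - y)%R \in pball N) s < size s)%N.
  by rewrite -has_find; apply/hasP; have [y ys h] := hs _ (hA i j); exists y.
exists (F [ffun ij => Ordinal (lt ij.1 ij.2)]).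
  by apply: map_f; rewrite mem_enum.
apply/mballP=> i j; rewrite !mxE ffunE /=.
apply: (@nth_find _ 0 (fun y => A i j - y \in pball N)).
by rewrite has_find.
Qed.

Lemma fin_mx m n M N (A B : zmodClosed 'M[K]_(m, n)) :
  {subset A <= mball m n M} -> {in A, forall x, x \in mball m n N -> x \in B} ->
  fin_index A B.
Proof. by move=> sA sB; apply: fin_index_sub (fin_mball m n M N). Qed.

Lemma fin_hball n M N : fin_index (hball n M : {pred 'M[K]_n}) (hball n N).
Proof.
apply: (@fin_mx _ _ M N); first exact: hball_mball.
by move=> A hA h; rewrite in_hball (hball_adj hA) eqxx.
Qed.

Lemma row_mx_ball n N (a : K) (y : 'rV[K]_n) :
  (row_mx a%:M y \in mball 1 (1 + n) N) = (a \in pball N) && (y \in mball 1 n N).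
Proof.
apply/mballP/andP => [h|[ha /mballP hy] i j].
  split; last by apply/mballP=> i j; move: (h i (rshift _ j)); rewrite row_mxEr.
  by move: (h 0 (lshift _ 0)); rewrite row_mxEl mxE mulr1n.
case: (split_ordP j) => j' ->; rewrite ?row_mxEl ?row_mxEr //.
by rewrite !ord1 mxE mulr1n.
Qed.

(** Fubini, one coordinate at a time. It turns the Gauss sum of a diagonal form into a product of
    one-dimensional Gauss sums. *)
Lemma qsum_row_prod m M N (F : 'I_m -> K -> C) : M <= N ->
  (forall i x y, x \in pball M -> y \in pball N -> F i (x + y) = F i x) ->
  qsum (mball 1 m M) (mball 1 m N) (fun y => \prod_i F i (y 0 i)) =
  \prod_i qsum (pball M) (pball N) (F i).
Proof.
move=> MN; elim: m F => [|m IH] F fB.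
  rewrite big_ord0 qsum_trivial; first by rewrite big_ord0.
  - by move=> x _; apply/mballP=> i [].
  - by move=> x _; apply/mballP=> i [].
  - by move=> x _; rewrite !big_ord0.
rewrite big_ord_recl -(IH (fun i => F (lift ord0 i))); last by move=> i; exact: fB.
rewrite (@qsum_fiber _ _ _ _ (pball M) (pball N) (mball 1 m M) (mball 1 m N)
  (mball 1 (1 + m) M) (mball 1 (1 + m) N)
   (fun (a : K) (y : 'rV[K]_m) => row_mx a%:M y : 'rV[K]_(1 + m))).
- rewrite -qsum_mull; apply: eq_bigr => a _; rewrite -qsum_mulr; apply: eq_bigr => y _.
  rewrite big_ord_recl; congr (_ * _).
    congr (F _ _); rewrite (_ : (ord0 : 'I_(1 + m)) = lshift m (0 : 'I_1)); last exact: ord_inj.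
    by apply: (etrans (row_mxEl _ _ _ _)); rewrite mxE mulr1n.
  apply: eq_bigr => i _; congr (F _ _).
  rewrite (_ : lift ord0 i = rshift 1 i :> 'I_(1 + m)); last exact: ord_inj.
  exact: row_mxEr.
- exact: pball_mono.
- exact: mball_mono.
- exact: fin_pball.
- exact: fin_mball.
- exact: fin_mball.
- by move=> a y ha hy; rewrite row_mx_ball ha.
- move=> x hx; have e : x = row_mx (lsubmx x 0 0)%:M (rsubmx x).
    by rewrite -mx11_scalar hsubmxK.
  move: hx; rewrite e row_mx_ball => /andP[ha hy].
  exists (lsubmx x 0 0) => // b hb hab; exists (rsubmx x) => //.
  rewrite opp_row_mx add_row_mx subrr -raddfB row_mx_ball rpred0 andbT.
  by rewrite -opprB (@rpredN _ (pball N)).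
- by move=> a y b z _ _ _ _; rewrite opp_row_mx add_row_mx -raddfB row_mx_ball => /andP[].
- by move=> a y z _ _ _; rewrite opp_row_mx add_row_mx -raddfB row_mx_ball subrr rpred0.
- move=> x y /mballP hx /mballP hy; apply: eq_bigr => i _; rewrite mxE; exact: fB.
Qed.

Lemma count_row m M (n : nat) :
  qsum (mball 1 m M : {pred 'rV[K]_m}) (mball 1 m (M + n%:Z)) (fun=> 1 : C) = (q ^ 2)%:R ^+ (n * m).
Proof.
transitivity (qsum (mball 1 m M : {pred 'rV[K]_m}) (mball 1 m (M + n%:Z))
   (fun y => \prod_(i < m) (fun (_ : 'I_m) (_ : K) => 1 : C) i (y 0 i))).
  by apply: eq_bigr => y _; rewrite big1.
rewrite (@qsum_row_prod m M _ (fun _ _ => 1)) ?lerDl //; under eq_bigr do rewrite count_pball.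
by rewrite prodr_const card_ord exprM.
Qed.

End Finiteness.

(** * Denominators of hermitian matrices *)

Section Denominators.
Variable D : herm_setting.
Local Notation K := (hs_K D).
Local Notation C := (hs_C D).
Local Notation w := (@hs_w D).
Local Notation star := (@hs_star D).
Local Notation pi := (hs_pi D).
Local Notation theta := (hs_theta D).
Local Notation q := (hs_q D).

Definition stab n (R : 'M[K]_n) : {pred 'cV[K]_n} :=
  [pred c : 'cV[K]_n | (c \in mball n 1 0) && (R *m c \in mball n 1 0)].

Fact stab_zmod_closed n (R : 'M[K]_n) : zmod_closed (stab R).
Proof.
split=> [|c d]; first by rewrite inE mulmx0 !rpred0.
move=> /andP[c1 c2] /andP[d1 d2]; rewrite inE mulmxBr.
by apply/andP; split; exact: (@rpredB _ (mball n 1 0)).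
Qed.

HB.instance Definition _ n (R : 'M[K]_n) :=
  GRing.isZmodClosed.Build 'cV[K]_n (stab R) (stab_zmod_closed R).

Lemma in_stab n (R : 'M[K]_n) c :
  (c \in stab R) = (c \in mball n 1 0) && (R *m c \in mball n 1 0).
Proof. by []. Qed.

Lemma stab_sub n (R : 'M[K]_n) : {subset stab R <= mball n 1 0}.
Proof. by move=> c /andP[]. Qed.

Lemma mball_stab n (R : 'M[K]_n) (e : nat) : R \in mball n n (- e%:Z) ->
  {subset mball n 1 e <= stab R}.
Proof.
move=> hR c hc; rewrite in_stab (mball_mono _ hc) //=.
by rewrite -(addNr e%:Z); exact: mballM.
Qed.

Lemma fin_stab n (R : 'M[K]_n) : fin_index (mball n 1 0 : {pred 'cV[K]_n}) (stab R).
Proof.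
have [e he] := mball_bound R.
by apply: (@fin_mx _ _ _ 0 e) => // c _; exact: mball_stab.
Qed.

(** An index rather than elementary divisors: invariance under [gl] and under integral translations,
    and multiplicativity on blocks, are then changes of variable, and the comparison of R with its
    dilate becomes a comparison of lattices. *)
Definition idx n (R : 'M[K]_n) : C := qsum (mball n 1 0) (stab R) (fun=> 1).

Lemma idx_gl n (U R V : 'M[K]_n) : U \in gl n -> V \in gl n -> idx (U *m R *m V) = idx R.
Proof.
move=> /glP[u1 u2 u3] /glP[v1 v2 v3]; rewrite /idx.
have stabE c : (V *m c \in stab R) = (c \in stab (U *m R *m V)).
  rewrite !in_stab; apply/andP/andP => -[h1 h2]; split.
  - by rewrite -[c](mulKmx v1) mball0M.
  - by rewrite -!mulmxA mball0M.
  - exact: mball0M.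
  - by rewrite -[R *m _](mulKmx u1) mball0M // !mulmxA.
rewrite [RHS](@qsum_reindex _ _ _ (mball n 1 0) (stab (U *m R *m V)) _ _
  (fun c => V *m c : 'cV[K]_n)) //.
- exact: stab_sub.
- exact: fin_stab.
- by move=> c hc; exact: mball0M.
- by move=> c d _ _; rewrite -mulmxBr stabE.
- move=> c hc; exists (invmx V *m c); first exact: mball0M.
  by rewrite mulKVmx // subrr rpred0.
Qed.

Lemma idx_addint n (R S : 'M[K]_n) : S \in mball n n 0 -> idx (R + S) = idx R.
Proof.
move=> hS; apply: qsum_pred => // c; rewrite !in_stab mulmxDl.
case hc: (c \in _) => //=; rewrite (@rpredDr _ (mball n 1 0)) //.
exact: mball0M.
Qed.

Lemma idx_block m n (A : 'M[K]_m) (B : 'M[K]_n) :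
  idx (block_mx A 0 0 B) = idx A * idx B.
Proof.
rewrite /idx.
have blockE (a : 'cV[K]_m) (b : 'cV[K]_n) :
   (col_mx a b \in stab (block_mx A 0 0 B)) = (a \in stab A) && (b \in stab B).
  rewrite !in_stab mul_block_col !mul0mx addr0 add0r !mball_col.
  by rewrite andbACA.
rewrite (@qsum_fiber _ _ _ _ (mball m 1 0) (stab A) (mball n 1 0) (stab B) _ _
   (fun a b => col_mx a b)) //; try exact: stab_sub; try exact: fin_stab.
- by rewrite -qsum_mull; apply: eq_qsumr => a; rewrite mul1r.
- by move=> a b ha hb; rewrite mball_col ha.
- move=> c; rewrite -[c]vsubmxK mball_col => /andP[ha hb].
  exists (usubmx c) => // a ha' haa; exists (dsubmx c) => //.
  rewrite opp_col_mx add_col_mx blockE subrr rpred0 andbT.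
  by rewrite -opprB (@rpredN _ (stab A)).
- by move=> a b a' b' _ _ _ _; rewrite opp_col_mx add_col_mx blockE => /andP[].
- by move=> a b b' _ _ _; rewrite opp_col_mx add_col_mx blockE subrr rpred0.
Qed.

Definition vden (r : K) : nat := if r \in pball 0 then 0%N else `|w r|%N.

Lemma vden_pball r N : (pi ^+ N * r \in pball 0) = (vden r <= N)%N.
Proof.
rewrite -[pi ^+ N]/(pi ^ N%:Z) pball_piX sub0r /vden.
case: ifP => [h|]; first by rewrite (pball_mono _ h) // oppr_le0.
rewrite !in_pball; case: eqP => //= r0; lia.
Qed.

Lemma vden_ball r : r \in pball (- (vden r)%:Z).
Proof. by have := vden_pball r (vden r); rewrite leqnn -[pi ^+ _]/(pi ^ _%:Z) pball_piX sub0r. Qed.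

Lemma vden_eq r r' : r - r' \in pball 0 -> vden r = vden r'.
Proof.
move=> h; have e N : (vden r <= N)%N = (vden r' <= N)%N.
  rewrite -!vden_pball -[r](subrK r') mulrDr (@rpredDl _ (pball 0)) //.
  by apply: pball0M => //; rewrite -[pi ^+ N]/(pi ^ N%:Z); apply: pball_mono (piX_ball _ _).
by apply/eqP; rewrite eqn_leq e leqnn -e leqnn.
Qed.

(** The stabilizer of the scalar r is the ball of exponent [vden r], and the residue field of K has
    q^2 elements. *)
Lemma idx_scalar (r : K) : idx (r%:M : 'M[K]_1) = (q ^ 2)%:R ^+ vden r.
Proof.
rewrite -[vden r]muln1 -(count_row D 1 0 (vden r)); apply: qsum_pred => // c.
rewrite in_stab add0r [c]mx11_scalar -scalar_mxM !mball_scalar1.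
set x := c 0 0; have := vden_pball r.
have [->|x0] := eqVneq x 0; first by rewrite mulr0 !rpred0.
rewrite ![x \in _]in_pball (negPf x0) /= => /(_ `|w x|%N).
have [wx|wx] /= := lerP 0 (w x); last by rewrite leNgt => _; case: (vden r) => [|?]; lia.
have -> : (vden r <= `|w x|)%N = ((vden r)%:Z <= w x) by lia.
move=> <-.
rewrite -[pi ^+ _]/(pi ^ `|w x|%:Z) gez0_abs // pball_piX sub0r mulrC.
by rewrite -(pball_mulE (- w x) r x0) subrr.
Qed.

Lemma idx_diag n (d : 'rV[K]_n) : idx (diag_mx d) = (q ^ 2)%:R ^+ (\sum_i vden (d 0%R i)).
Proof.
elim: n d => [|n IH] d.
  rewrite big_ord0 /idx qsum_trivial //; last exact: stab_sub.
  by move=> x _; rewrite in_stab; apply/andP; split; apply/mballP=> -[].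
have -> : d = row_mx (lsubmx (d : 'rV_(1 + n))) (rsubmx (d : 'rV_(1 + n))).
  by rewrite hsubmxK.
move: (lsubmx _) (rsubmx _) => a b.
have e : idx (diag_mx (row_mx a b)) = idx (diag_mx a) * idx (diag_mx b).
  by rewrite diag_mx_row idx_block.
apply: (etrans e); rewrite IH big_ord_recl exprD; congr (_ * _).
  rewrite (_ : diag_mx a = (a 0 0)%:M) ?idx_scalar; last first.
    by apply/matrixP=> i j; rewrite !ord1 !mxE eqxx.
  rewrite (_ : (ord0 : 'I_(1 + n)) = lshift n (0 : 'I_1)); last exact: ord_inj.
  by congr (_ ^+ vden _); exact/esym/row_mxEl.
congr (_ ^+ _); apply: eq_bigr => i _.
rewrite (_ : lift ord0 i = rshift 1 i :> 'I_(1 + n)); last exact: ord_inj.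
by congr (vden _); exact/esym/row_mxEr.
Qed.

(* [idx R] is the index in O_{k'}^n of the lattice of all c with R c integral,
   and q^(2 ord R) is its value, so that nu(R) = q^(ord R). *)
Fact ord_key : unit. Proof. exact: tt. Qed.
Definition ord : forall n, 'M[K]_n -> nat := locked_with ord_key
  (fun n R => xget 0%N [set m | idx R = (q ^ 2)%:R ^+ m]).

Lemma q2_gt1 : (1 < q ^ 2)%N.
Proof. by rewrite -(exp1n 2) ltn_exp2r // hs_q_gt1. Qed.

Lemma ordP n (R : 'M[K]_n) m : idx R = (q ^ 2)%:R ^+ m -> ord R = m.
Proof.
move=> h; have : [set m | idx R = (q ^ 2)%:R ^+ m] (ord R).
  by rewrite /ord locked_withE; apply: (@xgetPex _ 0%N); exists m.
rewrite /= h -[RHS]natrX -[LHS]natrX => /eqP; rewrite eqr_nat eqn_exp2l ?q2_gt1 //.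
by move/eqP.
Qed.

Lemma eq_ord n m (R : 'M[K]_n) (S : 'M[K]_m) : idx R = idx S -> ord R = ord S.
Proof. by rewrite /ord locked_withE => ->. Qed.

Definition hermitian_diag n (R : 'M[K]_n) : Prop :=
  exists (U : 'M[K]_n) (d : 'rV[K]_n), [/\ U \in gl n, (forall i, star (d 0 i) = d 0 i) &
    R = U *m diag_mx d *m adjmx U].

Lemma hermitian_diag_congr n (V R : 'M[K]_n) : V \in gl n ->
  hermitian_diag (V *m R *m adjmx V) -> hermitian_diag R.
Proof.
move=> hV [U [d [hU hd e]]]; exists (invmx V *m U), d; split=> //.
  exact: glM (glV hV) hU.
rewrite adjmxM adjmx_inv !mulmxA -[_ *m diag_mx d]mulmxA -[invmx V *m _ *m _]mulmxA -e.
by rewrite !mulmxA mulVmx ?gl_unit // mul1mx mulmxK // adjmx_unit gl_unit.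
Qed.

Lemma gl_block_unipotent n (z : 'cV[K]_n) : z \in mball n 1 0 ->
  block_mx 1%:M 0 z 1%:M \in gl (1 + n).
Proof.
move=> hz; apply: (@gl_intro _ _ _ (block_mx 1%:M 0 (- z) 1%:M)).
- rewrite mulmx_block !mul1mx !mulmx1 !mulmx0 !mul0mx !addr0 add0r subrr.
  by rewrite -scalar_mx_block.
- by rewrite mball_block !mball1 rpred0 hz.
- by rewrite mball_block !mball1 rpred0 (@rpredN _ (mball n 1 0)) hz.
Qed.

Lemma gl_block m n (U : 'M[K]_m) (V : 'M[K]_n) : U \in gl m -> V \in gl n ->
  block_mx U 0 0 V \in gl (m + n).
Proof.
move=> /glP[u1 u2 u3] /glP[v1 v2 v3].
apply: (@gl_intro _ _ _ (block_mx (invmx U) 0 0 (invmx V))).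
- rewrite mulmx_block !mulmx0 !mul0mx !addr0 add0r !mulmxV //.
  by rewrite -scalar_mx_block.
- by rewrite mball_block u2 v2 !rpred0.
- by rewrite mball_block u3 v3 !rpred0.
Qed.

(** The corner has the least valuation among the entries, so an integral unipotent matrix clears its
    row and column. *)
Lemma hermitian_diag_pivot n (R : 'M[K]_(1 + n)) :
  (forall S : 'M[K]_n, adjmx S = S -> hermitian_diag S) ->
  adjmx R = R -> R 0 0 != 0 -> R \in mball _ _ (w (R 0 0)) -> hermitian_diag R.
Proof.
move=> IH; rewrite -[R]submxK; set a := ulsubmx R; set b := ursubmx R.
set c := dlsubmx R; set S := drsubmx R.
rewrite [a]mx11_scalar; move: (a 0 0) => {a} r.
rewrite (_ : block_mx r%:M b c S 0 0 = r); last first.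
  rewrite (_ : (0 : 'I_(1 + n)) = lshift n (0 : 'I_1)); last exact: ord_inj.
  by rewrite block_mxEul mxE mulr1n.
rewrite adjmx_block => /eq_block_mx[ar cb _ aS] r0; rewrite mball_block => /and4P[_ _ hc _].
have sr : star r = r.
  by move: ar; rewrite adjmx_scalar => /(congr1 (fun A : 'M[K]_1 => A 0 0)); rewrite !mxE !mulr1n.
pose z := - (r^-1 *: c).
have hz : z \in mball n 1 0.
  rewrite (@rpredN _ (mball n 1 0)) -(addNr (w r)); apply: mballZ => //.
  by rewrite in_pball wV // lexx orbT.
apply: (hermitian_diag_congr (gl_block_unipotent hz)).
have ab : adjmx c = b by exact: cb.
have az : adjmx z = - (r^-1 *: b).
  by rewrite /z -scaleNr adjmxZ rmorphN fmorphV sr ab scaleNr.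
have -> : block_mx 1%:M 0 z 1%:M *m block_mx r%:M b c S *m adjmx (block_mx 1%:M 0 z 1%:M)
  = block_mx r%:M 0 0 (S + z *m b).
  rewrite adjmx_block !mulmx_block az adjmx0 !adjmx1 !mul1mx !mul0mx !mulmx1 !mulmx0 !addr0.
  have e1 : z *m r%:M + c = 0.
    by rewrite mul_mx_scalar scalerN scalerA mulfV // scale1r addNr.
  rewrite e1 mul0mx add0r; congr block_mx.
    by rewrite mul_scalar_mx scalerN scalerA mulfV // scale1r addNr.
  by rewrite addrC.
have [|U [d [hU hd e]]] := IH (S + z *m b).
  rewrite adjmxD aS adjmxM az -ab adjmxK /z mulmxN mulNmx -scalemxAl -scalemxAr.
  by [].
exists (block_mx 1%:M 0 0 U), (row_mx r%:M d); split.
- by apply: gl_block => //; exact: gl1.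
- move=> i; case: (split_ordP i) => j ->; rewrite ?row_mxEl ?row_mxEr //.
  by rewrite mxE !ord1 eqxx mulr1n.
rewrite diag_mx_row (_ : diag_mx r%:M = r%:M); last first.
  by apply/matrixP=> i j; rewrite !ord1 !mxE !eqxx.
rewrite adjmx_block !mulmx_block !adjmx0 adjmx1 !mul1mx !mulmx1 !mulmx0 !mul0mx !addr0 !add0r.
by rewrite e !mul0mx.
Qed.

(** Induction on the size, pivoting on an entry of least valuation. If one lies on the diagonal, a
    transposition brings it to the corner; otherwise a row operation creates one on the diagonal,
    which needs 2 to be a unit. *)
Lemma hermitian_diagP n (R : 'M[K]_n) : adjmx R = R -> hermitian_diag R.
Proof.
elim: n R => [|n IH] R sR.
  exists 1%:M, 0; split; [exact: gl1 | by case | by apply/matrixP=> -[]].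
have perm_pivot (S : 'M[K]_n.+1) k : adjmx S = S -> S k k != 0 ->
    S \in mball _ _ (w (S k k)) -> hermitian_diag S.
  move=> sS S0 hS; pose V : 'M[K]_n.+1 := tperm_mx 0 k.
  have hV : V \in gl n.+1 by exact: gl_perm.
  have aV : adjmx V = V by rewrite /adjmx tr_tperm_mx /V map_tperm_mx.
  apply: (hermitian_diag_congr hV); rewrite aV.
  have e : (V *m S *m V) 0 0 = S k k.
    by rewrite -xrowE -xcolE !mxE !tpermL.
  apply: hermitian_diag_pivot; rewrite ?e //.
    by rewrite !adjmxM aV sS mulmxA.
  by apply: mballM0; [apply: mball0M |]; rewrite ?gl_ball.
have [R0|[i [j Rij]]] : R = 0 \/ exists i j, R i j != 0.
    have [|/forallPn[i /forallPn[j ?]]] := boolP [forall i, forall j, R i j == 0].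
      by move/forallP=> h; left; apply/matrixP=> i j; rewrite mxE; apply/eqP/(forallP (h i)).
    by right; exists i, j.
  exists 1%:M, 0; split; [exact: gl1 | by move=> i; rewrite mxE rmorph0 |].
  by rewrite linear0 mulmx0 mul0mx.
pose P (ij : 'I_n.+1 * 'I_n.+1) := R ij.1 ij.2 != 0.
have Pij : P (i, j) by [].
case: (arg_minP (fun ij => w (R ij.1 ij.2)) Pij) => -[a b] /=; rewrite /P /= => Rab hmin.
have hR : R \in mball _ _ (w (R a b)).
  apply/mballP=> s t; rewrite in_pball; case: eqP => //= /eqP st.
  exact: (hmin (s, t)).
have [/existsP[k /andP[Rk /eqP wk]]|nodiag] :=
   boolP [exists k, (R k k != 0) && (w (R k k) == w (R a b))].
  by apply: (perm_pivot _ k) => //; rewrite wk.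
have hd k : R k k \in pball (w (R a b) + 1).
  rewrite in_pball; case: eqP => //= /eqP Rk; move/existsPn/(_ k): nodiag.
  rewrite Rk /= => nk; move: (hmin (k, k) Rk) => /=; lia.
have ab : a != b.
  by apply: contraNneq nodiag => ab; subst b; apply/existsP; exists a; rewrite Rab eqxx.
set N := w (R a b) in hR hd *.
(* The unit [al] makes al R_ab equal to pi^N. Adding al times row a to row b, and likewise for
   columns, gives the diagonal entry R_bb + Nm(al) R_aa + 2 pi^N, of valuation exactly N since all
   diagonal entries have larger valuation. *)
pose al := pi ^ N / R a b.
have wal : w al = 0 by rewrite /al hs_wM ?invr_eq0 ?piX_neq0 // wV // w_piX subrr.
have hal : al \in pball 0 by rewrite in_pball wal lexx orbT.
have Rba : R b a = star (R a b) by rewrite -[in LHS]sR adjmxE.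
pose V : 'M[K]_n.+1 := 1%:M + al *: delta_mx b a.
have hdel x : x \in pball 0 -> x *: delta_mx b a \in mball n.+1 n.+1 0.
  move=> hx; rewrite -[0]addr0; apply: mballZ => //; apply/mballP=> s t; rewrite mxE.
  by case: (_ && _); rewrite ?rpred0 // pball1.
have hV : V \in gl n.+1.
  apply: (@gl_intro _ _ _ (1%:M - al *: delta_mx b a)).
  - rewrite mulmxBr mulmx1 mulmxDl mul1mx -scalemxAl -scalemxAr mul_delta_mx_0 //.
    by rewrite !scaler0 addr0 addrK.
  - by rewrite (@rpredD _ (mball n.+1 n.+1 0)) ?mball1 ?hdel.
  - by rewrite (@rpredB _ (mball n.+1 n.+1 0)) ?mball1 ?hdel.
apply: (hermitian_diag_congr hV).
have e : (V *m R *m adjmx V) b b = R b b + al * star al * R a a + (pi ^ N + pi ^ N).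
  have rowV s : (V *m R) b s = R b s + al * R a s.
    rewrite mulmxDl mul1mx -scalemxAl !mxE; congr (_ + _ * _).
    rewrite (bigD1 a) //= big1 ?addr0 ?mxE ?eqxx ?mul1r // => t ta.
    by rewrite mxE eqxx (negPf ta) mul0r.
  rewrite mxE (eq_bigr (fun t => (V *m R) b t * star (V b t))); last first.
    by move=> t _; rewrite adjmxE.
  rewrite (bigD1 b) //= (bigD1 a) //= big1 ?addr0; last first.
    move=> t /andP[tb ta]; rewrite [V b t]mxE [(1%:M : 'M[K]_(_)) b t]mxE eq_sym (negPf tb) add0r.
    by rewrite !mxE (negPf ta) andbF mulr0 rmorph0 mulr0.
  rewrite !rowV (_ : V b b = 1); last first.
    by rewrite !mxE !eqxx [b == a]eq_sym (negPf ab) mulr0 addr0 mulr1n.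
  rewrite (_ : V b a = al); last first.
    by rewrite !mxE !eqxx [b == a]eq_sym (negPf ab) mulr1 add0r.
  rewrite rmorph1 mulr1 Rba.
  have -> : al * R a b = pi ^ N by rewrite /al divfK.
  have s2 : star (R a b) * star al = pi ^ N by rewrite -rmorphM /= mulrC divfK // star_piX.
  by rewrite mulrDl s2; ring.
have [v0 wv] : (V *m R *m adjmx V) b b != 0 /\ w ((V *m R *m adjmx V) b b) = N.
  have wN : w (pi ^ N + pi ^ N : K) = N.
    by rewrite -mulr2n -mulr_natl hs_wM ?hs_2_neq0 ?piX_neq0 // hs_w2 w_piX add0r.
  have := @w_add_small D (pi ^ N + pi ^ N) (R b b + al * star al * R a a).
  rewrite wN [_ + (R b b + _)]addrC -e; apply.
    by rewrite -mulr2n -mulr_natl mulf_neq0 ?hs_2_neq0 ?piX_neq0.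
  rewrite (@rpredD _ (pball (N + 1))) //; apply: pball0M => //.
  by apply: pball0M => //; rewrite pball_star.
apply: (perm_pivot _ b) => //; first by rewrite !adjmxM adjmxK sR mulmxA.
rewrite wv; apply: mballM0; last by rewrite mball_adj gl_ball.
by apply: mball0M => //; exact: gl_ball.
Qed.

(** Diagonalization shows that the index is a power of q^2; only then is [ord] more than the default
    value of [xget]. *)
Lemma idx_ord n (R : 'M[K]_n) : adjmx R = R -> idx R = (q ^ 2)%:R ^+ ord R.
Proof.
move/hermitian_diagP => [U [d [hU _ ->]]].
have e := idx_gl (diag_mx d) hU (gl_adj hU); rewrite idx_diag in e.
by rewrite e (ordP e).
Qed.

Lemma ord_block m n (A : 'M[K]_m) (B : 'M[K]_n) : adjmx A = A -> adjmx B = B ->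
  ord (block_mx A 0 0 B) = (ord A + ord B)%N.
Proof. by move=> hA hB; apply: ordP; rewrite idx_block !idx_ord // exprD. Qed.

Lemma ord_scalar (r : K) : ord (r%:M : 'M[K]_1) = vden r.
Proof. exact/ordP/idx_scalar. Qed.

End Denominators.

Lemma qsum_cond (V : zmodType) (W : pzRingType) (A A' B : zmodClosed V) (f : V -> W) :
  {subset B <= A'} -> {subset A' <= A} -> fin_index A B ->
  qsum A B (fun x => if x \in A' then f x else 0) = qsum A' B f.
Proof.
move=> sB sA fAB; rewrite (qsum_restrict sB sA fAB); last by move=> x _ /negPf ->.
apply: eq_qsum => //; first exact: fin_index_sub fAB.
by move=> x ->.
Qed.

(** * Character sums and the series of size 1 *)

Section CharacterSums.
Variable D : herm_setting.
Local Notation K := (hs_K D).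
Local Notation C := (hs_C D).
Local Notation w := (@hs_w D).
Local Notation star := (@hs_star D).
Local Notation pi := (hs_pi D).
Local Notation theta := (hs_theta D).
Local Notation q := (hs_q D).
Local Notation Psi := (@hs_psi D).

Lemma q_neq0 : q%:R != 0 :> C.
Proof. by rewrite pnatr_eq0 -lt0n (ltn_trans _ (hs_q_gt1 D)). Qed.

Lemma Psi_fball x : x \in fball 0 -> Psi x = 1.
Proof. by case/andP=> /eqP sx hx; exact: hs_psi_int. Qed.

Lemma Psi0 : Psi 0 = 1. Proof. by rewrite Psi_fball // rpred0. Qed.

Lemma Psi_addint x y : star x = x -> y \in fball 0 -> Psi (x + y) = Psi x.
Proof. by move=> sx hy; rewrite hs_psiD ?(fball_fix hy) // (Psi_fball hy) mulr1. Qed.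

Lemma PsiNK x : star x = x -> Psi x * Psi (- x) = 1.
Proof. by move=> sx; rewrite -hs_psiD ?rmorphN ?sx // subrr Psi0. Qed.

Lemma Psi_conj x : star x = x -> (Psi x)^* = Psi (- x).
Proof.
move=> sx; have := PsiNK sx; have n1 := hs_psi_norm sx.
have p0 : Psi x != 0 by rewrite -normr_eq0 n1 oner_neq0.
move=> h; apply: (mulfI p0); rewrite h -normCK n1 expr1n //.
Qed.

Definition Tr (x : K) := x + star x.
Definition Nm (x : K) := x * star x.

Lemma star_Tr x : star (Tr x) = Tr x.
Proof. by rewrite /Tr rmorphD /= hs_starK addrC. Qed.

Lemma star_Nm x : star (Nm x) = Nm x.
Proof. by rewrite /Nm rmorphM /= hs_starK mulrC. Qed.

Lemma TrD x y : Tr (x + y) = Tr x + Tr y.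
Proof. by rewrite /Tr rmorphD /=; ring. Qed.

Lemma Tr_fball N x : x \in pball N -> Tr x \in fball N.
Proof.
move=> hx; rewrite in_fball star_Tr eqxx (@rpredD _ (pball N)) // pball_star //.
Qed.

Lemma Nm_pball M N x : x \in pball M -> N <= M + M -> Nm x \in pball N.
Proof.
move=> hx NM; apply: (pball_mono NM); apply: pballM => //.
by rewrite pball_star.
Qed.

Lemma w_Nm x : x != 0 -> w (Nm x) = w x + w x.
Proof. by move=> x0; rewrite /Nm hs_wM ?fmorph_eq0 // hs_w_star. Qed.

Lemma Nm_pball1 x : x \in pball 0 -> (Nm x \in pball 1) = (x \in pball 1).
Proof.
have [->|x0] := eqVneq x 0; first by rewrite /Nm mul0r !rpred0.
by rewrite !in_pball mulf_eq0 fmorph_eq0 (negPf x0) /= w_Nm //; lia.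
Qed.

Lemma NmD x y : Nm (x + y) = Nm x + Tr (x * star y) + Nm y.
Proof. by rewrite /Nm /Tr rmorphD rmorphM /= hs_starK; ring. Qed.

(** The valuation is exactly -1 because [Psi] is trivial on integers. The translations that kill
    character sums are scaled from this x. *)
Lemma psi_witness : exists x, [/\ star x = x, x != 0, w x = -1 & Psi x != 1].
Proof.
have [x [sx hx px]] := hs_psi_nontrivial D; exists x.
have x0 : x != 0 by apply: contraNneq px => ->; rewrite Psi0.
split=> //; apply/eqP; rewrite eq_le andbC.
move: hx; rewrite (negPf x0) /= => -> /=; rewrite leNgt; apply: contra px => h.
by rewrite hs_psi_int // (negPf x0) /=; lia.
Qed.

Lemma psum_fball (M : int) (n : nat) (u : K) : star u = u -> u \in pball (- (M + n%:Z)) ->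
  qsum (fball M) (fball (M + n%:Z)) (fun r => Psi (u * r)) =
  if u \in pball (- M) then q%:R ^+ n else 0.
Proof.
move=> su hu.
have sB : {subset (fball (M + n%:Z) : {pred K}) <= fball M}.
  by apply: fball_mono; rewrite lerDl.
have int y : y \in fball (M + n%:Z) -> u * y \in fball 0.
  move=> hy; rewrite in_fball rmorphM /= su (fball_fix hy) eqxx /=.
  by rewrite -(addNr (M + n%:Z)); apply: pballM => //; exact: fball_pball.
case: ifPn => hM.
  rewrite -(count_fball D M); apply: eq_qsum => //; first exact: fin_fball.
  move=> r hr; apply: Psi_fball; rewrite in_fball rmorphM /= su (fball_fix hr) eqxx /=.
  by rewrite -(addNr M); apply: pballM => //; exact: fball_pball.
have u0 : u != 0 by apply: contraNneq hM => ->; rewrite rpred0.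
have [x [sx x0 wx px]] := psi_witness.
(* Here w u <= -M - 1, so x / u has valuation -1 - w u >= M and is an admissible translation; it
   multiplies the phase by Psi x. *)
apply: (@qsum_twist0 _ _ _ _ (x / u) (Psi x)) => //.
- exact: fin_fball.
- rewrite in_fball rmorphM fmorphV /= sx su eqxx in_pball hs_wM ?invr_eq0 // wV // wx /=.
  move: hM; rewrite in_pball (negPf u0) /= => hM; apply/orP; right; lia.
- move=> r y hr hy; rewrite mulrDr Psi_addint ?int //.
  by rewrite rmorphM /= su (fball_fix hr).
- move=> r hr; rewrite mulrDr mulrCA mulfV // mulr1 hs_psiD //; first exact: mulrC.
  by rewrite rmorphM /= su (fball_fix hr).
Qed.

Lemma psum_pball (M : int) (n : nat) (u : K) : u \in pball (- (M + n%:Z)) ->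
  qsum (pball M) (pball (M + n%:Z)) (fun z => Psi (Tr (u * z))) =
  if u \in pball (- M) then (q ^ 2)%:R ^+ n else 0.
Proof.
move=> hu.
have sB : {subset (pball (M + n%:Z) : {pred K}) <= pball M}.
  by apply: pball_mono; rewrite lerDl.
have int y : y \in pball (M + n%:Z) -> Tr (u * y) \in fball 0.
  by move=> hy; apply: Tr_fball; rewrite -(addNr (M + n%:Z)); exact: pballM.
case: ifPn => hM.
  rewrite -(count_pball D M); apply: eq_qsum => //; first exact: fin_pball.
  move=> r hr; apply: Psi_fball; apply: Tr_fball.
  by rewrite -(addNr M); exact: pballM.
have u0 : u != 0 by apply: contraNneq hM => ->; rewrite rpred0.
have [x [sx x0 wx px]] := psi_witness.
(* The factor 1/2 is there because x / 2 has trace x. *)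
apply: (@qsum_twist0 _ _ _ _ (2%:R^-1 * (x / u)) (Psi x)) => //.
- exact: fin_pball.
- rewrite pball_half in_pball hs_wM ?invr_eq0 // wV // wx /=.
  move: hM; rewrite in_pball (negPf u0) /= => hM; apply/orP; right; lia.
- by move=> r y hr hy; rewrite mulrDr TrD Psi_addint ?int // star_Tr.
- move=> r hr; rewrite mulrDr TrD.
  have -> : Tr (u * (2%:R^-1 * (x / u))) = x.
    have -> : u * (2%:R^-1 * (x / u)) = 2%:R^-1 * x by field; rewrite hs_2_neq0.
    by rewrite /Tr rmorphM star_half /= sx; field; rewrite hs_2_neq0.
  rewrite hs_psiD //; first exact: mulrC.
  exact: star_Tr.
Qed.

(* The case n = 1 of the truncated Siegel series [bsum] below. *)
Definition bone (t : K) (X : C) (E : nat) : C :=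
  qsum (fball (- E%:Z)) (fball 0) (fun r => X ^+ vden r * Psi (t * r)).

Lemma fball_vden (N : nat) r : star r = r -> (r \in fball (- N%:Z)) = (vden r <= N)%N.
Proof.
move=> sr; rewrite in_fball sr eqxx /= -vden_pball.
by rewrite -[pi ^+ N]/(pi ^ N%:Z) pball_piX sub0r.
Qed.

(** The new terms have exact denominator pi^(E+1); their phases add up to the difference of two
    complete character sums. *)
Lemma bone_rec t X E : star t = t -> t \in pball 0 ->
  bone t X E.+1 = bone t X E + X ^+ E.+1 *
    ((if t \in pball E.+1 then q%:R ^+ E.+1 else 0) - (if t \in pball E then q%:R ^+ E else 0)).
Proof.
move=> st ht.
have sub (A B : nat) : (A <= B)%N -> {subset fball (- A%:Z) <= (fball (- B%:Z) : {pred K})}.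
  by move=> AB; apply: fball_mono; rewrite lerN2 lez_nat.
have sub0 (A : nat) : {subset fball 0 <= (fball (- A%:Z) : {pred K})}.
  by apply: fball_mono; rewrite oppr_le0.
have sumE (A : nat) : qsum (fball (- A%:Z)) (fball 0) (fun r => Psi (t * r)) =
    if t \in pball A then q%:R ^+ A else 0.
  have := @psum_fball (- A%:Z) A t st; rewrite addNr oppr0 opprK; exact.
have step : bone t X E.+1 = qsum (fball (- E.+1%:Z)) (fball 0) (fun r =>
   (if r \in fball (- E%:Z) then X ^+ vden r * Psi (t * r) else 0) +
   (X ^+ E.+1 * Psi (t * r) - X ^+ E.+1 * (if r \in fball (- E%:Z) then Psi (t * r) else 0))).
  apply: eq_qsum; [exact: fin_fball | exact: sub0 |] => r hr.
  have sr := fball_fix hr; move: hr; rewrite !fball_vden //.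
  case: (leqP (vden r) E) => h1 h2; first by rewrite subrr addr0.
  by rewrite (_ : vden r = E.+1) ?mulr0 ?subr0 ?add0r //; lia.
rewrite step qsumD qsumB !qsum_mulr.
by rewrite !qsum_cond //; try (exact: sub); try (exact: sub0); try (exact: fin_fball);
  rewrite !sumE mulrBr.
Qed.

(** Summation of [bone_rec]: both complete sums are full up to exponent w t, only the subtracted one
    survives at w t + 1, and nothing is added afterwards. *)
Lemma boneE t X E : star t = t -> t != 0 -> 0 <= w t -> (`|w t| < E)%N ->
  bone t X E = (1 - X) * \sum_(j < `|w t|.+1) (q%:R * X) ^+ j.
Proof.
move=> st t0 wt; set a := `|w t|%N.
have ht : t \in pball 0 by rewrite in_pball wt orbT.
have inE' (A : nat) : (t \in pball A) = (A <= a)%N.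
  by rewrite in_pball (negPf t0) /= /a; lia.
have h0 e : (e <= a)%N -> bone t X e = (1 - X) * (\sum_(j < e) (q%:R * X) ^+ j) + (q%:R * X) ^+ e.
  elim: e => [|e IH] le.
    rewrite big_ord0 mulr0 add0r expr0 /bone oppr0 qsum_trivial //.
      by rewrite mulr0 Psi0 /vden rpred0 mulr1.
    move=> x hx; rewrite mulr0 Psi0 /vden rpred0 (fball_pball hx) Psi_fball //.
    by rewrite in_fball rmorphM /= st (fball_fix hx) eqxx /= pball0M // fball_pball.
  rewrite bone_rec // !inE' le IH ?(ltnW le) // big_ord_recr /= !exprMn !exprS.
  by ring.
have h1 e : bone t X (a + e.+1) = (1 - X) * \sum_(j < a.+1) (q%:R * X) ^+ j.
  elim: e => [|e IH].
    rewrite addn1 bone_rec // h0 // !inE' ltnn leqnn big_ord_recr /= !exprMn !exprS.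
    by ring.
  by rewrite addnS bone_rec // IH !inE' !ifF ?subrr ?mulr0 ?addr0 //; lia.
move=> aE; have -> : E = (a + (E - a.+1).+1)%N by lia.
exact: h1.
Qed.

Definition gauss (u : K) (m : nat) : C :=
  qsum (pball 0) (pball m) (fun d => Psi (u * Nm d)).

Lemma Nm_phase_inv (u : K) (m : nat) x y : star u = u -> u \in pball (- m%:Z) ->
  x \in pball 0 -> y \in pball m -> Psi (u * Nm (x + y)) = Psi (u * Nm x).
Proof.
move=> su hu hx hy; rewrite NmD -addrA mulrDr Psi_addint //.
  by rewrite rmorphM /= su star_Nm.
have e : fball 0 =i (fball (- m%:Z + m%:Z) : {pred K}) by rewrite addNr.
rewrite in_fball rmorphM rmorphD /= su star_Tr star_Nm eqxx /=.
rewrite -(addNr m%:Z); apply: pballM => //.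
rewrite (@rpredD _ (pball m)) //.
  apply: fball_pball; apply: Tr_fball; apply: pball0M => //; rewrite pball_star //.
by apply: Nm_pball hy _; rewrite lerDl.
Qed.

Lemma gauss_phase u x : star u = u -> star (u * Nm x) = u * Nm x.
Proof. by move=> su; rewrite rmorphM /= su star_Nm. Qed.

Lemma sub_pball0 (m : nat) : {subset (pball m : {pred K}) <= pball 0}.
Proof. exact: pball_mono. Qed.

Lemma gauss0 u : star u = u -> u \in pball 0 -> gauss u 0 = 1.
Proof.
move=> su hu; rewrite /gauss qsum_trivial //.
  by rewrite /Nm mul0r mulr0 Psi0.
move=> x hx; rewrite /Nm mul0r mulr0 Psi0 Psi_fball //.
rewrite in_fball rmorphM rmorphM /= hs_starK su [star x * x]mulrC eqxx /=.
by apply: pball0M => //; apply: Nm_pball hx _.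
Qed.

Lemma psum_linear (u : K) (d : K) : star u = u -> u \in pball (-1) -> d \in pball 0 ->
  qsum (pball 0) (pball 1) (fun z => Psi (u * Tr (d * star z))) =
  if u * d \in pball 0 then (q ^ 2)%:R else 0.
Proof.
move=> su hu hd; have := @psum_pball 0 1 (u * star d); rewrite add0r oppr0 expr1.
rewrite -[X in if X \in _ then _ else _](hs_starK) pball_star rmorphM /= hs_starK su => <-.
  apply: eq_qsumr => z; congr (Psi _).
  by rewrite /Tr !rmorphM /= !hs_starK su; ring.
by apply: pballM0 => //; rewrite pball_star.
Qed.

(** In the double sum for the squared absolute value, the translation of d by z leaves a linear
    character in z. Summing over z first keeps only d divisible by pi, which form a single class of
    weight q^2. *)
Lemma gauss_norm u : star u = u -> u != 0 -> w u = -1 -> `|gauss u 1| = q%:R.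
Proof.
move=> su u0 wu; have hu : u \in pball (- 1%:Z) by rewrite in_pball wu lexx orbT.
apply: (@pexpIrn _ 2) => //; rewrite ?nnegrE //.
rewrite normCK {2}/gauss /qsum rmorph_sum /=.
rewrite -/(qsum (pball 0) (pball 1) (fun d => (Psi (u * Nm d))^*)) -qsum_mulr.
have e z : z \in pball 0 -> gauss u 1 * (Psi (u * Nm z))^* =
    qsum (pball 0) (pball 1) (fun d => Psi (u * Nm d) * Psi (u * Tr (d * star z))).
  move=> hz; rewrite -qsum_mull (@qsum_translate _ _ (pball 0) (pball 1) z).
  - apply: eq_qsum; [exact: fin_pball | exact: sub_pball0 |] => d hd.
    rewrite Psi_conj ?gauss_phase // -!hs_psiD ?rmorphN /= ?gauss_phase //; last first.
      by rewrite rmorphM /= su star_Tr.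
    by congr Psi; rewrite NmD; ring.
  - exact: sub_pball0.
  - exact: fin_pball.
  - by [].
  - by move=> x y hx hy; rewrite (@Nm_phase_inv u 1).
rewrite (eq_qsum (fin_pball _ 0 1) (@sub_pball0 1) e) qsum_exchange.
have e2 d : d \in pball 0 -> qsum (pball 0) (pball 1) (fun z => Psi (u * Nm d) * Psi (u * Tr (d * star z))) =
   if d \in pball 1 then (q ^ 2)%:R * Psi (u * Nm d) else 0.
  move=> hd; rewrite qsum_mulr psum_linear //.
  have -> : (u * d \in pball 0) = (d \in pball 1).
    by have := pball_mulE 1 d u0; rewrite wu addNr.
  by case: ifP; rewrite ?mulr0 // mulrC.
rewrite (eq_qsum (fin_pball _ 0 1) (@sub_pball0 1) e2).
rewrite (@qsum_cond _ _ (pball 0) (pball 1) (pball 1)) //; last exact: fin_pball.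
  rewrite qsum_trivial //; first by rewrite /Nm mul0r mulr0 Psi0 mulr1 natrX.
  move=> x hx; rewrite -[x in LHS]add0r (@Nm_phase_inv u 1) //; exact: rpred0.
exact: sub_pball0.
Qed.

(** All u are treated at once. The q - 1 nonzero classes u in pi^-1 O / O have sums of absolute
    value q that add up to -q (q - 1), so equality holds in the triangle inequality and each of them
    is -q. F and G are set to 0 on the trivial class to exclude it. *)
Lemma gauss1 u : star u = u -> u != 0 -> w u = -1 -> gauss u 1 = - q%:R.
Proof.
have sub1 : {subset (fball 0 : {pred K}) <= fball (-1)} by exact: fball_mono.
have fin1 := fin_fball D (-1) 0.
pose F (u : K) := if u \in fball 0 then 0 else - gauss u 1.
pose G (u : K) : C := if u \in fball 0 then 0 else q%:R.
have ginv x v : x \in fball (-1) -> v \in fball 0 -> gauss (x + v) 1 = gauss x 1.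
  move=> hx hv; apply: eq_qsum; [exact: fin_pball | exact: sub_pball0 |] => d hd.
  rewrite mulrDl Psi_addint ?gauss_phase ?(fball_fix hx) //.
  rewrite in_fball gauss_phase ?(fball_fix hv) // eqxx /=.
  by apply: pball0M; [exact: fball_pball hv | apply: Nm_pball hd _].
have sumG : qsum (fball (-1)) (fball 0) G = q%:R * q%:R - q%:R.
  transitivity (qsum (fball (-1)) (fball 0) (fun u : K => q%:R - (if u \in fball 0 then q%:R else 0) : C)).
    by apply: eq_qsumr => x; rewrite /G; case: ifP; rewrite ?subrr ?subr0.
  rewrite qsumB (@qsum_cond _ _ (fball (-1)) (fball 0) (fball 0)) //.
  have := count_fball D (-1) 1; rewrite addNr expr1 => c1.
  by rewrite qsum_const c1 qsum_trivial.
(* After exchanging the sums, the sum over u detects whether pi divides Nm d, that is whether pi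
   divides d: the norm form is anisotropic modulo pi. *)
have total : qsum (fball (-1)) (fball 0) (fun u => gauss u 1) = q%:R.
  rewrite /gauss qsum_exchange.
  have e d : d \in pball 0 -> qsum (fball (-1)) (fball 0) (fun u => Psi (u * Nm d)) =
      if d \in pball 1 then q%:R else 0.
    move=> hd; rewrite -Nm_pball1 //.
    have := @psum_fball (-1) 1 (Nm d) (star_Nm d); rewrite addNr oppr0 expr1 opprK => <-.
      by apply: eq_qsumr => r; rewrite mulrC.
    exact: Nm_pball hd _.
  rewrite (eq_qsum (fin_pball _ 0 1) (@sub_pball0 1) e).
  rewrite (@qsum_cond _ _ (pball 0) (pball 1) (pball 1)) //; last exact: fin_pball.
    by rewrite qsum_trivial.
  exact: sub_pball0.
have sumF : qsum (fball (-1)) (fball 0) F = q%:R * q%:R - q%:R.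
  transitivity (qsum (fball (-1)) (fball 0) (fun u : K =>
      (if u \in fball 0 then gauss u 1 else 0) - gauss u 1 : C)).
    by apply: eq_qsumr => x; rewrite /F; case: ifP; rewrite ?subrr ?sub0r.
  rewrite qsumB total (@qsum_cond _ _ (fball (-1)) (fball 0) (fball 0)) //; congr (_ - _).
  rewrite qsum_trivial //; last by move=> x hx; rewrite -[x]add0r ginv // rpred0.
  rewrite /gauss; under eq_qsumr do rewrite mul0r Psi0.
  by have := count_pball D 0 1; rewrite add0r expr1 => ->; rewrite natrX expr2.
have key x : x \in coset_reps (fball (-1)) (fball 0) -> F x = G x.
  move=> xs; pose s := coset_reps (fball (-1) : {pred K}) (fball 0).
  have Fi (i : 'I_(size s)) : `|F s`_i| <= G s`_i.
    have /(coset_reps_sub fin1 sub1) hs := mem_nth 0 (ltn_ord i).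
    rewrite /F /G; case: ifPn => h; first by rewrite normr0.
    have v0 : s`_i != 0 by apply: contraNneq h => ->; rewrite rpred0.
    rewrite normrN gauss_norm ?(fball_fix hs) //.
    move: hs h; rewrite !in_fball !in_pball (negPf v0) /= => /andP[-> h1] /= h2.
    by move: h1 h2; move: (w s`_i) => z; lia.
  have ss : \sum_(i < size s) F s`_i = \sum_(i < size s) G s`_i.
    move: sumF; rewrite -sumG /qsum -/s (big_nth 0) big_mkord => ->.
    by rewrite (big_nth 0) big_mkord.
  have lt : (index x s < size s)%N by rewrite index_mem.
  have /= h := normC_sum_upper (fun i _ => Fi i) ss (i := Ordinal lt) isT.
  by have := h; rewrite (nth_index 0 xs).
move=> su u0 wu.
have hu : u \in fball (-1) by rewrite in_fball su eqxx in_pball wu lexx orbT.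
have r_in : coset_rep (fball 0) u \in coset_reps (fball (-1) : {pred K}) (fball 0).
  by apply/coset_repsP => //; exists u.
have nr : (coset_rep (fball 0) u \in fball 0) = false.
  apply/negP=> h; have : u \in fball 0.
    by rewrite -[u](subKr (coset_rep (fball 0) u)) (@rpredB _ (fball 0)) // coset_repP.
  by rewrite in_fball in_pball (negPf u0) wu andbF.
have := key _ r_in; rewrite /F /G nr.
rewrite -[coset_rep _ _](subrK u) addrC ginv ?coset_repP //.
by move=> /eqP; rewrite eqr_oppLR => /eqP.
Qed.

(** On the last layer, y in pi^(m+1) O modulo pi^(m+2), the term u Nm y is integral and the phase is
    linear in y. The sum over y vanishes unless pi divides d, and d = pi x moves pi^2 into u. *)
Lemma gauss_rec u m : star u = u -> u != 0 -> w u = - (m.+2)%:Z ->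
  gauss u m.+2 = (q ^ 2)%:R * gauss (u * pi ^ 2) m.
Proof.
move=> su u0 wu.
have hu : u \in pball (- (m.+2)%:Z) by rewrite in_pball wu lexx orbT.
have m1 : {subset (pball m.+1 : {pred K}) <= pball 0} by exact: sub_pball0.
rewrite /gauss (@qsum_tower _ _ (pball 0) (pball m.+1) (pball m.+2)) //; first last.
- by move=> x y hx hy; rewrite (@Nm_phase_inv u m.+2).
- exact: fin_pball.
- exact: fin_pball.
- by apply: pball_mono; lia.
have e d : d \in pball 0 ->
    qsum (pball m.+1) (pball m.+2) (fun y => Psi (u * Nm (d + y))) =
    if d \in pball 1 then (q ^ 2)%:R * Psi (u * Nm d) else 0.
  move=> hd.
  transitivity (qsum (pball m.+1) (pball m.+2) (fun y => Psi (u * Nm d) * Psi (Tr ((u * star d) * y)))).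
    apply: eq_qsum; [exact: fin_pball | by apply: pball_mono; lia |] => y hy.
    rewrite NmD -addrA [Tr _ + _]addrC addrA mulrDr hs_psiD.
    - rewrite mulrDr Psi_addint ?gauss_phase //.
        congr (_ * Psi _); rewrite /Tr !rmorphM /= !hs_starK su; ring.
      rewrite in_fball gauss_phase // eqxx /= -(addNr (m.+2)%:Z); apply: pballM => //.
      by apply: Nm_pball hy _; lia.
    - by rewrite rmorphM rmorphD /= su !star_Nm.
    - by rewrite rmorphM /= su star_Tr.
  rewrite qsum_mulr.
  have := @psum_pball m.+1 1 (u * star d).
  rewrite (_ : m.+1%:Z + 1%:Z = m.+2%:Z); last by lia.
  move=> ->; last by apply: pballM0; rewrite ?pball_star.
  have -> : (u * star d \in pball (- m.+1%:Z)) = (d \in pball 1).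
    have := pball_mulE 1 (star d) u0; rewrite pball_star wu => <-; congr (_ \in pball _); lia.
  by case: ifP; rewrite ?mulr0 // expr1 mulrC.
rewrite (eq_qsum (fin_pball _ 0 m.+1) m1 e).
rewrite (@qsum_cond _ _ (pball 0) (pball 1) (pball m.+1)); first last.
- exact: fin_pball.
- exact: pball_mono.
- by apply: pball_mono; lia.
rewrite qsum_mulr; congr (_ * _).
rewrite (@qsum_reindex _ _ _ (pball 0) (pball m) _ _ (fun x => pi * x)).
- apply: eq_qsumr => x; congr Psi; rewrite /Nm rmorphM /= hs_star_pi; ring.
- exact: sub_pball0.
- exact: fin_pball.
- by move=> x hx; rewrite -[pi]/(pi ^ 1%:Z) pball_piX subrr.
- move=> x y _ _; rewrite -mulrBr -[pi]/(pi ^ 1%:Z) pball_piX; congr (_ \in pball _); lia.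
- move=> x hx; exists (pi ^ (-1) * x); first by rewrite pball_piX sub0r opprK.
  by rewrite -[pi in pi * _]expr1z mulrA -expfzDr ?hs_pi_neq0 // mul1r subrr rpred0.
- move=> x y hx hy; rewrite NmD -addrA mulrDr Psi_addint ?gauss_phase //.
  rewrite in_fball rmorphM rmorphD /= su star_Tr star_Nm eqxx /=.
  rewrite -(addNr m.+2%:Z); apply: pballM => //.
  rewrite (@rpredD _ (pball m.+2)) //.
    apply: fball_pball; apply: Tr_fball; rewrite (_ : m.+2%:Z = 1 + m.+1%:Z); last by lia.
    by apply: pballM; rewrite ?pball_star.
  by apply: Nm_pball hy _; lia.
Qed.

Lemma gaussE u m : star u = u -> u != 0 -> w u = - m%:Z -> gauss u m = (- q%:R) ^+ m.
Proof.
have [k mk] := ubnP m; elim: k m mk u => // k IH [|[|m]] mk u su u0 wu.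
- by rewrite expr0 gauss0 // in_pball wu orbT.
- by rewrite expr1 gauss1.
rewrite gauss_rec // IH.
- by rewrite !exprS natrX; ring.
- by lia.
- by rewrite rmorphM /= su star_piX.
- by rewrite mulf_neq0 // piX_neq0.
- by rewrite hs_wM ?piX_neq0 // wu w_piX; lia.
Qed.

(** The phase only depends on z modulo pi^(e-a). Each class has q^(2a) lifts, and q^(2a) (-q)^(e-a)
    = (-q)^(e+a). *)
Lemma gauss_long (r t : K) (e a : nat) : star r = r -> star t = t -> r != 0 -> t != 0 ->
  w r = - e%:Z -> w t = a -> (a <= e)%N ->
  qsum (pball 0) (pball e) (fun z => Psi (r * t * Nm z)) = (- q%:R) ^+ (e + a).
Proof.
move=> sr st r0 t0 wr wt ae.
have srt : star (r * t) = r * t by rewrite rmorphM /= sr st.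
have rt0 : r * t != 0 by rewrite mulf_neq0.
have wrt : w (r * t) = - (e - a)%N%:Z by rewrite hs_wM // wr wt; lia.
have hrt : r * t \in pball (- (e - a)%N%:Z) by rewrite in_pball wrt lexx orbT.
rewrite (@qsum_tower _ _ (pball 0) (pball (e - a)%N) (pball e)) //; first last.
- move=> x y hx hy; rewrite (@Nm_phase_inv _ (e - a)%N) //.
  by apply: pball_mono hy; lia.
- exact: fin_pball.
- exact: fin_pball.
- exact: sub_pball0.
- by apply: pball_mono; lia.
transitivity (qsum (pball 0) (pball (e - a)%N) (fun z => (q ^ 2)%:R ^+ a * Psi (r * t * Nm z))).
  apply: eq_qsum; [exact: fin_pball | exact: sub_pball0 |] => z hz.
  have := count_pball D (e - a)%N a; rewrite (_ : (e - a)%N%:Z + a%:Z = e%:Z); last by lia.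
  move=> <-; rewrite -qsum_mull.
  apply: eq_qsum; [exact: fin_pball | by apply: pball_mono; lia |] => y hy.
  by rewrite mul1r (@Nm_phase_inv _ (e - a)%N).
rewrite qsum_mulr -/(gauss (r * t) (e - a)) gaussE //.
have -> : (e + a = 2 * a + (e - a))%N by lia.
by rewrite exprD exprM sqrrN natrX.
Qed.

End CharacterSums.

Lemma qsum1_neq0 (V : zmodType) (W : numDomainType) (A B : zmodClosed V) :
  fin_index A B -> qsum A B (fun=> 1 : W) != 0.
Proof.
move=> fAB; rewrite /qsum big_const_seq count_predT iter_addr_0 pnatr_eq0 -lt0n.
have : coset_rep B 0 \in coset_reps A B.
  by apply/coset_repsP => //; exists 0; rewrite ?rpred0.
by case: (coset_reps A B).
Qed.

(** * Truncated Siegel series *)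

Section SiegelSums.
Variable D : herm_setting.
Local Notation K := (hs_K D).
Local Notation C := (hs_C D).
Local Notation w := (@hs_w D).
Local Notation star := (@hs_star D).
Local Notation pi := (hs_pi D).
Local Notation theta := (hs_theta D).
Local Notation q := (hs_q D).
Local Notation Psi := (@hs_psi D).

Lemma star_trM n (T R : 'M[K]_n) : adjmx T = T -> adjmx R = R ->
  star (\tr (T *m R)) = \tr (T *m R).
Proof. by move=> sT sR; rewrite -tr_adj adjmxM sT sR mxtrace_mulC. Qed.

Definition phase n (T R : 'M[K]_n) : C := Psi (\tr (T *m R)).

Lemma phaseD n (T R S : 'M[K]_n) : adjmx T = T -> adjmx R = R -> adjmx S = S ->
  phase T (R + S) = phase T R * phase T S.
Proof. by move=> sT sR sS; rewrite /phase mulmxDr mxtraceD hs_psiD // star_trM. Qed.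

Lemma phase_int n (T R : 'M[K]_n) : adjmx T = T -> adjmx R = R ->
  T *m R \in mball n n 0 -> phase T R = 1.
Proof.
by move=> sT sR h; rewrite /phase Psi_fball // in_fball star_trM // eqxx /= mball_tr.
Qed.

Lemma phase_addint n (T R S : 'M[K]_n) : T \in hball n 0 -> adjmx R = R -> S \in hball n 0 ->
  phase T (R + S) = phase T R.
Proof.
move=> hT sR hS; rewrite phaseD ?(hball_adj hT) ?(hball_adj hS) //.
rewrite (@phase_int _ _ S) ?(hball_adj hT) ?(hball_adj hS) ?mulr1 //.
by apply: mball0M; exact: hball_mball.
Qed.

Definition periodic n (F : 'M[K]_n -> C) : Prop :=
  forall R S, adjmx R = R -> S \in hball n 0 -> F (R + S) = F R.

Lemma ord_addint n (R S : 'M[K]_n) : S \in mball n n 0 -> ord (R + S) = ord R.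
Proof. by move=> hS; apply: eq_ord; exact: idx_addint. Qed.

Lemma ord_gl n (U V R : 'M[K]_n) : U \in gl n -> V \in gl n -> ord (U *m R *m V) = ord R.
Proof. by move=> hU hV; apply: eq_ord; exact: idx_gl. Qed.

Lemma mball_gl n N (h R : 'M[K]_n) : h \in gl n ->
  (h *m R *m adjmx h \in mball n n N) = (R \in mball n n N).
Proof.
move=> hh; have ha : adjmx h \in gl n by exact: gl_adj.
apply/idP/idP => H; last first.
  by apply: mballM0; [apply: mball0M => // |]; exact: gl_ball.
rewrite -[R](mulKmx (gl_unit hh)) -[h *m R](mulmxK (gl_unit ha)).
by apply: mball0M; [|apply: mballM0 => //]; exact/gl_ball/glV.
Qed.

Definition hsum n (E : nat) (F : 'M[K]_n -> C) : C :=
  qsum (hball n (- E%:Z)) (hball n 0) F.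

Lemma sub_hball0 n (E : nat) : {subset (hball n 0 : {pred 'M[K]_n}) <= hball n (- E%:Z)}.
Proof. by apply: hball_mono; rewrite oppr_le0. Qed.

Lemma eq_hsum n E (F G : 'M[K]_n -> C) : {in hball n (- E%:Z), F =1 G} ->
  hsum E F = hsum E G.
Proof. by move=> FG; apply: eq_qsum FG; [exact: fin_hball | exact: sub_hball0]. Qed.

Lemma hsum_congr n E (h : 'M[K]_n) (F : 'M[K]_n -> C) : h \in gl n ->
  (forall R S, R \in hball n (- E%:Z) -> S \in hball n 0 -> F (R + S) = F R) ->
  hsum E F = hsum E (fun R => F (h *m R *m adjmx h)).
Proof.
move=> hh Fp; have hb := gl_ball hh; have hu := gl_unit hh.
have ha : adjmx h \in unitmx by rewrite adjmx_unit.
have inv R : invmx h *m (h *m R *m adjmx h) *m adjmx (invmx h) = R.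
  by rewrite adjmx_inv !mulmxA mulVmx // mul1mx mulmxK.
have inv2 R : h *m (invmx h *m R *m adjmx (invmx h)) *m adjmx h = R.
  by rewrite adjmx_inv !mulmxA mulmxV // mul1mx mulmxKV.
have hV := gl_ball (glV hh).
apply: qsum_reindex => //.
- exact: sub_hball0.
- exact: fin_hball.
- by move=> R hR; exact: hball_congr.
- move=> R S hR hS; rewrite -mulmxBl -mulmxBr; apply/idP/idP => H; last exact: hball_congr.
  by rewrite -[R - S]inv; exact: hball_congr.
- move=> R hR; exists (invmx h *m R *m adjmx (invmx h)); first exact: hball_congr.
  by rewrite inv2 subrr rpred0.
Qed.

Lemma phase_congr n (T R U : 'M[K]_n) : phase T (U *m R *m adjmx U) = phase (adjmx U *m T *m U) R.
Proof. by rewrite /phase mulmxA mxtrace_mulC !mulmxA. Qed.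

(** A nonintegral entry A_ij is detected by moving Z along the elementary matrix with indices (j,
    i). *)
Lemma psum_mx n p (N : nat) (A : 'M[K]_(n, p)) : A \in mball n p (- N%:Z) -> A \notin mball n p 0 ->
  qsum (mball p n 0) (mball p n N) (fun Z => Psi (Tr (\tr (Z *m A)))) = 0.
Proof.
move=> hA nA; have [i [j Aij]] : exists i j, A i j \notin pball 0.
  move: nA; rewrite inE negb_forall => /existsP[ i ]; rewrite negb_forall => /existsP[j] h.
  by exists i, j.
have A0 : A i j != 0 by apply: contraNneq Aij => ->; rewrite rpred0.
have wA : w (A i j) <= -1.
  by move: Aij; rewrite !in_pball (negPf A0) /=; move: (w _) => z; lia.
have [x [sx x0 wx px]] := psi_witness D.
pose c := 2%:R^-1 * (x / A i j).
apply: (@qsum_twist0 _ _ _ _ (c *: delta_mx j i) (Psi x)) => //.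
- exact: mball_mono.
- exact: fin_mball.
- rewrite -[0]addr0; apply: mballZ.
    by rewrite pball_half in_pball hs_wM ?invr_eq0 // wV // wx subr_ge0 wA orbT.
  apply/mballP=> s t; rewrite mxE; case: (_ && _); rewrite ?rpred0 //; exact: pball1.
- move=> Z Y _ hY; rewrite mulmxDl mxtraceD TrD Psi_addint ?star_Tr //.
  by apply: Tr_fball; apply: mball_tr; rewrite -(addrN N%:Z); exact: mballM.
- move=> Z _; rewrite mulmxDl mxtraceD TrD.
  have -> : \tr (c *: delta_mx j i *m A) = 2%:R^-1 * x.
    rewrite -scalemxAl mxtraceZ /mxtrace (bigD1 j) //= big1 ?addr0.
      rewrite mxE (bigD1 i) //= big1 ?addr0 ?mxE ?eqxx ?mul1r //.
        by rewrite /c; field; rewrite hs_2_neq0 A0.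
      by move=> s si; rewrite mxE eqxx (negPf si) mul0r.
    move=> s sj; rewrite mxE big1 // => t _; rewrite mxE (negPf sj) /= mul0r //.
  have -> : Tr (2%:R^-1 * x) = x.
    by rewrite /Tr rmorphM star_half /= sx; field; rewrite hs_2_neq0.
  rewrite hs_psiD ?star_Tr //; exact: mulrC.
Qed.

(* Averaging over R -> h R h^*, h = 1 + pi^(e-1) T^-1 Z, kills the terms whose
   exact denominator pi^e is large compared with the elementary divisors of T. *)
Lemma hsum_vanish n (T : 'M[K]_n) (lam E0 E : nat) (F : 'M[K]_n -> C) :
  T \in hball n 0 -> T \in unitmx -> invmx T \in mball n n (- lam%:Z) ->
  periodic F ->
  (forall h R, h \in gl n -> h - 1%:M \in mball n n 2 -> R \in hball n (- E%:Z) ->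
     F (h *m R *m adjmx h) = F R) ->
  (forall R, R \in hball n (- E%:Z) -> R \in mball n n (- E0%:Z) -> F R = 0) ->
  (lam + 2 <= E0)%N -> hsum E (fun R => F R * phase T R) = 0.
Proof.
move=> hT uT hTV; have sT := hball_adj hT.
elim: E F => [|E IH] F Fp Fh F0 lE.
  rewrite (@eq_hsum _ _ _ (fun=> 0)) ?/hsum ?qsum0 // => R hR.
  rewrite F0 ?mul0r //; apply: mball_mono (hball_mball hR); lia.
have [E0E|EE0] := leqP E.+1 E0.
  rewrite (@eq_hsum _ _ _ (fun=> 0)) ?/hsum ?qsum0 // => R hR.
  rewrite F0 ?mul0r //; apply: mball_mono (hball_mball hR); lia.
(* G isolates the terms of exact denominator pi^(E+1); the others are covered by the induction
   hypothesis. *)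
pose G (R : 'M[K]_n) : C := if R \in mball n n (- E%:Z) then 0 else F R * phase T R.
have subE : {subset (hball n (- E%:Z) : {pred 'M[K]_n}) <= hball n (- E.+1%:Z)}.
  by apply: hball_mono; lia.
have split_sum : hsum E.+1 (fun R => F R * phase T R) =
    hsum E (fun R => F R * phase T R) + hsum E.+1 G.
  rewrite /hsum -(@qsum_cond _ _ (hball n (- E.+1%:Z)) (hball n (- E%:Z))) //; first last.
  - exact: fin_hball.
  - exact: sub_hball0.
  rewrite -qsumD; apply: eq_hsum => R hR; rewrite in_hball (hball_adj hR) eqxx /= /G.
  by case: ifP; rewrite ?addr0 ?add0r.
rewrite split_sum IH ?add0r //; first last.
- by move=> R hR; apply: F0; exact: subE.
- by move=> h R hh h1 hR; apply: Fh => //; exact: subE.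
have Gp R S : R \in hball n (- E.+1%:Z) -> S \in hball n 0 -> G (R + S) = G R.
  move=> hR hS; rewrite /G Fp ?(hball_adj hR) // phase_addint ?(hball_adj hR) //.
  rewrite (@rpredDr _ (mball n n (- E%:Z))) //; apply: hball_mball; exact: sub_hball0.
(* With h = 1 + z and T z = pi^E Z, the linear part of the phase changes by Tr tr(Z pi^E R). The
   quadratic part lies in the ball of exponent 2E - (E+1) - lam, which is nonnegative since E >= E0
   >= lam + 2; for the same reason z is divisible by pi^2. *)
have key Z : Z \in mball n n 0 ->
    hsum E.+1 G = hsum E.+1 (fun R => G R * Psi (Tr (\tr (Z *m (pi ^ E%:Z *: R))))).
  move=> hZ; pose z := pi ^ E%:Z *: (invmx T *m Z).
  have hz : z \in mball n n 2.
    rewrite mball_piX; apply: (@mball_mono _ _ _ (- lam%:Z)); first by lia.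
    exact: mballM0.
  have hh : 1%:M + z \in gl n by apply: gl_near1; exact: mball_mono hz.
  rewrite (hsum_congr hh Gp); apply: eq_hsum => R hR.
  have sR := hball_adj hR.
  have hR' : (1%:M + z) *m R *m adjmx (1%:M + z) \in hball n (- E.+1%:Z).
    by apply: hball_congr => //; exact: gl_ball.
  rewrite /G Fh //; last by rewrite addrC addKr.
  have -> : ((1%:M + z) *m R *m adjmx (1%:M + z) \in mball n n (- E%:Z)) =
      (R \in mball n n (- E%:Z)).
    exact: mball_gl.
  case: ifP => [|_]; first by rewrite mul0r.
  rewrite -mulrA; congr (_ * _).
  have Tz : T *m z = pi ^ E%:Z *: Z by rewrite /z -scalemxAr mulKVmx.
  have -> : (1%:M + z) *m R *m adjmx (1%:M + z) =
     R + (z *m R + R *m adjmx z) + z *m R *m adjmx z.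
    rewrite adjmxD adjmx1 !mulmxDl !mulmxDr !mulmx1 !mul1mx !addrA.
    by congr (_ + _); exact: addrAC.
  have s1 : adjmx (z *m R + R *m adjmx z) = z *m R + R *m adjmx z.
    by rewrite adjmxD !adjmxM adjmxK sR addrC.
  have s2 : adjmx (z *m R *m adjmx z) = z *m R *m adjmx z.
    by rewrite !adjmxM adjmxK sR mulmxA.
  have s12 : adjmx (R + (z *m R + R *m adjmx z)) = R + (z *m R + R *m adjmx z).
    by rewrite adjmxD sR s1.
  rewrite (phaseD sT s12 s2) (phaseD sT sR s1).
  rewrite (@phase_int _ T (z *m R *m adjmx z)) ?mulr1 //.
    rewrite {2}/phase; congr (_ * Psi _); rewrite mulmxDr mxtraceD.
    have e1 : \tr (T *m (z *m R)) = \tr (Z *m (pi ^ E%:Z *: R)).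
      by rewrite mulmxA Tz -scalemxAl -scalemxAr.
    have e2 : \tr (T *m (R *m adjmx z)) = star (\tr (T *m (z *m R))).
      by rewrite -tr_adj !adjmxM sT sR [LHS]mxtrace_mulC.
    by rewrite e2 e1.
  rewrite 2!mulmxA Tz /z adjmxZ star_piX adjmxM adjmx_inv sT.
  rewrite -!scalemxAl -!scalemxAr !scalerA -expfzDr ?hs_pi_neq0 // mball_piX.
  apply: (@mball_mono _ _ _ (- E.+1%:Z + - lam%:Z)); first by lia.
  apply: mballM; first by apply: mball0M => //; exact: hball_mball.
  by apply: mball0M => //; rewrite mball_adj.
(* Average over Z modulo pi: wherever G is nonzero, pi^E R is nonintegral and the character of Z
   sums to 0. *)
have : qsum (mball n n 0 : {pred 'M[K]_n}) (mball n n 1) (fun=> 1 : C) * hsum E.+1 G = 0.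
  rewrite -qsum_mull.
  transitivity (qsum (mball n n 0) (mball n n 1) (fun Z =>
     hsum E.+1 (fun R => G R * Psi (Tr (\tr (Z *m (pi ^ E%:Z *: R))))))).
    apply: eq_qsum; [exact: fin_mball | exact: mball_mono |] => Z hZ.
    by rewrite mul1r; exact: key.
  rewrite /hsum qsum_exchange; transitivity (hsum E.+1 (fun _ : 'M[K]_n => 0 : C)).
    apply: eq_hsum => R hR; rewrite qsum_mulr /G; case: ifPn => nR; first by rewrite mul0r.
    rewrite psum_mx ?mulr0 // mball_piX ?sub0r //.
    apply: mball_mono (hball_mball hR); lia.
  by rewrite /hsum qsum0.
by move/eqP; rewrite mulf_eq0 (negPf (qsum1_neq0 _ (fin_mball _ _ _ _ _))) => /eqP.
Qed.

Definition bsum n E (X : C) (T : 'M[K]_n) : C := hsum E (fun R => X ^+ ord R * phase T R).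

(** [hsum_vanish] with E0 = E, applied to the terms outside the smaller ball. This makes the series
    a polynomial in X. *)
Lemma bsum_stable n (T : 'M[K]_n) (lam E E' : nat) X :
  T \in hball n 0 -> T \in unitmx -> invmx T \in mball n n (- lam%:Z) ->
  (lam + 2 <= E)%N -> (E <= E')%N -> bsum E' X T = bsum E X T.
Proof.
move=> hT uT hTV lE EE'.
have subE : {subset (hball n (- E%:Z) : {pred 'M[K]_n}) <= hball n (- E'%:Z)}.
  by apply: hball_mono; lia.
pose F (R : 'M[K]_n) : C := if R \in mball n n (- E%:Z) then 0 else X ^+ ord R.
have v : hsum E' (fun R => F R * phase T R) = 0.
  apply: (hsum_vanish hT uT hTV _ _ _ lE).
  - move=> R S sR hS; rewrite /F (ord_addint _ (hball_mball hS)).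
    rewrite (@rpredDr _ (mball n n (- E%:Z))) //; apply: hball_mball; exact: sub_hball0.
  - move=> h R hh _ hR; rewrite /F ord_gl ?gl_adj //.
    by rewrite mball_gl.
  - by move=> R _ h; rewrite /F h.
rewrite /bsum -[RHS]addr0 -v /hsum -(@qsum_cond _ _ (hball n (- E'%:Z)) (hball n (- E%:Z))) //.
- rewrite -qsumD; apply: eq_hsum => R hR; rewrite in_hball (hball_adj hR) eqxx /= /F.
  by case: ifP; rewrite ?mul0r ?addr0 ?add0r.
- exact: sub_hball0.
- exact: fin_hball.
Qed.

End SiegelSums.

(** * The difference relation for T and t + T *)

Section BlockSums.
Variable D : herm_setting.
Local Notation K := (hs_K D).
Local Notation C := (hs_C D).
Local Notation w := (@hs_w D).
Local Notation star := (@hs_star D).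
Local Notation pi := (hs_pi D).
Local Notation theta := (hs_theta D).
Local Notation q := (hs_q D).
Local Notation Psi := (@hs_psi D).

Definition blk m (r : K) (y : 'rV[K]_m) (S : 'M[K]_m) : 'M[K]_(1 + m) :=
  block_mx r%:M y (adjmx y) S.

Definition dblk m (t : K) (T : 'M[K]_m) : 'M[K]_(1 + m) := block_mx t%:M 0 0 T.

Lemma blkD m r y (S : 'M[K]_m) r' y' S' :
  blk r y S + blk r' y' S' = blk (r + r') (y + y') (S + S').
Proof. by rewrite /blk add_block_mx adjmxD raddfD. Qed.

Lemma blkB m r y (S : 'M[K]_m) r' y' S' :
  blk r y S - blk r' y' S' = blk (r - r') (y - y') (S - S').
Proof. by rewrite /blk opp_block_mx add_block_mx adjmxB raddfB. Qed.

Lemma adjmx_scalar1_eq (r : K) : (adjmx (r%:M : 'M[K]_1) == r%:M) = (star r == r).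
Proof.
rewrite adjmx_scalar; apply/eqP/eqP => [/matrixP/(_ 0 0)|-> //].
by rewrite !mxE !mulr1n.
Qed.

Lemma adjmx_blk_eq m r y (S : 'M[K]_m) :
  (adjmx (blk r y S) == blk r y S) = (star r == r) && (adjmx S == S).
Proof.
rewrite /blk adjmx_block adjmxK; apply/eqP/andP => [/eq_block_mx[h _ _ ->]|[h /eqP ->]].
  by rewrite -adjmx_scalar1_eq h !eqxx.
by move: h; rewrite -adjmx_scalar1_eq => /eqP ->.
Qed.

Lemma hball_blk m N r y (S : 'M[K]_m) :
  (blk r y S \in hball (1 + m) N) = [&& r \in fball N, y \in mball 1 m N & S \in hball m N].
Proof.
rewrite in_hball adjmx_blk_eq mball_block mball_adj mball_scalar1 in_fball in_hball.
by apply/idP/idP => [/andP[/andP[-> ->]] /and4P[-> -> _ ->]|/and3P[/andP[-> ->] -> /andP[-> ->]]].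
Qed.

Lemma adjmx_dblk m t (T : 'M[K]_m) : star t = t -> adjmx T = T -> adjmx (dblk t T) = dblk t T.
Proof. by move=> st sT; rewrite /dblk adjmx_block !adjmx0 adjmx_scalar st sT. Qed.

Lemma blk_ex m (R : 'M[K]_(1 + m)) : adjmx R = R -> exists r y S, R = blk r y S.
Proof.
rewrite -[R]submxK adjmx_block => /eq_block_mx[_ _ e _].
exists (ulsubmx R 0 0), (ursubmx R), (drsubmx R).
by rewrite /blk -mx11_scalar e.
Qed.

Lemma phase_dblk m t (T : 'M[K]_m) r y S : star t = t -> adjmx T = T ->
  star r = r -> adjmx S = S -> phase (dblk t T) (blk r y S) = Psi (t * r) * phase T S.
Proof.
move=> st sT sr sS; rewrite /phase /dblk /blk mulmx_block !mul0mx !addr0 !add0r.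
rewrite mxtrace_block -scalar_mxM mxtrace_scalar mulr1n hs_psiD ?star_trM //.
by rewrite rmorphM /= st sr.
Qed.

Lemma hsum_blk m E (F : 'M[K]_(1 + m) -> C) :
  (forall R S, R \in hball (1 + m) (- E%:Z) -> S \in hball (1 + m) 0 -> F (R + S) = F R) ->
  hsum E F = qsum (fball (- E%:Z)) (fball 0) (fun r =>
    qsum (mball 1 m (- E%:Z)) (mball 1 m 0) (fun y => hsum E (fun S => F (blk r y S)))).
Proof.
move=> Fp.
have sf : {subset (fball 0 : {pred K}) <= fball (- E%:Z)} by apply: fball_mono; rewrite oppr_le0.
have sm : {subset (mball 1 m 0 : {pred 'rV[K]_m}) <= mball 1 m (- E%:Z)}.
  by apply: mball_mono; rewrite oppr_le0.
have ff := fin_fball D (- E%:Z) 0; have fm := fin_mball D 1 m (- E%:Z) 0.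
have fh := fin_hball D m (- E%:Z) 0.
pose phi (z : K * ('rV[K]_m * 'M[K]_m)) := blk z.1 z.2.1 z.2.2.
pose A N := pair_pred (fball N : {pred K}) (pair_pred (mball 1 m N : {pred 'rV[K]_m}) (hball m N : {pred 'M[K]_m})).
have phiA N z : (phi z \in hball (1 + m) N) = (z \in A N).
  by rewrite hball_blk !inE.
rewrite /hsum (@qsum_reindex _ _ _ (A (- E%:Z)) (A 0) _ _ phi) //; first last.
- move=> R hR; have [r [y [S e]]] := blk_ex (hball_adj hR); exists (r, (y, S)).
    by rewrite -phiA /phi /= -e.
  by rewrite /phi /= -e subrr rpred0.
- by move=> x y _ _; rewrite -phiA /phi blkB.
- by move=> x; rewrite phiA.
- by apply: fin_index_pair => //; exact: fin_index_pair.
- by move=> x; rewrite -!phiA; exact: sub_hball0.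
rewrite qsum_pair //; first last.
- move=> x y; rewrite -/(A _) -/(A _) -!phiA => hx hy; rewrite -(Fp (phi x) (phi y)) //; congr (F _).
  by rewrite /phi blkD.
- exact: fin_index_pair.
- by move=> -[y S] /andP[/= hy hS]; rewrite inE /= sm // sub_hball0.
apply: eq_qsum => // r hr; rewrite qsum_pair //.
- exact: sub_hball0.
- move=> x y hx hy; rewrite -(Fp (phi (r, x)) (phi (0, y))).
  + by congr (F _); rewrite /phi blkD /= addr0.
  + by rewrite phiA inE /= hr.
  + by rewrite phiA inE /= rpred0.
Qed.

(** [Psi] is a character on the fixed field only, so the induction also carries that the partial
    sums are fixed. *)
Lemma Psi_sum m (f : 'I_m -> K) : (forall i, star (f i) = f i) ->
  Psi (\sum_i f i) = \prod_i Psi (f i).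
Proof.
move=> hf; pose P (x : K) (y : C) := star x = x /\ Psi x = y.
suff [] : P (\sum_i f i) (\prod_i Psi (f i)) by [].
apply: (big_ind2 P) => [|x y x' y' [sx ex] [sx' ex']|i _]; first by split; rewrite ?rmorph0 ?Psi0.
  by split; rewrite ?rmorphD ?sx ?sx' //= hs_psiD // ex ex'.
by split.
Qed.

Definition unip m (z : 'rV[K]_m) : 'M[K]_(1 + m) := block_mx 1%:M 0 (adjmx z) 1%:M.

Lemma unip_gl m (z : 'rV[K]_m) : z \in mball 1 m 0 -> unip z \in gl (1 + m).
Proof. by move=> hz; apply: gl_block_unipotent; rewrite mball_adj. Qed.

Lemma unip_congr m (z y : 'rV[K]_m) r S : star r = r ->
  unip z *m blk r y S *m adjmx (unip z) =
  blk r (y + r *: z) (S + (adjmx z *m y + adjmx y *m z + r *: (adjmx z *m z))).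
Proof.
move=> sr; rewrite /unip /blk adjmx_block !adjmx1 adjmx0 adjmxK !mulmx_block.
rewrite !mul1mx !mulmx1 !mul0mx !mulmx0 !addr0 adjmxD adjmxZ sr.
rewrite mul_scalar_mx mul_mx_scalar; congr block_mx; [by rewrite addrC | by rewrite addrC |].
rewrite mulmxDl -scalemxAl addrA [LHS]addrC; congr (_ + _).
by rewrite addrC [X in _ + X]addrC addrA.
Qed.

Section CornerSum.
Variables (m : nat) (d : 'rV[K]_m) (lam : nat).
Hypothesis (d_fix : forall i, star (d 0 i) = d 0 i) (d_neq0 : forall i, d 0 i != 0).
Hypothesis (d_int : forall i, 0 <= w (d 0 i)) (d_le : forall i, w (d 0 i) <= lam).
Local Notation T := (diag_mx d).
Local Notation lT := (\sum_i `|w (d 0%R i)|)%N.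

Lemma diag_adj : adjmx T = T.
Proof. by rewrite adjmx_diag; congr diag_mx; apply/rowP=> i; rewrite mxE d_fix. Qed.

Lemma diag_ball : T \in mball m m 0.
Proof.
apply/mballP=> i j; rewrite mxE; case: eqP => _; rewrite ?mulr0n ?rpred0 // mulr1n.
by rewrite in_pball d_int orbT.
Qed.

Lemma diag_hball : T \in hball m 0.
Proof. by rewrite in_hball diag_adj eqxx diag_ball. Qed.

Lemma diag_mulV : T *m diag_mx (map_mx GRing.inv d) = 1%:M.
Proof.
rewrite mulmx_diag -diag_const_mx; congr diag_mx; apply/rowP=> i.
by rewrite !mxE mulfV.
Qed.

Lemma diag_unit : T \in unitmx.
Proof. by case: (mulmx1_unit diag_mulV). Qed.

Lemma diag_inv : invmx T = diag_mx (map_mx GRing.inv d).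
Proof. by rewrite -[LHS]mulmx1 -diag_mulV mulmxA mulVmx ?diag_unit // mul1mx. Qed.

Lemma diag_inv_ball : invmx T \in mball m m (- lam%:Z).
Proof.
rewrite diag_inv; apply/mballP=> i j; rewrite !mxE; case: eqP => _; rewrite ?mulr0n ?rpred0 // mulr1n.
by rewrite in_pball wV // lerN2 d_le orbT.
Qed.

(** Diagonality of T splits the quadratic phase into one factor per coordinate, each evaluated by
    [gauss_long]; the hypothesis on lam gives w d_i <= e. *)
Lemma diag_gauss (r : K) (e : nat) : star r = r -> r != 0 -> w r = - e%:Z -> (lam <= e)%N ->
  qsum (mball 1 m 0) (mball 1 m e) (fun z => phase T (r *: (adjmx z *m z))) =
  (- q%:R) ^+ (m * e + lT).
Proof.
move=> sr r0 wr le.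
have hr : r \in pball (- e%:Z) by rewrite in_pball wr lexx orbT.
transitivity (qsum (mball 1 m 0) (mball 1 m e) (fun z => \prod_i Psi (r * d 0 i * Nm (z 0 i)))).
  apply: eq_qsumr => z; rewrite -Psi_sum; last first.
    by move=> i; rewrite !rmorphM /= hs_starK sr d_fix [_ * z 0 i]mulrC.
  rewrite /phase; congr Psi; rewrite /mxtrace; apply: eq_bigr => i _.
  rewrite mul_diag_mx !mxE big_ord1 adjmxE /Nm; ring.
rewrite (@qsum_row_prod _ _ _ _ (fun i x => Psi (r * d 0 i * Nm x))) //; last first.
  move=> i x y hx hy; apply: (@Nm_phase_inv _ _ e) => //; first by rewrite rmorphM /= sr d_fix.
  by apply: pballM0 => //; rewrite in_pball d_int orbT.
have e1 i : qsum (pball 0) (pball e) (fun x => Psi (r * d 0 i * Nm x)) = (- q%:R) ^+ (e + `|w (d 0 i)|).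
  by apply: gauss_long => //; move: (d_int i) (d_le i); case: (w (d 0 i)) => [] // a; lia.
rewrite (eq_bigr _ (fun i _ => e1 i)) -(big_morph _ (exprD _) (expr0 _)); congr (_ ^+ _).
by rewrite big_split /= sum_nat_const card_ord mulnC.
Qed.

(** Conjugation by [unip z] shifts the row y by r z and S by a hermitian matrix whose phase is
    explicit. This first confines y to r O^m, by averaging, and then reduces y = r z to y = 0,
    leaving the Gauss sum of [diag_gauss] and a block diagonal matrix. *)
Lemma corner_sum (E : nat) (X : C) (r : K) : r \in fball (- E%:Z) -> (0 < vden r)%N ->
  (lam <= vden r)%N ->
  qsum (mball 1 m (- E%:Z)) (mball 1 m 0)
    (fun y => hsum E (fun S => X ^+ ord (blk r y S) * phase T S)) =
  X ^+ vden r * (- q%:R) ^+ (m * vden r + lT) * bsum E X T.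
Proof.
move=> hr r_nint le; set e := vden r in r_nint le *.
have sr := fball_fix hr.
have nr : r \notin pball 0 by move: r_nint; rewrite /e /vden; case: ifP.
have r0 : r != 0 by apply: contraNneq nr => ->; rewrite rpred0.
have wr : w r = - e%:Z.
  rewrite /e /vden (negPf nr); move: nr; rewrite in_pball (negPf r0) /=; move: (w r) => z; lia.
have eE : (e <= E)%N by move: hr; rewrite fball_vden.
pose sf y := hsum E (fun S => X ^+ ord (blk r y S) * phase T S).
have hyz y z : y \in mball 1 m (- E%:Z) -> z \in mball 1 m 0 ->
   adjmx z *m y + adjmx y *m z + r *: (adjmx z *m z) \in hball m (- E%:Z).
  move=> hy hz; rewrite in_hball !adjmxD adjmxZ !adjmxM !adjmxK sr [_ + adjmx z *m y]addrC eqxx /=.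
  rewrite !(@rpredD _ (mball m m (- E%:Z))) //.
  - by apply: mball0M => //; rewrite mball_adj.
  - by apply: mballM0 => //; rewrite mball_adj.
  - rewrite -[- E%:Z]addr0; apply: mballZ; first exact: fball_pball.
    by apply: mball0M => //; rewrite mball_adj.
have Fp y S S' : adjmx S = S -> S' \in hball m 0 ->
    X ^+ ord (blk r y (S + S')) * phase T (S + S') = X ^+ ord (blk r y S) * phase T S.
  move=> sS hS'; rewrite (phase_addint diag_hball sS hS').
  have -> : blk r y (S + S') = blk r y S + blk 0 0 S' by rewrite blkD !addr0.
  by rewrite ord_addint // hball_mball // hball_blk !rpred0.
have shift y z : y \in mball 1 m (- E%:Z) -> z \in mball 1 m 0 ->
   sf (y + r *: z) = phase T (adjmx z *m y + adjmx y *m z + r *: (adjmx z *m z)) * sf y.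
  move=> hy hz; have hS := hyz y z hy hz.
  rewrite /sf /hsum [LHS](qsum_translate _ _ hS); first last.
  - by move=> S S' hS1 hS'; apply: Fp => //; exact: hball_adj hS1.
  - exact: fin_hball.
  - exact: sub_hball0.
  rewrite -qsum_mulr; apply: eq_hsum => S hS1.
  rewrite phaseD ?diag_adj ?(hball_adj hS1) ?(hball_adj hS) // -unip_congr //.
  by rewrite ord_gl ?gl_adj ?unip_gl // mulrA [LHS]mulrC.
have sfp y y' : y \in mball 1 m (- E%:Z) -> y' \in mball 1 m 0 -> sf (y + y') = sf y.
  move=> hy hy'; apply: eq_hsum => S hS.
  have -> : blk r (y + y') S = blk r y S + blk 0 y' 0 by rewrite blkD !addr0.
  by rewrite ord_addint // hball_mball // hball_blk hy' !rpred0.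
have sm0 N : {subset (mball 1 m 0 : {pred 'rV[K]_m}) <= mball 1 m (- N%:Z)}.
  by apply: mball_mono; rewrite oppr_le0.
have smE : {subset (mball 1 m (- e%:Z) : {pred 'rV[K]_m}) <= mball 1 m (- E%:Z)}.
  by apply: mball_mono; lia.
have fin1 := fin_mball D 1 m (- E%:Z) 0.
have rV : r^-1 \in pball e by rewrite in_pball wV // wr opprK lexx orbT.
(* The choice z = r^-1 zeta T^-1 is integral because lam <= e. It cancels T in the linear phase and
   makes the quadratic phase trivial. *)
have shift2 y (zeta : 'rV[K]_m) : y \in mball 1 m (- E%:Z) -> zeta \in mball 1 m 0 ->
   sf (y + zeta *m invmx T) = Psi (Tr (\tr (zeta *m (r^-1 *: adjmx y)))) * sf y.
  move=> hy hzeta; pose z := r^-1 *: (zeta *m invmx T).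
  have hz : z \in mball 1 m 0.
    apply: (@mball_mono _ _ _ (e%:Z - lam%:Z)); first by lia.
    by apply: mballZ => //; apply: mball0M => //; exact: diag_inv_ball.
  have -> : zeta *m invmx T = r *: z by rewrite scalerA mulfV // scale1r.
  have s1 : adjmx (adjmx z *m y + adjmx y *m z) = adjmx z *m y + adjmx y *m z.
    by rewrite adjmxD !adjmxM !adjmxK addrC.
  have s2 : adjmx (r *: (adjmx z *m z)) = r *: (adjmx z *m z).
    by rewrite adjmxZ adjmxM adjmxK sr.
  rewrite shift //; congr (_ * _); rewrite (phaseD diag_adj s1 s2).
  have Tz : T *m adjmx z = r^-1 *: adjmx zeta.
    rewrite /z adjmxZ fmorphV sr adjmxM adjmx_inv diag_adj -scalemxAr mulKVmx //.
    exact: diag_unit.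
  rewrite (phase_int diag_adj s2) ?mulr1; last first.
    rewrite -scalemxAr mulmxA Tz -scalemxAl scalerA mulfV // scale1r.
    by apply: mball0M => //; rewrite mball_adj.
  rewrite /phase; congr Psi; rewrite mulmxDr mxtraceD.
  have e1 : \tr (T *m (adjmx y *m z)) = \tr (zeta *m (r^-1 *: adjmx y)).
    rewrite mulmxA mxtrace_mulC mulmxA -[z]adjmxK -{1}diag_adj -adjmxM Tz adjmxZ adjmxK fmorphV sr.
    by rewrite -scalemxAl -scalemxAr.
  have e2 : \tr (T *m (adjmx z *m y)) = star (\tr (T *m (adjmx y *m z))).
    by rewrite -tr_adj !adjmxM adjmxK diag_adj [LHS]mxtrace_mulC.
  by rewrite e2 e1 addrC.
(* For y outside pi^-e O^m the column r^-1 y is nonintegral, so its character in zeta averages to 0.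
   Translation by zeta T^-1 respects the condition on y, again because lam <= e. *)
have kill : qsum (mball 1 m (- E%:Z)) (mball 1 m 0)
   (fun y => if y \in mball 1 m (- e%:Z) then 0 else sf y) = 0.
  set G := (fun y => _).
  have Gp x y : x \in mball 1 m (- E%:Z) -> y \in mball 1 m 0 -> G (x + y) = G x.
    move=> hx hy; rewrite /G sfp // (@rpredDr _ (mball 1 m (- e%:Z))) //; exact: sm0.
  have key zeta : zeta \in mball 1 m 0 ->
     qsum (mball 1 m (- E%:Z)) (mball 1 m 0) G =
     qsum (mball 1 m (- E%:Z)) (mball 1 m 0) (fun y => Psi (Tr (\tr (zeta *m (r^-1 *: adjmx y)))) * G y).
    move=> hz; have hzT : zeta *m invmx T \in mball 1 m (- e%:Z).
      apply: (@mball_mono _ _ _ (- lam%:Z)); first by lia.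
      by apply: mball0M => //; exact: diag_inv_ball.
    rewrite (@qsum_translate _ _ _ _ (zeta *m invmx T)) //; last exact: smE.
      apply: eq_qsum => //; first exact: sm0.
      move=> y hy; rewrite /G (@rpredDr _ (mball 1 m (- e%:Z))) //.
      by case: ifP => _; rewrite ?mulr0 // shift2.
    exact: sm0.
  have : qsum (mball 1 m 0 : {pred 'rV[K]_m}) (mball 1 m E) (fun=> 1 : C) *
      qsum (mball 1 m (- E%:Z)) (mball 1 m 0) G = 0.
    rewrite -qsum_mull.
    transitivity (qsum (mball 1 m 0) (mball 1 m E) (fun zeta =>
      qsum (mball 1 m (- E%:Z)) (mball 1 m 0)
        (fun y => Psi (Tr (\tr (zeta *m (r^-1 *: adjmx y)))) * G y))).
      apply: eq_qsum; [exact: fin_mball | exact: mball_mono |] => z hz.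
      by rewrite mul1r; exact: key.
    rewrite qsum_exchange.
    transitivity (qsum (mball 1 m (- E%:Z)) (mball 1 m 0) (fun _ : 'rV[K]_m => 0 : C)); last exact: qsum0.
    apply: eq_qsum => //; first exact: sm0.
    move=> y hy; rewrite qsum_mull /G; case: ifPn => ny; first by rewrite mulr0.
    rewrite psum_mx ?mul0r //.
      apply: (@mball_mono _ _ _ (e%:Z - E%:Z)); first by lia.
      by apply: mballZ => //; rewrite mball_adj.
    apply: contra ny => h; rewrite -mball_adj -[adjmx y]scale1r -(mulfV r0) -scalerA.
    rewrite -[- _]addr0; apply: mballZ => //.
    by rewrite in_pball wr lexx orbT.
  by move/eqP; rewrite mulf_eq0 (negPf (qsum1_neq0 _ (fin_mball _ _ _ _ _))) => /eqP.
have -> : qsum (mball 1 m (- E%:Z)) (mball 1 m 0) sf = qsum (mball 1 m (- e%:Z)) (mball 1 m 0) sf.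
  rewrite -(@qsum_cond _ _ (mball 1 m (- E%:Z)) (mball 1 m (- e%:Z))) //; last exact: sm0.
  rewrite -[RHS]addr0 -[X in _ = _ + X]kill -qsumD; apply: eq_qsumr => y.
  by case: ifP => _; rewrite ?addr0 ?add0r.
(* The remaining rows are y = r z with z integral, and y modulo O corresponds to z modulo pi^e. *)
rewrite (@qsum_reindex _ _ _ (mball 1 m 0) (mball 1 m e) _ _ (fun z => r *: z)); first last.
- by move=> x y hx hy; apply: sfp => //; exact: smE.
- move=> y hy; exists (r^-1 *: y); last by rewrite scalerA mulfV // scale1r subrr rpred0.
  by rewrite -(addrN e%:Z); exact: mballZ.
- move=> x y _ _; rewrite -scalerBr; apply/idP/idP => h.
    rewrite -[x - y]scale1r -(mulVf r0) -scalerA -[e%:Z]addr0; exact: mballZ.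
  rewrite -(addNr e%:Z); apply: mballZ => //.
  by rewrite in_pball wr lexx orbT.
- move=> z hz; rewrite -[- _]addr0; apply: mballZ => //.
  by rewrite in_pball wr lexx orbT.
- exact: fin_mball.
- exact: mball_mono.
have sf0 : sf 0 = X ^+ e * bsum E X T.
  rewrite /bsum /hsum -qsum_mulr; apply: eq_hsum => S hS.
  rewrite /blk adjmx0 ord_block ?(hball_adj hS) ?adjmx_scalar ?sr // ord_scalar exprD.
  by rewrite mulrA.
have lin z : z \in mball 1 m 0 -> sf (r *: z) = phase T (r *: (adjmx z *m z)) * (X ^+ e * bsum E X T).
  move=> hz; have := shift 0 z (rpred0 _) hz.
  by rewrite add0r mulmx0 adjmx0 mul0mx !add0r sf0.
transitivity (qsum (mball 1 m 0) (mball 1 m e)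
   (fun z => phase T (r *: (adjmx z *m z)) * (X ^+ e * bsum E X T))).
  by apply: eq_qsum; [exact: fin_mball | exact: mball_mono | exact: lin].
rewrite qsum_mull diag_gauss //; ring.
Qed.

(* Only the matrices whose corner has a large denominator see the difference,
   and there [corner_sum] applies. *)
Lemma bsum_corner_diff (E : nat) (X : C) (t : K) : star t = t -> t != 0 -> lam%:Z <= w t ->
  bsum E X (dblk (pi ^ 2 * t) T) - bsum E X (dblk t T) =
  (- q%:R) ^+ lT * bsum E X T *
  (bone (pi ^ 2 * t) ((- q%:R) ^+ m * X) E - bone t ((- q%:R) ^+ m * X) E).
Proof.
move=> st t0 wt.
have st2 : star (pi ^ 2 * t) = pi ^ 2 * t by rewrite rmorphM /= star_piX st.
have it : t \in pball 0 by rewrite in_pball (le_trans _ wt) ?orbT.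
have it2 : pi ^ 2 * t \in pball 0 by rewrite pball_piX; apply: pball_mono it.
have exp (u : K) : star u = u -> u \in pball 0 -> bsum E X (dblk u T) =
    qsum (fball (- E%:Z)) (fball 0) (fun r => Psi (u * r) *
     qsum (mball 1 m (- E%:Z)) (mball 1 m 0)
    (fun y => hsum E (fun S => X ^+ ord (blk r y S) * phase T S))).
  move=> su iu; rewrite /bsum hsum_blk; last first.
    move=> R S hR hS; rewrite ord_addint ?(hball_mball hS) // phase_addint ?(hball_adj hR) //.
    rewrite in_hball adjmx_dblk ?diag_adj // eqxx /= mball_block mball_scalar1 iu !rpred0.
    exact: diag_ball.
  apply: eq_qsum; [exact: fin_fball | by apply: fball_mono; rewrite oppr_le0 |] => r hr.
  rewrite -qsum_mulr; apply: eq_qsumr => y; rewrite /hsum -qsum_mulr.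
  apply: eq_hsum => S hS; rewrite phase_dblk ?diag_adj ?(fball_fix hr) ?(hball_adj hS) //.
  by rewrite [RHS]mulrCA.
rewrite !exp // /bone -!qsumB -qsum_mulr.
apply: eq_qsum; [exact: fin_fball | by apply: fball_mono; rewrite oppr_le0 |] => r hr.
have sr := fball_fix hr.
(* For a denominator of at most pi^(w t), both t r and pi^2 t r are integral: the phases are 1 and
   both sides vanish. Beyond it, [vden r] exceeds lam and [corner_sum] applies. *)
have [h|h] := leqP (vden r) `|w t|.
  have int u : star u = u -> u != 0 -> w t <= w u -> Psi (u * r) = 1.
    move=> su u0 wu; apply: Psi_fball; rewrite in_fball rmorphM /= su sr eqxx /=.
    apply: (@pball_mono _ (w u + - (vden r)%:Z)); first by lia.
    by apply: pballM; [exact: pball_w | exact: vden_ball].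
  have n2 : pi ^ 2 * t != 0 by rewrite mulf_neq0 ?piX_neq0.
  have w2 : w t <= w (pi ^ 2 * t) by rewrite hs_wM ?piX_neq0 // w_piX; lia.
  by rewrite (int _ st2 n2 w2) (int _ st t0 (lexx _)) !subrr mulr0.
rewrite corner_sum //; [|lia|lia].
rewrite exprD exprM exprMn; move: (Psi _) (Psi _) (bsum _ _ _) => a b c.
move: (X ^+ vden r) (((- q%:R : C) ^+ m) ^+ vden r) ((- q%:R : C) ^+ lT) => e f g; ring.
Qed.

End CornerSum.

End BlockSums.

(** * The dilation relation *)

Section Dilation.
Variable D : herm_setting.
Local Notation K := (hs_K D).
Local Notation C := (hs_C D).
Local Notation w := (@hs_w D).
Local Notation star := (@hs_star D).
Local Notation pi := (hs_pi D).
Local Notation theta := (hs_theta D).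
Local Notation q := (hs_q D).
Local Notation Psi := (@hs_psi D).

(** The lattice S O^m + O^m. A row whose adjoint lies in it can be cleared by completing the
    square. *)
Definition span_col m (S : 'M[K]_m) : {pred 'cV[K]_m} :=
  [pred y : 'cV[K]_m | `[< exists2 c : 'cV[K]_m, c \in mball m 1 0 & y - S *m c \in mball m 1 0 >]].

Lemma span_colP m (S : 'M[K]_m) y :
  reflect (exists2 c : 'cV[K]_m, c \in mball m 1 0 & y - S *m c \in mball m 1 0) (y \in span_col S).
Proof. exact: asboolP. Qed.

(** Lattice duality: for hermitian S, [stab S] is dual to S O^m + O^m. After diagonalization it
    suffices to find one coordinate in which y fails to lie in d_i O + O. *)
Lemma span_col_dual m (S : 'M[K]_m) (y : 'rV[K]_m) : adjmx S = S ->
  adjmx y \notin span_col S -> exists2 c : 'cV[K]_m, c \in stab S & (y *m c) 0 0 \notin pball 0.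
Proof.
move=> sS ny; have [U [d [hU hd eS]]] := hermitian_diagP sS.
have uU := gl_unit hU; have uaU := gl_unit (gl_adj hU).
pose z : 'cV[K]_m := invmx U *m adjmx y.
have [i hi] : exists i, forall c, c \in pball 0 -> z i 0 - d 0 i * c \notin pball 0.
  apply: contrapT => /forallNP h; move/negP: ny; apply; apply/span_colP.
  have hc i : exists c, c \in pball 0 /\ z i 0 - d 0 i * c \in pball 0.
    have /existsNP[c /not_implyP[c0 /negP]] := h i; rewrite negbK => c1.
    by exists c.
  have /choice[f hf] := hc.
  have hcol : \col_i f i \in mball m 1 0.
    by apply/mballP=> i j; rewrite mxE; case: (hf i).
  exists (invmx (adjmx U) *m \col_i f i).
    by apply: mball0M hcol; exact/gl_ball/glV/gl_adj.
  rewrite {1}eS -(mulmxA (U *m diag_mx d)) mulKVmx // -[adjmx y](mulKVmx uU) -/z -mulmxA -mulmxBr.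
  apply: mball0M; first exact: gl_ball.
  apply/mballP=> i j; rewrite ord1 mul_diag_mx !mxE; case: (hf i) => _.
  by rewrite !mxE.
(* Since d_i O + O = pi^-k O, the vector pi^k e_i, in the diagonalizing coordinates, belongs to
   [stab S] and pairs with y to a nonintegral number. *)
pose k := vden (d 0 i).
exists (pi ^ k%:Z *: (invmx (adjmx U) *m delta_mx i 0)).
  have h0 : (delta_mx i 0 : 'cV[K]_m) \in mball m 1 0.
    by apply/mballP=> a b; rewrite mxE; case: (_ && _); rewrite ?rpred0 // pball1.
  have h1 : invmx (adjmx U) *m delta_mx i 0 \in mball m 1 0.
    by apply: mball0M h0; exact/gl_ball/glV/gl_adj.
  rewrite in_stab mball_piX (mball_mono _ h1) ?sub0r ?oppr_le0 //=.
  rewrite -scalemxAr eS -(mulmxA (U *m diag_mx d)) mulKVmx // -mulmxA scalemxAr.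
  apply: mball0M; first exact: gl_ball.
  apply/mballP=> a b; rewrite mxE mul_diag_mx !mxE; case: eqP => [->|_] /=; last by rewrite !mulr0 rpred0.
  case: (_ == _); rewrite ?mulr0 ?rpred0 // mulr1 pball_piX sub0r; exact: vden_ball.
rewrite -scalemxAr mxE.
have -> : (y *m (invmx (adjmx U) *m (delta_mx i 0 : 'cV[K]_m))) 0 0 = star (z i 0).
  have -> : y *m (invmx (adjmx U) *m (delta_mx i 0 : 'cV[K]_m)) = adjmx z *m delta_mx i 0.
    by rewrite /z adjmxM adjmxK adjmx_inv mulmxA.
  rewrite mxE (bigD1 i) //= big1 ?addr0 => [|j ji]; first by rewrite !mxE !eqxx mulr1.
  by rewrite [delta_mx _ _ _ _]mxE (negPf ji) /= mulr0.
rewrite pball_piX pball_star sub0r; apply/negP=> hz.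
have := hi 0 (rpred0 _); rewrite mulr0 subr0 => nz.
have z0 : z i 0 != 0 by apply: contraNneq nz => ->; rewrite rpred0.
have dn : d 0 i \notin pball 0.
  by apply: contra nz => di; move: hz; rewrite /k /vden di oppr0.
have d0 : d 0 i != 0 by apply: contraNneq dn => ->; rewrite rpred0.
have := hi (z i 0 / d 0 i); rewrite mulrCA mulfV // mulr1 subrr rpred0 => h.
have : z i 0 / d 0 i \in pball 0; last by move/h.
move: hz dn; rewrite /k /vden !in_pball mulf_eq0 invr_eq0 (negPf z0) (negPf d0) /= hs_wM ?invr_eq0 // wV //.
by move: (w _) (w _) => a b; case: ifP; lia.
Qed.

Definition dil m : 'M[K]_(1 + m) := block_mx pi%:M 0 0 1%:M.

Lemma adj_dil m : adjmx (dil m) = dil m.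
Proof. by rewrite /dil adjmx_block !adjmx0 adjmx_scalar hs_star_pi adjmx1. Qed.

Lemma dil_blk m r y (S : 'M[K]_m) :
  dil m *m blk r y S *m dil m = blk (pi ^ 2 * r) (pi *: y) S.
Proof.
rewrite /dil /blk !mulmx_block !mul0mx !mulmx0 !addr0 !add0r !mul1mx !mulmx1.
rewrite -!scalar_mxM mul_scalar_mx mul_mx_scalar adjmxZ hs_star_pi; congr block_mx.
congr (_%:M); rewrite -[pi ^ 2]/(pi ^+ 2); ring.
Qed.

Lemma dil_dblk m t (S : 'M[K]_m) :
  dil m *m dblk t S *m dil m = dblk (pi ^ 2 * t) S.
Proof.
have h := dil_blk t 0 S; rewrite scaler0 in h.
by rewrite /dblk -[X in block_mx _ _ X _](adjmx0 D 1 m) -/(blk t 0 S) h /blk adjmx0.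
Qed.

Lemma stab_blk m r y (S : 'M[K]_m) (a : 'M[K]_1) (b : 'cV[K]_m) :
  (col_mx a b \in stab (blk r y S)) =
  [&& a \in mball 1 1 0, b \in mball m 1 0, r *: a + y *m b \in mball 1 1 0
    & adjmx y *m a + S *m b \in mball m 1 0].
Proof. by rewrite in_stab /blk mul_block_col !mball_col mul_scalar_mx -andbA. Qed.

(** The image of the integral columns under [dil]. *)
Definition top_divisible m : {pred 'cV[K]_(1 + m)} :=
  [pred c : 'cV[K]_(1 + m) | (c \in mball (1 + m) 1 0) && (usubmx c \in mball 1 1 1)].

Fact top_divisible_zmod_closed m : zmod_closed (@top_divisible m).
Proof.
split=> [|c d]; first by rewrite inE linear0 !rpred0.
move=> /andP[c1 c2] /andP[d1 d2]; rewrite inE linearB.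
by rewrite (@rpredB _ (mball _ _ 0)) // (@rpredB _ (mball 1 1 1)).
Qed.

HB.instance Definition _ m :=
  GRing.isZmodClosed.Build 'cV[K]_(1 + m) (@top_divisible m) (@top_divisible_zmod_closed m).

Lemma in_top_divisible m (c : 'cV[K]_(1 + m)) :
  (c \in @top_divisible m) = (c \in mball (1 + m) 1 0) && (usubmx c \in mball 1 1 1).
Proof. by []. Qed.

Definition dil_stab m (R : 'M[K]_(1 + m)) : {pred 'cV[K]_(1 + m)} :=
  [pred c : 'cV[K]_(1 + m) | (c \in mball (1 + m) 1 0) && (dil m *m c \in stab R)].

Fact dil_stab_zmod_closed m (R : 'M[K]_(1 + m)) : zmod_closed (dil_stab R).
Proof.
split=> [|c d]; first by rewrite inE mulmx0 !rpred0.
move=> /andP[c1 c2] /andP[d1 d2]; rewrite inE mulmxBr.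
by rewrite (@rpredB _ (mball _ _ 0)) // (@rpredB _ (stab R)).
Qed.

HB.instance Definition _ m (R : 'M[K]_(1 + m)) :=
  GRing.isZmodClosed.Build 'cV[K]_(1 + m) (dil_stab R) (dil_stab_zmod_closed R).

Lemma in_dil_stab m (R : 'M[K]_(1 + m)) c :
  (c \in dil_stab R) = (c \in mball (1 + m) 1 0) && (dil m *m c \in stab R).
Proof. by []. Qed.

Lemma dil_col m (a : 'M[K]_1) (b : 'cV[K]_m) : dil m *m col_mx a b = col_mx (pi *: a) b.
Proof. by rewrite /dil mul_block_col !mul0mx addr0 add0r mul1mx mul_scalar_mx. Qed.

Lemma piZ_ball p n (A : 'M[K]_(p, n)) N : (pi *: A \in mball p n N) = (A \in mball p n (N - 1)).
Proof. exact: (mball_piX 1 N A). Qed.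

Lemma mball_pi p n (A : 'M[K]_(p, n)) N : A \in mball p n N -> pi *: A \in mball p n N.
Proof. by move=> h; rewrite piZ_ball; apply: mball_mono h; rewrite gerBl. Qed.

Lemma dil_stab_col m r y (S : 'M[K]_m) (a : 'M[K]_1) (b : 'cV[K]_m) :
  (col_mx a b \in dil_stab (blk r y S)) =
  [&& a \in mball 1 1 0, b \in mball m 1 0, (pi * r) *: a + y *m b \in mball 1 1 0
    & pi *: (adjmx y *m a) + S *m b \in mball m 1 0].
Proof.
rewrite in_dil_stab dil_col stab_blk mball_col scalerA [r * pi]mulrC -scalemxAr.
case ha: (a \in _) => //=; rewrite (mball_pi ha) /=.
by case: (b \in _).
Qed.

(** Two factors q^2. First, [stab R] lies in [top_divisible], of index q^2 in the integral columns.
    Secondly, pulled back by [dil], it has index q^2 in the stabilizer of the dilated matrix: there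
    the first row is only required to lie in pi^-1 O, and [span_col_dual] shows that every class of
    pi^-1 O / O occurs. *)
Lemma idx_dil m r y (S : 'M[K]_m) : star r = r -> adjmx S = S ->
  adjmx y \notin span_col S ->
  idx (blk r y S) = ((q ^ 2)%:R ^+ 2) * idx (dil m *m blk r y S *m dil m).
Proof.
move=> sr sS ny; set R := blk r y S; set R2 := _ *m _ *m _.
have eR2 : R2 = blk (pi ^ 2 * r) (pi *: y) S by rewrite /R2 dil_blk.
(* If the first coordinate of a stabilizing column were a unit, dividing by it would place y in the
   span of the columns of S. *)
have sub0 : {subset stab R <= @top_divisible m}.
  move=> c; rewrite -[c]vsubmxK stab_blk; set a := usubmx c; set b := dsubmx c.
  move=> /and4P[ha hb _ hab]; rewrite in_top_divisible mball_col ha hb col_mxKu /=.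
  move: ha hab; rewrite [a]mx11_scalar; move: (a 0 0) => {a} x.
  rewrite !mball_scalar1 mul_mx_scalar => hx hab; apply: contraNT ny => nx.
  have x0 : x != 0 by apply: contraNneq nx => ->; rewrite rpred0.
  have wx : w x = 0.
    by move: hx nx; rewrite !in_pball (negPf x0) /=; move: (w x) => z; lia.
  have xV : x^-1 \in pball 0 by rewrite in_pball wV // wx oppr0 lexx orbT.
  apply/span_colP; exists (- (x^-1 *: b)).
    by rewrite (@rpredN _ (mball m 1 0)) -[0]addr0; exact: mballZ.
  rewrite mulmxN opprK -scalemxAr -[adjmx y]scale1r -(mulVf x0) -scalerA -scalerDr.
  by rewrite -[0]addr0; exact: mballZ.
have subL : {subset (@top_divisible m) <= mball (1 + m) 1 0} by move=> c /andP[].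
have fin0 (A : zmodClosed 'cV[K]_(1 + m)) : {subset mball (1 + m) 1 1 <= A} ->
    fin_index (mball (1 + m) 1 0 : {pred 'cV[K]_(1 + m)}) A.
  by move=> h; apply: (@fin_mx _ _ _ 0 1) => // c _; exact: h.
have sub1 : {subset mball (1 + m) 1 1 <= @top_divisible m}.
  move=> c hc; rewrite in_top_divisible (mball_mono _ hc) //=.
  by move: hc; rewrite -{1}[c]vsubmxK mball_col => /andP[].
rewrite {1}/idx (@qsum_tower _ _ _ (@top_divisible m)) //; first last.
- by apply: fin_index_sub (fin_stab R).
- exact: fin0.
rewrite qsum_const.
have -> : qsum (mball (1 + m) 1 0) (@top_divisible m) (fun=> 1 : C) = (q ^ 2)%:R.
  have := count_pball D 0 1; rewrite expr1 add0r => <-.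
  apply: (@qsum_reindex _ _ _ (pball 0) (pball 1) _ _ (fun b => col_mx b%:M 0 : 'cV[K]_(1 + m))) => //.
  - exact: pball_mono.
  - exact: fin_pball.
  - by move=> b hb; rewrite mball_col mball_scalar1 hb rpred0.
  - move=> a b ha hb; rewrite opp_col_mx add_col_mx -raddfB subrr in_top_divisible mball_col col_mxKu !mball_scalar1.
    by rewrite (@rpredB _ (pball 0)) // rpred0.
  - move=> c hc; exists (usubmx c 0 0).
      by move: hc; rewrite -{1}[c]vsubmxK mball_col => /andP[/mballP].
    rewrite in_top_divisible -mx11_scalar -{1 3}[c]vsubmxK opp_col_mx add_col_mx subrr subr0.
    rewrite mball_col col_mxKu !rpred0 /= andbT.
    by move: hc; rewrite -{1}[c]vsubmxK mball_col => /andP[].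
rewrite expr2 -mulrA; congr (_ * _).
transitivity (qsum (mball (1 + m) 1 0) (dil_stab R) (fun=> 1 : C)).
  apply: (@qsum_reindex _ _ _ (mball (1 + m) 1 0) (dil_stab R) _ _ (fun c => dil m *m c : 'cV[K]_(1 + m))) => //.
  - by move=> c /andP[].
  - have [e he] := mball_bound R; apply: (@fin_mx _ _ _ 0 e) => // c hc hc2.
    rewrite in_dil_stab hc /=; apply: (mball_stab he).
    move: hc2; rewrite -[c]vsubmxK dil_col !mball_col => /andP[h1 ->].
    by rewrite mball_pi.
  - move=> c; rewrite -[c]vsubmxK dil_col in_top_divisible !mball_col col_mxKu => /andP[h1 ->].
    by rewrite mball_pi //= piZ_ball.
  - move=> c d hc hd; rewrite -mulmxBr [RHS]in_dil_stab (@rpredB _ (mball (1 + m) 1 0)) //.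
  - move=> c /andP[]; rewrite -[c]vsubmxK mball_col col_mxKu => /andP[h1 h2] h3.
    exists (col_mx (pi^-1 *: usubmx c) (dsubmx c)).
      by rewrite mball_col h2 andbT -[pi^-1]/(pi ^ (-1)) mball_piX sub0r opprK.
    by rewrite dil_col scalerA mulfV ?hs_pi_neq0 // scale1r subrr rpred0.
have dil_bot (a : 'M[K]_1) (b : 'cV[K]_m) : (col_mx a b \in stab R2) =
   [&& a \in mball 1 1 0, b \in mball m 1 0, pi *: ((pi * r) *: a + y *m b) \in mball 1 1 0
    & pi *: (adjmx y *m a) + S *m b \in mball m 1 0].
  rewrite eR2 stab_blk adjmxZ hs_star_pi scalerDr scalerA -!scalemxAl.
  by rewrite (_ : pi ^ 2 * r = pi * (pi * r)) // -[pi ^ 2]/(pi ^+ 2) expr2 mulrA.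
have sub2 : {subset dil_stab R <= stab R2}.
  move=> c; rewrite -[c]vsubmxK dil_stab_col dil_bot => /and4P[-> -> h ->].
  by rewrite mball_pi.
rewrite (@qsum_tower _ _ _ (stab R2)) //; first last.
- have [e he] := mball_bound R; apply: (@fin_mx _ _ _ 0 e); first exact: stab_sub.
  move=> c hc hc2; rewrite in_dil_stab (stab_sub hc) /=; apply: (mball_stab he).
  move: hc2; rewrite -[c]vsubmxK dil_col !mball_col => /andP[h1 ->].
  by rewrite mball_pi.
- exact: fin_stab.
- exact: stab_sub.
rewrite qsum_const mulrC; congr (_ * _).
have [c hc nyc] := span_col_dual sS ny.
set eta := (y *m c) 0 0 in nyc.
have eta0 : eta != 0 by apply: contraNneq nyc => ->; rewrite rpred0.
have weta : w eta <= -1 by move: nyc; rewrite in_pball (negPf eta0) /=; move: (w eta) => z; lia.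
(* Scaling c by pi^j brings y c to valuation exactly -1, so that its multiples by O represent all of
   pi^-1 O / O. *)
pose j := (`|w eta|.-1)%N.
have wj : w eta = - (j%:Z + 1) by rewrite /j; move: (w eta) weta => z; lia.
pose ch : 'cV[K]_m := pi ^ j%:Z *: c.
have yc : y *m c = eta%:M by rewrite [LHS]mx11_scalar.
have [hc1 hc2] : c \in mball m 1 0 /\ S *m c \in mball m 1 0 by apply/andP.
have pj N p n (A : 'M[K]_(p, n)) : A \in mball p n N -> pi ^ j%:Z *: A \in mball p n N.
  by move=> h; rewrite mball_piX; apply: mball_mono h; rewrite gerBl.
have zb N p n (A : 'M[K]_(p, n)) b : b \in pball 0 -> A \in mball p n N -> b *: A \in mball p n N.
  by move=> hb h; rewrite -[N]add0r; exact: mballZ.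
pose eps := pi * (pi ^ j%:Z * eta).
have eps0 : eps != 0 by rewrite !mulf_neq0 ?hs_pi_neq0 ?piX_neq0.
have weps : w eps = 0.
  by rewrite !hs_wM ?mulf_neq0 ?hs_pi_neq0 ?piX_neq0 // hs_w_pi w_piX wj addrA; lia.
have ych b : y *m (b *: ch) = (b * (pi ^ j%:Z * eta))%:M.
  by rewrite /ch -!scalemxAr yc !scale_scalar_mx.
have Sch b : b \in pball 0 -> S *m (b *: ch) \in mball m 1 0.
  by move=> hb; rewrite /ch -!scalemxAr; apply: zb => //; exact: pj.
have hch : ch \in mball m 1 0 by exact: pj.
have key b : b \in pball 0 -> col_mx 0 (b *: ch) \in stab R2.
  move=> hb; rewrite dil_bot rpred0 (zb _ _ _ _ _ hb hch) !mulmx0 !scaler0 !add0r Sch // andbT /=.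
  rewrite ych scale_scalar_mx mball_scalar1 mulrCA -/eps; apply: pball0M => //.
  by rewrite in_pball weps lexx orbT.
have := count_pball D 0 1; rewrite expr1 add0r => <-.
apply: (@qsum_reindex _ _ _ (pball 0) (pball 1) _ _ (fun b => col_mx 0 (b *: ch) : 'cV[K]_(1 + m))) => //.
- exact: pball_mono.
- exact: fin_pball.
- move=> b b' hb hb'; rewrite opp_col_mx add_col_mx subrr -scalerBl dil_stab_col.
  have hbb : b - b' \in pball 0 by exact: (@rpredB _ (pball 0)).
  rewrite rpred0 (zb _ _ _ _ _ hbb hch) !mulmx0 !scaler0 !add0r Sch // andbT /= ych mball_scalar1.
  have n0 : pi ^ j%:Z * eta != 0 by rewrite mulf_neq0 ?piX_neq0.
  have wn : w (pi ^ j%:Z * eta) = -1.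
    by rewrite (hs_wM (piX_neq0 D _) eta0) w_piX wj opprD addrA subrr add0r.
  by have := pball_mulE 1 (b - b') n0; rewrite wn addNr mulrC.
move=> z; rewrite -[z]vsubmxK; set a := usubmx z; set b := dsubmx z.
rewrite dil_bot => /and4P[ha hb h1 h2].
set W := (pi * r) *: a + y *m b in h1.
have [x eW] : exists x, W = x%:M by exists (W 0 0); exact: mx11_scalar.
have hW : pi * x \in pball 0 by move: h1; rewrite eW scale_scalar_mx mball_scalar1.
have hbeta : pi * x / eps \in pball 0.
  by apply: pballM0 => //; rewrite in_pball wV // weps oppr0 lexx orbT.
exists (pi * x / eps) => //.
rewrite opp_col_mx add_col_mx subr0 dil_stab_col ha.
rewrite (@rpredB _ (mball m 1 0) _ _ hb (zb _ _ _ _ _ hbeta hch)) /= !mulmxBr addrA -/W ych eW addrA.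
rewrite (@rpredB _ (mball m 1 0) _ _ h2) ?Sch // ?andbT -raddfB mball_scalar1.
rewrite (_ : x - _ = 0) ?rpred0 //.
rewrite /eps; move: (pi ^ j%:Z * eta) (mulf_neq0 (piX_neq0 D j%:Z) eta0) => u u0.
by field; rewrite u0 hs_pi_neq0.
Qed.

End Dilation.

Section DilationRelation.
Variable D : herm_setting.
Local Notation K := (hs_K D).
Local Notation C := (hs_C D).
Local Notation w := (@hs_w D).
Local Notation star := (@hs_star D).
Local Notation pi := (hs_pi D).
Local Notation theta := (hs_theta D).
Local Notation q := (hs_q D).
Local Notation Psi := (@hs_psi D).

Lemma ord_dil m r y (S : 'M[K]_m) : star r = r -> adjmx S = S ->
  adjmx y \notin span_col S -> ord (blk r y S) = (2 + ord (dil D m *m blk r y S *m dil D m))%N.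
Proof.
move=> sr sS ny; apply: ordP; rewrite (idx_dil sr sS ny) exprD; congr (_ * _).
apply: idx_ord; rewrite !adjmxM adj_dil mulmxA; congr (_ *m _ *m _).
by apply/eqP; rewrite adjmx_blk_eq sr sS !eqxx.
Qed.

Definition form m (S : 'M[K]_m) (c : 'cV[K]_m) : K := (adjmx c *m S *m c) 0 0.

Lemma star_form m (S : 'M[K]_m) c : adjmx S = S -> star (form S c) = form S c.
Proof. by move=> sS; rewrite /form -adjmxE !adjmxM adjmxK sS mulmxA. Qed.

Lemma form_pball m N (S : 'M[K]_m) c : S \in mball m m N -> c \in mball m 1 0 -> form S c \in pball N.
Proof.
move=> hS hc; suff /mballP h : adjmx c *m S *m c \in mball 1 1 N by exact: h.
by apply: mballM0 => //; apply: mball0M => //; rewrite mball_adj.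
Qed.

(* Completing the square removes the integral combination [c] of the columns
   of [S] from the off-diagonal row. *)
Lemma ord_clear m r c (l : 'rV[K]_m) (S : 'M[K]_m) : star r = r -> adjmx S = S ->
  c \in mball m 1 0 -> l \in mball 1 m 0 ->
  ord (blk r (adjmx c *m S + l) S) = (vden (r - form S c) + ord S)%N.
Proof.
move=> sr sS hc hl; set y := _ + l.
pose g : 'M[K]_(1 + m) := block_mx 1%:M (- adjmx c) 0 1%:M.
have hg : g \in gl (1 + m).
  apply: (@gl_intro _ _ _ (block_mx 1%:M (adjmx c) 0 1%:M)).
  - rewrite mulmx_block !mul1mx !mulmx1 !mulmx0 !mul0mx !addr0 !add0r subrr.
    by rewrite -scalar_mx_block.
  - by rewrite mball_block !mball1 rpred0 (@rpredN _ (mball 1 m 0)) mball_adj hc.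
  - by rewrite mball_block !mball1 rpred0 mball_adj hc.
have ay : adjmx y = S *m c + adjmx l by rewrite /y adjmxD adjmxM adjmxK sS.
pose lc := (l *m c) 0 0.
have elc : l *m c = lc%:M by exact: mx11_scalar.
have ealc : adjmx c *m adjmx l = (star lc)%:M by rewrite -adjmxM elc adjmx_scalar.
have ef : adjmx c *m S *m c = (form S c)%:M by exact: mx11_scalar.
have hlc : lc \in pball 0 by rewrite -mball_scalar1 -elc; exact: mball0M.
have e : g *m blk r y S *m adjmx g = dblk (r - form S c) S + blk (- (lc + star lc)) l 0.
  rewrite /g /blk /dblk adjmx_block !adjmx1 adjmx0 !mulmx_block add_block_mx.
  have -> : adjmx (- adjmx c) = - c.
    by apply/matrixP=> i j; rewrite !mxE rmorphN /= hs_starK.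
  rewrite !mul1mx !mulmx1 !mul0mx !mulmx0 !addr0 !add0r ay.
  congr block_mx.
  - have -> : y + - adjmx c *m S = l by rewrite mulNmx /y addrAC subrr add0r.
    rewrite mulNmx mulmxDr mulmxA ef ealc mulmxN elc.
    by apply/matrixP=> i j; rewrite !ord1 !mxE !mulr1n; ring.
  - by rewrite mulNmx /y addrAC subrr add0r.
  - by rewrite mulmxN addrAC subrr add0r.
have -> : ord (blk r y S) = ord (g *m blk r y S *m adjmx g) by rewrite ord_gl // gl_adj.
rewrite e ord_addint; last first.
  apply: (@hball_mball _ _ 0); rewrite hball_blk hl rpred0 andbT in_fball.
  rewrite rmorphN rmorphD /= hs_starK addrC eqxx /= (@rpredN _ (pball 0)).
  by rewrite (@rpredD _ (pball 0)) // pball_star.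
by rewrite ord_block ?ord_scalar // adjmx_scalar rmorphB /= sr star_form.
Qed.

(** Separate exponents for corner, row and block, because the dilation does not map balls to
    balls. *)
Definition hbox m (a b c : int) : {pred 'M[K]_(1 + m)} :=
  [pred R : 'M[K]_(1 + m) | [&& adjmx R == R, ulsubmx R \in mball 1 1 a,
     ursubmx R \in mball 1 m b & drsubmx R \in mball m m c]].

Fact hbox_zmod_closed m a b c : zmod_closed (@hbox m a b c).
Proof.
split=> [|R S]; first by rewrite inE adjmx0 eqxx /ulsubmx /ursubmx /drsubmx !linear0 !rpred0.
move=> /and4P[/eqP r0 r1 r2 r3] /and4P[/eqP s0 s1 s2 s3]; rewrite inE adjmxB r0 s0 eqxx /=.
rewrite /ulsubmx /ursubmx /drsubmx !linearB /= (@rpredB _ (mball 1 1 a)) // (@rpredB _ (mball 1 m b)) //.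
by rewrite (@rpredB _ (mball m m c)).
Qed.

HB.instance Definition _ m a b c :=
  GRing.isZmodClosed.Build 'M[K]_(1 + m) (@hbox m a b c) (@hbox_zmod_closed m a b c).

Lemma hbox_blk m a b c r y (S : 'M[K]_m) :
  (blk r y S \in @hbox m a b c) = [&& r \in fball a, y \in mball 1 m b & S \in hball m c].
Proof.
rewrite [LHS]/(_ && _) adjmx_blk_eq block_mxKul block_mxKur block_mxKdr.
rewrite mball_scalar1 in_fball in_hball.
by apply/idP/idP => [/and4P[/andP[-> ->] -> -> ->]|/and3P[/andP[-> ->] -> /andP[-> ->]]].
Qed.

Lemma hbox_adj m a b c (R : 'M[K]_(1 + m)) : R \in @hbox m a b c -> adjmx R = R.
Proof. by case/and4P=> /eqP. Qed.

Lemma hbox_mono m a b c a' b' c' : a' <= a -> b' <= b -> c' <= c ->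
  {subset @hbox m a b c <= @hbox m a' b' c'}.
Proof.
move=> ha hb hc R hR; have [r [y [S e]]] := blk_ex (hbox_adj hR).
move: hR; rewrite e !hbox_blk => /and3P[h1 h2 h3].
by rewrite (fball_mono ha h1) (mball_mono hb h2) (hball_mono hc h3).
Qed.

Lemma hbox_hball m N (R : 'M[K]_(1 + m)) : (R \in @hbox m N N N) = (R \in hball (1 + m) N).
Proof.
have [sR|nR] := eqVneq (adjmx R) R; last first.
  by rewrite in_hball (negPf nR) [LHS]/(_ && _) (negPf nR).
by have [r [y [S ->]]] := blk_ex sR; rewrite hbox_blk hball_blk.
Qed.

Lemma dil_hbox m a b c (R : 'M[K]_(1 + m)) : adjmx R = R ->
  (dil D m *m R *m dil D m \in @hbox m (2 + a) (1 + b) c) = (R \in @hbox m a b c).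
Proof.
move=> sR; have [r [y [S ->]]] := blk_ex sR; rewrite dil_blk !hbox_blk.
by rewrite fball_piX piZ_ball [2 + a]addrC [1 + b]addrC !addrK.
Qed.

Lemma count_hbox m : qsum (@hbox m (-2) (-1) 0) (hball (1 + m) 0) (fun=> 1 : C) =
  (q ^ 2)%:R ^+ (1 + m).
Proof.
pose A := pair_pred (fball (-2) : {pred K}) (mball 1 m (-1) : {pred 'rV[K]_m}).
pose B := pair_pred (fball 0 : {pred K}) (mball 1 m 0 : {pred 'rV[K]_m}).
have ff := fin_fball D (-2) 0; have fm := fin_mball D 1 m (-1) 0.
have sf : {subset (fball 0 : {pred K}) <= fball (-2)} by exact: fball_mono.
have sm : {subset (mball 1 m 0 : {pred 'rV[K]_m}) <= mball 1 m (-1)} by exact: mball_mono.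
rewrite (@qsum_reindex _ _ _ A B _ _ (fun z => blk z.1 z.2 0)) //; first last.
- move=> R hR; have [r [y [S e]]] := blk_ex (hbox_adj hR).
  move: hR; rewrite e hbox_blk => /and3P[h1 h2 h3]; exists (r, y); first by rewrite inE /= h1.
  by rewrite blkB !subrr subr0 hball_blk !rpred0.
- by move=> x y _ _; rewrite blkB subrr hball_blk rpred0 andbT.
- by move=> x; rewrite hbox_blk rpred0 andbT.
- exact: fin_index_pair.
- by move=> x /andP[h1 h2]; rewrite inE /= sf // sm.
rewrite qsum_pair // qsum_const.
have := count_fball D (-2) 2; rewrite addNr => ->.
have := count_row D m (-1) 1; rewrite addNr mul1n => ->.
by rewrite exprD expr1 natrX.
Qed.

Section Quotient.
Variables (m : nat) (d : 'rV[K]_m) (lam : nat).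
Hypothesis (d_fix : forall i, star (d 0 i) = d 0 i) (d_neq0 : forall i, d 0 i != 0).
Hypothesis (d_int : forall i, 0 <= w (d 0 i)) (d_le : forall i, w (d 0 i) <= lam).
Local Notation T := (diag_mx d).
Variable t : K.
Hypothesis (t_fix : star t = t) (t_neq0 : t != 0) (t_ge : lam%:Z <= w t).
Local Notation a := `|w t|%N.

Let sT : adjmx T = T := diag_adj d_fix.

Lemma dblk_hball u : star u = u -> u \in pball 0 -> dblk u T \in hball (1 + m) 0.
Proof.
move=> su hu; rewrite in_hball adjmx_dblk // eqxx /= mball_block mball_scalar1 hu !rpred0.
exact: diag_ball.
Qed.

Lemma t_int : t \in pball 0.
Proof. by rewrite in_pball (le_trans _ t_ge) ?orbT. Qed.

Lemma dblk_inv : dblk t T *m dblk t^-1 (invmx T) = 1%:M.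
Proof.
rewrite /dblk mulmx_block !mulmx0 !mul0mx !addr0 add0r mulmxV ?diag_unit //.
by rewrite -scalar_mxM mulfV // -scalar_mx_block.
Qed.

Lemma dblk_unit : dblk t T \in unitmx.
Proof. by case: (mulmx1_unit dblk_inv). Qed.

Lemma dblk_inv_ball : invmx (dblk t T) \in mball (1 + m) (1 + m) (- a%:Z).
Proof.
have -> : invmx (dblk t T) = dblk t^-1 (invmx T).
  by rewrite -[LHS]mulmx1 -dblk_inv mulmxA mulVmx ?dblk_unit // mul1mx.
rewrite /dblk mball_block mball_scalar1 !rpred0 /= in_pball wV // andbC /=.
apply/andP; split; last by apply/orP; right; lia.
by apply: mball_mono (diag_inv_ball d_neq0 d_le); lia.
Qed.

(* The terms outside the image of R -> pi R pi cancel, see [hsum_vanish]. *)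
Lemma bsum_dilate E (X : C) : (a + 4 <= E)%N ->
  (q ^ 2)%:R ^+ (1 + m) * bsum E X (dblk t T) =
  hsum E (fun R => X ^+ ord (dil D m *m R *m dil D m) * phase (dblk (pi ^ 2 * t) T) R).
Proof.
move=> aE; set P := dil D m.
(* The image of the ball of exponent -E under R -> pi R pi in the first coordinate; [B2] below is
   the preimage of the integral matrices. *)
pose B1 := @hbox m (2 - E%:Z) (1 - E%:Z) (- E%:Z).
have hT := dblk_hball t_fix t_int.
have subB : {subset B1 <= hball (1 + m) (- E%:Z)}.
  by move=> R hR; rewrite -hbox_hball; apply: hbox_mono hR; lia.
have sub0 : {subset hball (1 + m) 0 <= B1}.
  by move=> R; rewrite -hbox_hball; apply: hbox_mono; lia.
have finB : fin_index (hball (1 + m) (- E%:Z) : {pred 'M[K]_(1 + m)}) (hball (1 + m) 0) by exact: fin_hball.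
pose F (R : 'M[K]_(1 + m)) : C := if R \in B1 then 0 else X ^+ ord R.
have v : hsum E (fun R => F R * phase (dblk t T) R) = 0.
  (* F vanishes on pi^(2-E), which is contained in [B1]; hence E0 = E - 2, and a + 2 <= E - 2 is the
     hypothesis on E. *)
  apply: (@hsum_vanish _ _ _ a (E - 2)) => //.
  - exact: dblk_unit.
  - exact: dblk_inv_ball.
  - move=> R S sR hS; rewrite /F (ord_addint _ (hball_mball hS)).
    by rewrite (@rpredDr _ B1) //; exact: sub0.
  - move=> h R hh h1 hR; rewrite /F ord_gl ?gl_adj //.
    have -> // : (h *m R *m adjmx h \in B1) = (R \in B1).
    (* This is why [hsum_vanish] asks for invariance only under h congruent to 1 modulo pi^2: such
       an h moves R by an element of pi^(2-E), inside [B1]. *)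
    have hd : h *m R *m adjmx h - R \in B1.
      apply: (@hbox_mono _ (2 - E%:Z) (2 - E%:Z) (2 - E%:Z)); [lia|lia|lia|].
      rewrite hbox_hball in_hball adjmxB !adjmxM adjmxK (hball_adj hR) mulmxA eqxx /=.
      have -> : h *m R *m adjmx h - R = (h - 1%:M) *m R *m adjmx h + R *m adjmx (h - 1%:M).
        rewrite adjmxB adjmx1 mulmxBl mul1mx mulmxBl mulmxBr mulmx1 addrA subrK //.
      rewrite (@rpredD _ (mball (1 + m) (1 + m) (2 - E%:Z))) //.
        apply: mballM0; last by rewrite mball_adj; exact: gl_ball.
        by apply: mballM => //; exact: hball_mball.
      by rewrite [2 - _]addrC; apply: mballM; [exact: hball_mball | rewrite mball_adj].
    by rewrite -[X in (X \in _) = _](subrK R) (@rpredDl _ B1).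
  - move=> R hR hR2; rewrite /F ifT //.
    have [r [y [S e]]] := blk_ex (hball_adj hR).
    move: hR hR2; rewrite e hball_blk hbox_blk /blk mball_block mball_scalar1 => /and3P[h1 h2 h3] /and4P[g1 g2 _ _].
    rewrite h3 andbT in_fball (fball_fix h1) eqxx /=; apply/andP; split.
      by apply: pball_mono g1; lia.
    by apply: mball_mono g2; lia.
  - lia.
have e1 : bsum E X (dblk t T) = qsum B1 (hball (1 + m) 0) (fun R => X ^+ ord R * phase (dblk t T) R).
  rewrite -(@qsum_cond _ _ (hball (1 + m) (- E%:Z)) B1) //.
  rewrite -[RHS]addr0 -[X in _ = _ + X]v /hsum -qsumD; apply: eq_qsumr => R.
  by rewrite /F; case: ifP; rewrite ?mul0r ?addr0 ?add0r.
have aP : adjmx P = P by exact: adj_dil.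
have phP R : phase (dblk t T) (P *m R *m P) = phase (dblk (pi ^ 2 * t) T) R.
  by rewrite -{2}aP phase_congr aP /P dil_dblk.
have gp R S : R \in B1 -> S \in hball (1 + m) 0 ->
    X ^+ ord (R + S) * phase (dblk t T) (R + S) = X ^+ ord R * phase (dblk t T) R.
  move=> hR hS; rewrite (ord_addint _ (hball_mball hS)) phase_addint //.
  exact: hbox_adj hR.
have sP (R : 'M[K]_(1 + m)) : adjmx R = R -> adjmx (P *m R *m P) = P *m R *m P.
  by move=> sR; rewrite !adjmxM aP sR mulmxA.
pose B2 := @hbox m (-2) (-1) 0.
have PB R : adjmx R = R -> (P *m R *m P \in hball (1 + m) 0) = (R \in B2).
  by move=> sR; rewrite -hbox_hball -(dil_hbox (-2) (-1) 0 sR).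
have PB1 R : adjmx R = R -> (P *m R *m P \in B1) = (R \in hball (1 + m) (- E%:Z)).
  by move=> sR; rewrite -hbox_hball -(dil_hbox _ _ _ sR).
have subB2 : {subset B2 <= hball (1 + m) (- E%:Z)}.
  by move=> R hR; rewrite -hbox_hball; apply: hbox_mono hR; lia.
have sub02 : {subset hball (1 + m) 0 <= B2}.
  by move=> R; rewrite -hbox_hball; apply: hbox_mono; lia.
have finB2 : fin_index (hball (1 + m) (- E%:Z) : {pred 'M[K]_(1 + m)}) B2.
  by apply: fin_index_sub finB => // R _; exact: sub02.
rewrite e1 (@qsum_reindex _ _ _ (hball (1 + m) (- E%:Z)) B2 _ _ (fun R => P *m R *m P)) //; first last.
- move=> R hR; have [r [y [S e]]] := blk_ex (hbox_adj hR).
  move: hR; rewrite e hbox_blk => /and3P[h1 h2 h3].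
  exists (blk (pi ^ (-2) * r) (pi^-1 *: y) S); last first.
    rewrite dil_blk scalerA mulfV ?hs_pi_neq0 // scale1r mulrA -expfzDr ?hs_pi_neq0 //.
    by rewrite addrN expr0z mul1r subrr rpred0.
  rewrite hball_blk h3 andbT fball_piX -[pi^-1]/(pi ^ (-1)) mball_piX.
  by rewrite !opprK ![- _ + _]addrC h1.
- move=> x y hx hy; rewrite -mulmxBl -mulmxBr PB // adjmxB (hball_adj hx) (hball_adj hy) //.
- by move=> R hR; rewrite PB1 // (hball_adj hR).
(* The dilated summand is invariant under [B2], which contains the integral matrices with index
   (q^2)^(1+m); this is the factor on the left. *)
rewrite /hsum [RHS](@qsum_tower _ _ _ B2) //; first last.
- move=> R S hR hS; rewrite mulmxDr mulmxDl -!phP mulmxDr mulmxDl gp //.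
    by rewrite PB1 // (hball_adj hR).
  by rewrite PB ?(hball_adj hS) //; exact: sub02.
- apply: fin_index_sub finB => //.
rewrite -qsum_mulr; apply: eq_qsum => // R hR.
rewrite phP -count_hbox -qsum_mull; apply: eq_qsum => //.
  by apply: fin_index_sub finB.
move=> S hS; rewrite mul1r mulmxDr mulmxDl -!phP mulmxDr mulmxDl gp //.
  by rewrite PB1 // (hball_adj hR).
by rewrite PB // (hbox_adj hS).
Qed.

Local Notation tau := (pi ^ 2 * t).

Lemma tau_fix : star tau = tau.
Proof. by rewrite rmorphM /= star_piX t_fix. Qed.

Lemma tau_int : tau \in pball 0.
Proof. by rewrite pball_piX; apply: pball_mono t_int. Qed.

Lemma w_tau : w tau = a%:Z + 2.
Proof. by rewrite hs_wM ?piX_neq0 // w_piX; lia. Qed.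

(** Substituting pi^-2 r in the second part gives q^2 times the series of t truncated at E - 2. By
    [boneE] both parts are geometric sums, and after cancellation the first two terms remain. *)
Lemma bone_dilate E (X : C) : (a + 4 <= E)%N ->
  qsum (fball (- E%:Z)) (fball 0)
    (fun r => (X ^+ vden r - X ^+ (2 + vden (pi ^ 2 * r))) * Psi (tau * r)) =
  (1 - X) * (1 + q%:R * X).
Proof.
move=> aE.
have tau0 : tau != 0 by rewrite mulf_neq0 ?piX_neq0.
have wt : 0 <= w t by exact: le_trans t_ge.
have fs M N : M <= N -> {subset (fball N : {pred K}) <= fball M} by exact: fball_mono.
pose f r := X ^+ vden (pi ^ 2 * r) * Psi (tau * r).
have fp r s : r \in fball (- E%:Z) -> s \in fball (-2) -> f (r + s) = f r.
  move=> hr hs; rewrite /f mulrDr (@vden_eq _ _ (pi ^ 2 * r)); last first.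
    by rewrite addrC addKr pball_piX; exact: fball_pball.
  rewrite mulrDr Psi_addint //; first by rewrite rmorphM /= tau_fix (fball_fix hr).
  rewrite in_fball rmorphM /= tau_fix (fball_fix hs) eqxx /= [pi ^ 2 * t]mulrC -mulrA.
  apply: pball0M; first exact: t_int.
  by rewrite pball_piX; exact: fball_pball.
have e2 : qsum (fball (- E%:Z)) (fball 0) f = q%:R ^+ 2 * bone t X (E - 2).
  rewrite (@qsum_tower _ _ _ (fball (-2))); first last.
  - move=> r s hr hs; apply: fp => //; exact: fs hs.
  - exact: fin_fball.
  - exact: fin_fball.
  - by apply: fs; lia.
  - exact: fs.
  have h := count_fball D (-2) 2; rewrite addNr in h.
  transitivity (qsum (fball (- E%:Z)) (fball (-2)) (fun r => q%:R ^+ 2 * f r)).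
    apply: eq_qsum; [exact: fin_fball | by apply: fs; lia |] => r hr.
    rewrite -h -qsum_mull; apply: eq_qsum; [exact: fin_fball | exact: fs |] => s hs.
    by rewrite mul1r fp.
  rewrite qsum_mulr; congr (_ * _).
  have hz : (- (E - 2)%N%:Z = - E%:Z + 2) by lia.
  rewrite /bone hz -{1}(addNr 2) qsum_fball_shift //; last 3 first.
  - by lia.
  - exact: fin_fball.
  - move=> r s hr; rewrite addNr => hs; rewrite mulrDr Psi_addint; first last.
    + by rewrite in_fball rmorphM /= t_fix (fball_fix hs) eqxx /= pball0M ?t_int ?(fball_pball hs).
    + by rewrite rmorphM /= t_fix (fball_fix hr).
    by rewrite (@vden_eq _ _ r) // addrC addKr; exact: fball_pball hs.
  by apply: eq_qsumr => r; rewrite /f mulrA [t * _]mulrC.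
transitivity (bone tau X E - X ^+ 2 * (q%:R ^+ 2 * bone t X (E - 2))).
  rewrite -e2 -qsum_mulr -qsumB; apply: eq_qsumr => r.
  by rewrite /f mulrBl exprD !mulrA.
rewrite !boneE ?tau_fix ?w_tau //; try lia.
rewrite (_ : absz (a%:Z + 2) = a.+2); last by lia.
rewrite big_ord_recl [in X in X - _]big_ord_recl /= expr0.
have -> : \sum_(i < a.+1) (q%:R * X) ^+ bump 0 (bump 0 i) =
    (q%:R * X) ^+ 2 * \sum_(i < a.+1) (q%:R * X) ^+ i.
  by rewrite mulr_sumr; apply: eq_bigr => i _; rewrite -exprD.
by rewrite /bump /= expr1; ring.
Qed.

Definition span_row (S : 'M[K]_m) : {pred 'rV[K]_m} := [pred y : 'rV[K]_m | adjmx y \in span_col S].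

Fact span_row_zmod_closed S : zmod_closed (span_row S).
Proof.
split=> [|x y]; rewrite ![_ \in span_row S]/(adjmx _ \in _).
  by apply/span_colP; exists 0; rewrite ?adjmx0 ?mulmx0 ?subr0 rpred0.
move=> /span_colP[b hb hxb] /span_colP[c hc hyc]; apply/span_colP; exists (b - c).
  exact: (@rpredB _ (mball m 1 0)).
have -> : adjmx (x - y) - S *m (b - c) = (adjmx x - S *m b) - (adjmx y - S *m c).
  by rewrite adjmxB mulmxBr !opprB addrACA [in RHS]addrACA; congr (_ + _); exact: addrC.
exact: (@rpredB _ (mball m 1 0)).
Qed.

HB.instance Definition _ S :=
  GRing.isZmodClosed.Build 'rV[K]_m (span_row S) (span_row_zmod_closed S).

(** S b is integral, so the cross term and the value at b are integral, as is tau. *)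
Lemma form_phase_stab E S c b : S \in hball m (- E%:Z) -> c \in mball m 1 0 -> b \in stab S ->
  Psi (tau * form S (c + b)) = Psi (tau * form S c).
Proof.
move=> hS hc /andP[hb hSb]; have sS := hball_adj hS.
have tf u : star u = u -> star (tau * u) = tau * u by move=> su; rewrite rmorphM /= tau_fix su.
have e : form S (c + b) = form S c + (Tr ((adjmx c *m (S *m b)) 0 0) + form S b).
  have eM : adjmx (c + b) *m S *m (c + b) = adjmx c *m S *m c +
     (adjmx c *m (S *m b) + adjmx (adjmx c *m (S *m b)) + adjmx b *m S *m b).
    by rewrite adjmxD !adjmxM sS adjmxK !mulmxDl !mulmxDr !mulmxA !addrA.
  rewrite /form eM /Tr -adjmxE [LHS]mxE; congr (_ + _).
  by rewrite [LHS]mxE; congr (_ + _); rewrite [LHS]mxE.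
rewrite e mulrDr Psi_addint ?tf ?star_form //.
rewrite in_fball tf; last by rewrite rmorphD /= star_Tr star_form.
rewrite eqxx /=; apply: pball0M; first exact: tau_int.
have h (x : 'cV[K]_m) : x \in mball m 1 0 -> (adjmx x *m (S *m b)) 0 0 \in pball 0.
  move=> hx; suff /mballP : adjmx x *m (S *m b) \in mball 1 1 0 by apply.
  by apply: mball0M => //; rewrite mball_adj.
rewrite (@rpredD _ (pball 0)) //; first by apply: fball_pball; apply: Tr_fball; exact: h.
by rewrite /form -mulmxA; exact: h.
Qed.

(** The mean of the phase of the form S over integral columns. It is taken modulo pi^E instead of
    [stab S], so that the quotient does not depend on S. *)
Definition avg_form E (S : 'M[K]_m) : C :=
  (qsum (mball m 1 0 : {pred 'cV[K]_m}) (mball m 1 E) (fun=> 1))^-1 *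
  qsum (mball m 1 0) (mball m 1 E) (fun c => Psi (tau * form S c)).

Lemma stab_avg E S : S \in hball m (- E%:Z) ->
  qsum (mball m 1 0) (stab S) (fun c => Psi (tau * form S c)) =
  (q ^ 2)%:R ^+ ord S * avg_form E S.
Proof.
move=> hS; have sE := mball_stab (hball_mball hS).
have fin1 : fin_index (stab S) (mball m 1 E).
  by apply: (@fin_mx _ _ _ 0 E) => //; exact: stab_sub.
have tow (f : 'cV[K]_m -> C) : (forall c b, c \in mball m 1 0 -> b \in stab S -> f (c + b) = f c) ->
   qsum (mball m 1 0) (mball m 1 E) f =
   qsum (stab S) (mball m 1 E) (fun=> 1) * qsum (mball m 1 0) (stab S) f.
  move=> fp; rewrite (@qsum_tower _ _ _ (stab S)) //; first last.
  - by move=> c b hc hb; apply: fp => //; exact: sE.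
  - exact: fin_stab.
  - exact: stab_sub.
  rewrite -qsum_mulr; apply: eq_qsum; [exact: fin_stab | exact: stab_sub |] => c hc.
  rewrite -qsum_mull; apply: eq_qsum => // b hb; rewrite mul1r fp //.
rewrite /avg_form (tow (fun=> 1)) // -/(idx S) idx_ord ?(hball_adj hS) //.
rewrite (tow (fun c => Psi (tau * form S c))); last by move=> c b; exact: form_phase_stab hS.
have n1 := qsum1_neq0 C fin1.
have n2 : (q ^ 2)%:R ^+ ord S != 0 :> C.
  by rewrite expf_neq0 // pnatr_eq0 -lt0n (ltn_trans _ (q2_gt1 D)).
by move: (qsum (stab S) _ _) n1 ((q ^ 2)%:R ^+ _) n2 => A nA B nB; rewrite mulrA; field; rewrite nA nB.
Qed.

(** By [ord_dil], rows outside [span_row S] contribute 0. The others are the adjoint of c times S up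
    to integral rows, with c modulo [stab S]; completing the square leaves a sum over the corner,
    given by [bone_dilate], times the phase of S[c]. *)
Lemma row_sum E (X : C) S : (a + 4 <= E)%N -> S \in hball m (- E%:Z) ->
  qsum (mball 1 m (- E%:Z)) (mball 1 m 0) (fun y => qsum (fball (- E%:Z)) (fball 0) (fun r =>
    (X ^+ ord (blk r y S) - X ^+ (2 + ord (dil D m *m blk r y S *m dil D m))) * Psi (tau * r))) =
  (1 - X) * (1 + q%:R * X) * (((q ^ 2)%:R * X) ^+ ord S * avg_form E S).
Proof.
move=> aE hS; have sS := hball_adj hS.
have sm : {subset (mball 1 m 0 : {pred 'rV[K]_m}) <= mball 1 m (- E%:Z)}.
  by apply: mball_mono; rewrite oppr_le0.
have sf : {subset (fball 0 : {pred K}) <= fball (- E%:Z)} by apply: fball_mono; rewrite oppr_le0.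
have ff := fin_fball D (- E%:Z) 0.
set G := fun y => _.
have Gval c l : c \in mball m 1 0 -> l \in mball 1 m 0 -> G (adjmx c *m S + l) =
   (1 - X) * (1 + q%:R * X) * (X ^+ ord S * Psi (tau * form S c)).
  move=> hc hl; have hf : form S c \in fball (- E%:Z).
    rewrite in_fball star_form // eqxx /= form_pball //; exact: hball_mball.
  have sfm := star_form c sS.
  rewrite -(bone_dilate X aE) -qsum_mull.
  rewrite [RHS](_ : _ = qsum (fball (- E%:Z)) (fball 0) (fun r =>
    (X ^+ (vden (r - form S c) + ord S) - X ^+ (2 + (vden (pi ^ 2 * (r - form S c)) + ord S))) * Psi (tau * r))).
    apply: eq_qsum => // r hr; have sr := fball_fix hr.
    rewrite ord_clear // dil_blk scalerDr scalemxAl -[pi]hs_star_pi -adjmxZ hs_star_pi.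
    rewrite ord_clear //.
    - congr ((_ - _ ^+ (2 + (vden _ + _))) * _); rewrite mulrBr; congr (_ - _).
      rewrite /form adjmxZ hs_star_pi -!scalemxAl -scalemxAr scalerA mxE.
      by rewrite -[pi ^ 2]/(pi ^+ 2) expr2.
    - by rewrite rmorphM /= star_piX sr.
    - exact: mball_pi.
    - exact: mball_pi.
  (* Translating the corner by S[c] removes it from both denominators and releases the factor
     Psi(tau S[c]). *)
  rewrite [RHS](@qsum_translate _ _ _ _ (form S c)) //.
    apply: eq_qsum => // r hr; have sr := fball_fix hr.
    have h1 : star (tau * r) = tau * r by rewrite rmorphM /= tau_fix sr.
    have h2 : star (tau * form S c) = tau * form S c by rewrite rmorphM /= tau_fix sfm.
    rewrite addrK mulrDr (hs_psiD h1 h2) addnA !exprD.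
    move: (X ^+ vden r) (X ^+ vden (pi ^ 2 * r)) (X ^+ ord S) (X ^+ 2) => x1 x2 x3 x4.
    by move: (Psi (tau * r)) (Psi (tau * form S c)) => p1 p2; ring.
  move=> x y hx hy; have hy0 := fball_pball hy.
  rewrite [tau * (x + y)]mulrDr Psi_addint; first last.
  - by rewrite in_fball rmorphM /= tau_fix (fball_fix hy) eqxx /= pball0M ?tau_int.
  - by rewrite rmorphM /= tau_fix (fball_fix hx).
  have v1 : vden (x + y - form S c) = vden (x - form S c).
    by apply: vden_eq; rewrite opprB addrA subrK addrC addKr.
  have v2 : vden (pi ^ 2 * (x + y - form S c)) = vden (pi ^ 2 * (x - form S c)).
    apply: vden_eq; rewrite -mulrBr opprB addrA subrK [x + y]addrC addrK.
    by apply: pball0M => //; apply: pball_mono (piX_ball D 2).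
  by rewrite v1 v2.
have rspan (y : 'rV[K]_m) : y \in span_row S -> exists2 c, c \in mball m 1 0 & y - adjmx c *m S \in mball 1 m 0.
  move/span_colP=> [c hc h]; exists c => //.
  by rewrite -mball_adj adjmxB adjmxM adjmxK sS.
have sub1 : {subset mball 1 m 0 <= span_row S}.
  by move=> y hy; apply/span_colP; exists 0; rewrite ?rpred0 // mulmx0 subr0 mball_adj.
have subcS c : c \in mball m 1 0 -> adjmx c *m S \in mball 1 m (- E%:Z).
  move=> hc; apply: mball0M; [by rewrite mball_adj | exact: hball_mball].
have sub2 : {subset span_row S <= mball 1 m (- E%:Z)}.
  move=> y /rspan[c hc h]; rewrite -[y](subrK (adjmx c *m S)).
  by rewrite (@rpredD _ (mball 1 m (- E%:Z))) ?subcS ?sm.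
(* Outside the span, dilation lowers [ord] by exactly 2 and the two powers of X cancel. *)
rewrite (qsum_restrict sub1 sub2); first last.
- move=> y hy ny; rewrite /G -[RHS](qsum0 C (fball (- E%:Z) : {pred K}) (fball 0)).
  apply: eq_qsum => // r hr; rewrite ord_dil ?(fball_fix hr) // subrr mul0r //.
- exact: fin_mball.
rewrite (@qsum_reindex _ _ _ (mball m 1 0) (stab S) _ _ (fun c => adjmx c *m S)); first last.
- move=> y l /rspan[c hc hl] hl'.
  rewrite -[y](subrK (adjmx c *m S)) [_ + adjmx c *m S]addrC -addrA !Gval //.
  exact: (@rpredD _ (mball 1 m 0)).
- by move=> y /rspan[c hc h]; exists c.
- move=> c b hc hb; rewrite -mulmxBl -adjmxB -mball_adj adjmxM adjmxK sS in_stab.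
  by rewrite (@rpredB _ (mball m 1 0)).
- by move=> c hc; apply/span_colP; exists c; rewrite // adjmxM adjmxK sS subrr rpred0.
- exact: fin_stab.
- exact: stab_sub.
transitivity (qsum (mball m 1 0) (stab S) (fun c => (1 - X) * (1 + q%:R * X) * X ^+ ord S * Psi (tau * form S c))).
  apply: eq_qsum; [exact: fin_stab | exact: stab_sub |] => c hc.
  by have := Gval c 0 hc (rpred0 _); rewrite addr0 mulrA.
rewrite qsum_mulr (stab_avg hS) exprMn.
by move: (X ^+ ord S) (avg_form E S) ((q ^ 2)%:R ^+ ord S) => x1 x2 x3; ring.
Qed.

(** [bsum_dilate] puts both series on the same phase, and [row_sum] evaluates the difference up to
    the weight [avg_form]. The factor q^2 in the new variable is the index of [stab S], that is the
    number of rows in the span. *)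
Lemma bsum_corner_quot E (X : C) : (a + 4 <= E)%N ->
  bsum E X (dblk tau T) - (q ^ 2)%:R ^+ (1 + m) * X ^+ 2 * bsum E X (dblk t T) =
  (1 - X) * (1 + q%:R * X) * bsum E ((q ^ 2)%:R * X) T.
Proof.
move=> aE; rewrite [Z in _ - Z]mulrAC bsum_dilate // [Z in _ - Z]mulrC /bsum.
set Y := (q ^ 2)%:R * X; set kap := (1 - X) * _.
transitivity (hsum E (fun R => (X ^+ ord R - X ^+ (2 + ord (dil D m *m R *m dil D m))) * phase (dblk tau T) R)).
  rewrite /hsum -qsum_mulr -qsumB; apply: eq_qsumr => R.
  by rewrite exprD mulrBl !mulrA.
have hTt := dblk_hball tau_fix tau_int.
have adil (R : 'M[K]_(1 + m)) : R \in hball (1 + m) 0 -> dil D m *m R *m dil D m \in mball (1 + m) (1 + m) 0.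
  move=> hR; have hd : dil D m \in mball (1 + m) (1 + m) 0.
    rewrite /dil mball_block mball_scalar1 mball1 !rpred0 andbT /=.
    by rewrite in_pball hs_w_pi orbT.
  by apply: mballM0 => //; apply: mball0M => //; exact: hball_mball.
rewrite hsum_blk; last first.
  move=> R S hR hS; rewrite mulmxDr mulmxDl (ord_addint _ (hball_mball hS)) (ord_addint _ (adil _ hS)).
  by rewrite phase_addint // (hball_adj hR).
transitivity (hsum E (fun S => kap * (Y ^+ ord S * avg_form E S) * phase T S)).
  under eq_qsumr do rewrite /hsum qsum_exchange.
  rewrite qsum_exchange; apply: eq_hsum => S hS.
  rewrite -(row_sum X aE hS) -qsum_mull [LHS]qsum_exchange.
  apply: eq_qsumr => y; rewrite -qsum_mull.
  apply: eq_qsum; [exact: fin_fball | by apply: fball_mono; rewrite oppr_le0 |] => r hr.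
  by rewrite phase_dblk ?tau_fix ?(fball_fix hr) ?(hball_adj hS) ?mulrA.
pose F (S : 'M[K]_m) := Y ^+ ord S * (avg_form E S - 1).
have fin0 := fin_mball D m 1 0 E.
have subE : {subset (mball m 1 E : {pred 'cV[K]_m}) <= mball m 1 0} by exact: mball_mono.
have tf u : star u = u -> star (tau * u) = tau * u by move=> su; rewrite rmorphM /= tau_fix su.
(* The weight may be replaced by 1: for S of denominator at most pi^(a+2), tau S[c] is integral and
   the mean is 1. As lam <= a, [hsum_vanish] with E0 = a + 2 removes the rest. *)
have v : hsum E (fun S => F S * phase T S) = 0.
  apply: (@hsum_vanish _ _ _ lam (a + 2)) => //.
  - exact: diag_hball.
  - exact: diag_unit.
  - exact: diag_inv_ball.
  - move=> S S' sS hS'; rewrite /F (ord_addint _ (hball_mball hS')).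
    have -> // : avg_form E (S + S') = avg_form E S.
    rewrite /avg_form; congr (_ * _); apply: eq_qsum => // c hc.
    rewrite /form mulmxDr mulmxDl mxE mulrDr Psi_addint ?tf ?(star_form _ sS) //.
    rewrite in_fball tf ?(star_form _ (hball_adj hS')) // eqxx /=.
    by apply: pball0M; [exact: tau_int | apply: form_pball hc; exact: hball_mball].
  - move=> h S hh _ hS; rewrite /F ord_gl ?gl_adj //.
    have -> // : avg_form E (h *m S *m adjmx h) = avg_form E S.
    rewrite /avg_form; congr (_ * _).
    have ga := gl_adj hh; have ua := gl_unit ga.
    have hbE N : {subset (mball m 1 N : {pred 'cV[K]_m}) <= [pred c | invmx (adjmx h) *m c \in mball m 1 N]}.
      by move=> c hc; apply: mball0M => //; exact/gl_ball/glV.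
    rewrite [RHS](@qsum_reindex _ _ _ (mball m 1 0) (mball m 1 E) _ _ (fun c => adjmx h *m c)) //; first last.
    + move=> c b hc hb; apply: (form_phase_stab hS hc).
      exact: (mball_stab (hball_mball hS)).
    + move=> c hc; exists (invmx (adjmx h) *m c); first exact: hbE.
      by rewrite mulKVmx // subrr rpred0.
    + move=> c b _ _; rewrite -mulmxBr; apply/idP/idP => H.
        by rewrite -[c - b](mulKmx ua); exact: hbE.
      by apply: mball0M => //; exact: gl_ball.
    + by move=> c hc; apply: mball0M => //; exact: gl_ball.
    by apply: eq_qsumr => c; rewrite /form adjmxM adjmxK !mulmxA.
  - move=> S hS hS2; rewrite /F /avg_form.
    have -> : qsum (mball m 1 0) (mball m 1 E) (fun c => Psi (tau * form S c)) =
        qsum (mball m 1 0 : {pred 'cV[K]_m}) (mball m 1 E) (fun=> 1).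
      apply: eq_qsum => // c hc; apply: Psi_fball; rewrite in_fball tf ?star_form ?(hball_adj hS) // eqxx /=.
      rewrite -(addrN (a%:Z + 2)) -w_tau; apply: pballM; first exact: pball_w.
      by apply: form_pball hc; rewrite w_tau -PoszD.
    by rewrite mulVf ?subrr ?mulr0 // qsum1_neq0.
  - by move: t_ge; lia.
rewrite /hsum -qsum_mulr -[RHS]addr0 -(mulr0 kap) -[X in _ = _ + _ * X]v /hsum -qsum_mulr -qsumD.
apply: eq_qsumr => S; rewrite /F.
by move: (Y ^+ ord S) (avg_form E S) (phase T S) => x1 x2 x3; move: (kap) => x4; ring.
Qed.

End Quotient.

End DilationRelation.

(** * The functional equation for diagonal matrices *)

Section ReciprocalDensity.
Variable F : numFieldType.

Lemma poly_eq0_pointwise (p : {poly F}) : (forall x, p.[x] = 0) -> p = 0.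
Proof.
move=> h; apply/eqP/negPn/negP => p0.
have := @max_poly_roots _ p [seq i%:R | i <- iota 0 (size p)] p0.
rewrite size_map size_iota ltnn => h2; have : false; last by [].
apply: h2; first by apply/allP=> x _; apply/eqP.
by rewrite map_inj_uniq ?iota_uniq // => i j /eqP; rewrite eqr_nat => /eqP.
Qed.

Lemma poly_reciprocal (p : {poly F}) (k : F) :
  exists r : {poly F}, forall x, x != 0 -> x ^+ size p * p.[k / x] = r.[x].
Proof.
exists (\sum_(i < size p) (p`_i * k ^+ i) *: 'X^(size p - i)) => x x0.
rewrite horner_coef mulr_sumr horner_sum; apply: eq_bigr => i _.
rewrite hornerZ hornerXn expr_div_n -{1}(subnK (ltnW (ltn_ord i))) exprD.
by field; rewrite expf_neq0.
Qed.

(** Multiplication by powers of x turns both sides into polynomials. Their difference times h and x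
    vanishes at every point, hence identically, and h is nonzero. *)
Lemma reciprocal_density (p1 p2 r1 r2 h : {poly F}) (k c : F) (l : nat) : h != 0 ->
  (forall x, x != 0 -> h.[x] != 0 ->
    p1.[x] * p2.[k / x] = (c * x) ^+ l * r1.[x] * r2.[k / x]) ->
  forall x, x != 0 -> p1.[x] * p2.[k / x] = (c * x) ^+ l * r1.[x] * r2.[k / x].
Proof.
move=> h0 hx; have [s2 e2] := poly_reciprocal p2 k; have [t2 f2] := poly_reciprocal r2 k.
pose H := 'X^(size r2) * p1 * s2 - (c *: 'X) ^+ l * r1 * t2 * 'X^(size p2).
have HE x : x != 0 -> H.[x] = x ^+ (size p2 + size r2) *
    (p1.[x] * p2.[k / x] - (c * x) ^+ l * r1.[x] * r2.[k / x]).
  move=> x0; rewrite /H hornerD hornerN !hornerM !horner_exp hornerZ !hornerX.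
  rewrite -e2 // -f2 // exprD.
  by move: (x ^+ size p2) (x ^+ size r2) ((c * x) ^+ l) => a b d; ring.
have : h * 'X * H = 0.
  apply: poly_eq0_pointwise => x; rewrite !hornerM hornerX.
  have [->|x0] := eqVneq x 0; first by rewrite mulr0 mul0r.
  have [->|nx] := eqVneq h.[x] 0; first by rewrite !mul0r.
  by rewrite HE // hx // subrr !mulr0.
move/eqP; rewrite !mulf_eq0 (negPf h0) polyX_eq0 /= => /eqP H0 x x0.
move: (HE x x0); rewrite H0 horner0 => /esym/eqP.
by rewrite mulf_eq0 expf_eq0 (negPf x0) andbF /= subr_eq0 => /eqP.
Qed.

End ReciprocalDensity.

(* One induction step: B, B' are the series of sizes n+1 and n; the subscripts
   stand for evaluation at X, q^2 X and their duals. *)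
Lemma fe_step_algebra (F : fieldType) (p x xt X Xt u ut BX BXt B'X B'Xt B'q B'qt
   CX CXt C'X C'Xt C'q C'qt y yp ya : F) :
  x * xt = 1 -> p != 0 -> yp != 0 -> ya != 0 -> y != 0 ->
  (1 - x ^+ 2) * BX = (1 - X) * (1 - p * X) * B'q - yp * B'X * ((1 - u) * (ya * x) * (1 + x)) ->
  (1 - xt ^+ 2) * BXt = (1 - Xt) * (1 - p * Xt) * B'qt - yp * B'Xt * ((1 - ut) * (ya^-1 * xt) * (1 + xt)) ->
  B'q * C'Xt = yp * y * B'Xt * C'q ->
  B'X * C'qt = y / yp * B'qt * C'X ->
  CX = C'X * (1 - u) -> CXt = C'Xt * (1 - ut) ->
  CX * (1 + x) = (1 - X) * (1 - p * X) * C'q ->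
  CXt * (1 + xt) = (1 - Xt) * (1 - p * Xt) * C'qt ->
  (1 - x ^+ 2) * (1 + xt) * (BX * CXt) = (1 - x ^+ 2) * (1 + xt) * (ya * y * BXt * CX).
Proof.
move=> xxt p0 yp0 ya0 y0 hB hBt i1 i2 c1 c2 c3 c4.
have x0 : x != 0 by apply: contra_eq_neq xxt => ->; rewrite mul0r eq_sym oner_neq0.
have ext : xt = x^-1 by apply: (mulfI x0); rewrite xxt mulfV.
transitivity ((1 + xt) * CXt * ((1 - x ^+ 2) * BX)); first by ring.
transitivity (- x ^+ 2 * (ya * y) * (1 + xt) * CX * ((1 - xt ^+ 2) * BXt)); last first.
  by rewrite ext; field.
rewrite hB hBt.
(* The terms match crosswise: each of the two terms of the relation at X is carried to the other
   term of the relation at the dual point. *)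
have t1 : (1 + xt) * CXt * ((1 - X) * (1 - p * X) * B'q) =
   x ^+ 2 * (ya * y) * (1 + xt) * CX * (yp * B'Xt * ((1 - ut) * (ya^-1 * xt) * (1 + xt))).
  transitivity ((1 + xt) * (1 - ut) * (1 - X) * (1 - p * X) * (B'q * C'Xt)); first by rewrite c2; ring.
  rewrite i1; transitivity ((1 + xt) * (1 - ut) * yp * y * B'Xt * ((1 - X) * (1 - p * X) * C'q)); first by ring.
  by rewrite -c3 ext; field; rewrite x0 ya0.
have t2 : (1 + xt) * CXt * (yp * B'X * ((1 - u) * (ya * x) * (1 + x))) =
   x ^+ 2 * (ya * y) * (1 + xt) * CX * ((1 - Xt) * (1 - p * Xt) * B'qt).
  transitivity (CXt * (1 + xt) * (yp * B'X * ((1 - u) * (ya * x) * (1 + x)))); first by ring.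
  rewrite c4.
  transitivity ((1 - Xt) * (1 - p * Xt) * yp * (B'X * C'qt) * ((1 - u) * (ya * x) * (1 + x))); first by ring.
  by rewrite i2 c1 ext; field; rewrite x0 yp0.
by rewrite mulrBr t1 t2; ring.
Qed.

Section FunctionalEquation.
Variable D : herm_setting.
Local Notation K := (hs_K D).
Local Notation C := (hs_C D).
Local Notation w := (@hs_w D).
Local Notation star := (@hs_star D).
Local Notation pi := (hs_pi D).
Local Notation q := (hs_q D).
Local Notation Psi := (@hs_psi D).
Local Notation p := (- (q%:R) : C).

Definition bpoly n E (T : 'M[K]_n) : {poly C} :=
  qsum (hball n (- E%:Z)) (hball n 0) (fun R => phase T R *: 'X^(ord R)).

Lemma bpolyE n E (T : 'M[K]_n) X : (bpoly E T).[X] = bsum E X T.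
Proof.
rewrite /bpoly /bsum /hsum /qsum horner_sum; apply: eq_bigr => R _.
by rewrite hornerZ hornerXn mulrC.
Qed.

Definition norm_factor n (X : C) : C := \prod_(i < n) (1 - p ^+ i * X).

Definition norm_poly n : {poly C} := \prod_(i < n) (1 - p ^+ i *: 'X).

Lemma norm_polyE n X : (norm_poly n).[X] = norm_factor n X.
Proof. by rewrite /norm_poly horner_prod; apply: eq_bigr => i _; rewrite !hornerE. Qed.

Lemma norm_factorS n X : norm_factor n.+1 X = norm_factor n X * (1 - p ^+ n * X).
Proof. by rewrite /norm_factor big_ord_recr. Qed.

(** Both sides are the product of the first n + 2 factors, since p^2 = q^2. *)
Lemma norm_factor_shift n X : norm_factor n.+1 X * (1 - p ^+ n.+1 * X) =
  (1 - X) * (1 - p * X) * norm_factor n ((q ^ 2)%:R * X).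
Proof.
rewrite -norm_factorS /norm_factor 2!big_ord_recl /= expr0 mul1r /bump /= expr1 !mulrA.
congr (_ * _); apply: eq_bigr => i _; rewrite /bump /= !add1n !exprS natrX; ring.
Qed.

Lemma bsum_gl n E X (T U : 'M[K]_n) : T \in hball n 0 -> U \in gl n ->
  bsum E X (adjmx U *m T *m U) = bsum E X T.
Proof.
move=> hT hU; rewrite /bsum [RHS](hsum_congr hU).
  by apply: eq_hsum => R hR; rewrite phase_congr ord_gl // gl_adj.
by move=> R S hR hS; rewrite (ord_addint _ (hball_mball hS)) phase_addint // (hball_adj hR).
Qed.

Lemma bsum_size0 E X (T : 'M[K]_0) : bsum E X T = 1.
Proof.
have h (A : 'M[K]_0) : A = 0 by apply/matrixP=> -[].
rewrite /bsum /hsum qsum_trivial.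
- rewrite (@ordP _ _ _ 0); last first.
    have hc (c : 'cV[K]_0) : c = 0 by apply/matrixP=> -[].
    by rewrite expr0 /idx qsum_trivial // => c _; rewrite (hc c) rpred0.
  by rewrite /phase /mxtrace big_ord0 Psi0 mulr1 expr0.
- by move=> A _; rewrite (h A) rpred0.
- by move=> A _; rewrite (h A) rpred0.
- by move=> A _; rewrite (h A).
Qed.

Lemma tperm_diag n (i j : 'I_n) (d : 'rV[K]_n) :
  adjmx (tperm_mx i j) *m diag_mx d *m tperm_mx i j = diag_mx (\row_k d 0 (tperm i j k)).
Proof.
rewrite /adjmx tr_tperm_mx map_tperm_mx -xrowE -xcolE.
apply/matrixP=> a b; rewrite !mxE (inj_eq perm_inj) //.
Qed.

Local Notation valsum d := (\sum_i `|w (d 0%R i)|)%N.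

(** For X = q^-s the point q^(-2n) / X is q^-(2n-s). The equation is cross-multiplied, so that zeros
    of the normalizing factors need not be excluded. *)
Definition fun_eq n (d : 'rV[K]_n) E : Prop := forall X : C, X != 0 ->
  bsum E X (diag_mx d) * norm_factor n ((q ^ 2)%:R ^- n / X) =
  (- (p ^+ n * X)) ^+ valsum d * bsum E ((q ^ 2)%:R ^- n / X) (diag_mx d) * norm_factor n X.

Lemma fun_eq_step n (t : K) (d : 'rV[K]_n) E :
  star t = t -> t != 0 -> 0 <= w t ->
  (forall i, star (d 0 i) = d 0 i) -> (forall i, d 0 i != 0) ->
  (forall i, 0 <= w (d 0 i)) -> (forall i, w (d 0 i) <= w t) ->
  (`|w t| + 10 <= E)%N -> fun_eq d E ->
  forall X : C, X != 0 ->
  bsum E X (dblk t (diag_mx d)) * norm_factor n.+1 ((q ^ 2)%:R ^- n.+1 / X) =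
  (- (p ^+ n.+1 * X)) ^+ (`|w t| + valsum d) *
     bsum E ((q ^ 2)%:R ^- n.+1 / X) (dblk t (diag_mx d)) * norm_factor n.+1 X.
Proof.
move=> st t0 wt sd d0 wd dle tE IH; set a := `|w t|%N in tE *.
have q0 := q_neq0 D.
have p0 : p != 0 by rewrite oppr_eq0.
have q2E : (q ^ 2)%:R = p ^+ 2 :> C by rewrite natrX sqrrN.
have q20 : (q ^ 2)%:R != 0 :> C by rewrite q2E expf_neq0.
have dle' i : w (d 0 i) <= a by rewrite /a gez0_abs.
have ta : a%:Z <= w t by rewrite /a gez0_abs.
have rel X : (1 - (- (p ^+ n.+1 * X)) ^+ 2) * bsum E X (dblk t (diag_mx d)) =
   (1 - X) * (1 - p * X) * bsum E ((q ^ 2)%:R * X) (diag_mx d) -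
   p ^+ valsum d * bsum E X (diag_mx d) *
     ((1 - p ^+ n * X) * ((- (p ^+ n.+1 * X)) ^+ a * (- (p ^+ n.+1 * X))) * (1 + - (p ^+ n.+1 * X))).
  have r1 := bsum_corner_diff sd d0 wd dle' E X st t0 ta.
  have tE4 : (`|w t| + 4 <= E)%N by lia.
  have r2 := bsum_corner_quot sd d0 wd dle' st t0 ta X tE4.
  have st2 : star (pi ^ 2 * t) = pi ^ 2 * t by rewrite rmorphM /= star_piX st.
  have t20 : pi ^ 2 * t != 0 by rewrite mulf_neq0 ?piX_neq0.
  have wt2 : w (pi ^ 2 * t) = a%:Z + 2 by rewrite hs_wM ?piX_neq0 // w_piX /a; lia.
  move: r1; rewrite !boneE ?wt2 //; try lia.
  rewrite (_ : absz (a%:Z + 2) = a.+2); last by lia.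
  rewrite -/a [\sum_(j < a.+3) _]big_ord_recr [\sum_(j < a.+2) _]big_ord_recr /= => r1.
  have {}r1 : bsum E X (dblk (pi ^ 2 * t) (diag_mx d)) = bsum E X (dblk t (diag_mx d)) +
     p ^+ valsum d * bsum E X (diag_mx d) *
     ((1 - p ^+ n * X) * ((q%:R * (p ^+ n * X)) ^+ a.+1 + (q%:R * (p ^+ n * X)) ^+ a.+2)).
    by rewrite -[LHS](subrK (bsum E X (dblk t (diag_mx d)))) r1; ring.
  move: r2; rewrite r1 => r2.
  have ex : - (p ^+ n.+1 * X) = q%:R * (p ^+ n * X) by rewrite exprS; ring.
  have eq1 : (q ^ 2)%:R ^+ (1 + n) * X ^+ 2 = (- (p ^+ n.+1 * X)) ^+ 2 :> C.
    by rewrite q2E [RHS]sqrrN [RHS]exprMn -!exprM mulnC.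
  rewrite eq1 in r2; rewrite -ex in r2.
  move: r2; move: (- (p ^+ n.+1 * X)) => x.
  rewrite [x ^+ a.+2]exprS [x ^+ a.+1]exprS.
  move: (bsum E X (dblk t (diag_mx d))) (bsum E ((q ^ 2)%:R * X) (diag_mx d)) => B Bq.
  move: (bsum E X (diag_mx d)) => B'.
  move: (x ^+ a) (p ^+ valsum d) (p ^+ n * X) => xa pl u r2.
  have -> : (1 - X) * (1 - p * X) * Bq = (1 - X) * (1 + q%:R * X) * Bq by ring.
  by rewrite -r2; ring.
have n10 : (p ^+ n.+1 != 0) by rewrite expf_neq0.
pose kap : C := (q ^ 2)%:R ^- n.+1.
have k0 : kap != 0 by rewrite invr_eq0 expf_neq0.
have kapE : kap * (p ^+ n.+1 * p ^+ n.+1) = 1.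
  by rewrite /kap q2E -expr2 -!exprM mulnC mulVf // expf_neq0.
have kapn : (q ^ 2)%:R ^- n = (q ^ 2)%:R * kap :> C.
  by rewrite /kap exprS invfM mulrA mulfV // mul1r.
have main X : X != 0 -> - (p ^+ n.+1 * X) != 1 -> - (p ^+ n.+1 * X) != -1 ->
   bsum E X (dblk t (diag_mx d)) * norm_factor n.+1 (kap / X) =
  (- (p ^+ n.+1 * X)) ^+ (a + valsum d) *
     bsum E (kap / X) (dblk t (diag_mx d)) * norm_factor n.+1 X.
  move=> X0 nx1 nxm1; set Xt := kap / X.
  have Xt0 : Xt != 0 by rewrite mulf_neq0 // invr_eq0.
  set x := - (p ^+ n.+1 * X) in nx1 nxm1 *; pose xt := - (p ^+ n.+1 * Xt).
  have xxt : x * xt = 1.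
    rewrite /x /xt /Xt mulrNN -[RHS]kapE; move: (p ^+ n.+1) (kap) => P k; field.
    exact: X0.
  have x0 : x != 0 by rewrite oppr_eq0 mulf_neq0.
  have i1 := IH ((q ^ 2)%:R * X) (mulf_neq0 q20 X0).
  have i2 := IH X X0.
  (* Duality in size n sends q^2 X to Xt, and X to q^2 Xt, where Xt is the dual of X in size n +
     1. *)
  have e1 : (q ^ 2)%:R ^- n / ((q ^ 2)%:R * X) = Xt.
    rewrite kapn /Xt; move: ((q ^ 2)%:R : C) q20 (kap) => Q Q0 k.
    by field; rewrite X0 Q0.
  have e2 : (q ^ 2)%:R ^- n / X = (q ^ 2)%:R * Xt by rewrite kapn /Xt mulrA.
  have e3 : - (p ^+ n * ((q ^ 2)%:R * X)) = p * x.
    by rewrite /x q2E [p ^+ n.+1]exprS; ring.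
  have e4 : - (p ^+ n * X) = p^-1 * x.
    by rewrite /x exprS; field.
  rewrite e1 e3 exprMn in i1; rewrite e2 e4 exprMn exprVn in i2.
  have yp0 : p ^+ valsum d != 0 by rewrite expf_neq0.
  have y0 : x ^+ valsum d != 0 by rewrite expf_neq0.
  have ya0 : x ^+ a != 0 by rewrite expf_neq0.
  have ext : xt = x^-1 by apply: (mulfI x0); rewrite xxt mulfV.
  have relX := rel X; have relXt := rel Xt.
  rewrite -/x in relX; have exa : xt ^+ a = (x ^+ a)^-1 by rewrite ext exprVn.
  rewrite -/xt exa in relXt.
  have c3 := norm_factor_shift n X; have c4 := norm_factor_shift n Xt.
  have e5 : 1 - p ^+ n.+1 * X = 1 + x by rewrite /x.
  have e6 : 1 - p ^+ n.+1 * Xt = 1 + xt by rewrite /xt.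
  rewrite e5 in c3; rewrite e6 in c4.
  have i2' : bsum E X (diag_mx d) * norm_factor n ((q ^ 2)%:R * Xt) =
    x ^+ valsum d / p ^+ valsum d * bsum E ((q ^ 2)%:R * Xt) (diag_mx d) * norm_factor n X.
    by rewrite i2 [_^-1 * _]mulrC.
  have := fe_step_algebra xxt p0 yp0 ya0 y0 relX relXt i1 i2' (norm_factorS n X)
    (norm_factorS n Xt) c3 c4.
  rewrite exprD => h; apply: (mulfI _ h).
  have n1 : 1 - x ^+ 2 != 0.
    by rewrite subr_eq0 eq_sym sqrf_eq1 negb_or nx1 nxm1.
  rewrite mulf_neq0 // ext; apply: contra nxm1 => /eqP h1; apply/eqP.
  have : x + 1 = x * (1 + x^-1) by field.
  by rewrite h1 mulr0 => /eqP; rewrite addr_eq0 => /eqP.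
(* The zeros of h are the points with x = 1 or x = -1, which [main] excludes. *)
pose h : {poly C} := (1 + p ^+ n.+1 *: 'X) * (1 - p ^+ n.+1 *: 'X).
have hE X : h.[X] = (1 + p ^+ n.+1 * X) * (1 - p ^+ n.+1 * X) by rewrite /h !hornerE.
have h0 : h != 0.
  apply: contraTneq (oner_neq0 C) => h0; have := hE 0.
  by rewrite h0 horner0 mulr0 addr0 subr0 mulr1 => <-; rewrite eqxx.
move=> X X0; rewrite -/kap.
have := @reciprocal_density _ (bpoly E (dblk t (diag_mx d))) (norm_poly n.+1)
   (norm_poly n.+1) (bpoly E (dblk t (diag_mx d))) h kap (- p ^+ n.+1) (a + valsum d) h0 _ X X0.
rewrite !bpolyE !norm_polyE mulNr => ->; first by rewrite mulrAC.
move=> Y Y0; rewrite hE mulf_eq0 negb_or => /andP[g1 g2].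
rewrite !bpolyE !norm_polyE mulNr main //; first by rewrite mulrAC.
- by apply: contra g1 => /eqP g; rewrite -{1}g -[X in _ + X]opprK subrr.
- by apply: contra g2; rewrite eqr_opp => /eqP ->; rewrite subrr.
Qed.

Lemma fun_eq_diag n (d : 'rV[K]_n) E (lam : nat) :
  (forall i, star (d 0 i) = d 0 i) -> (forall i, d 0 i != 0) ->
  (forall i, 0 <= w (d 0 i)) -> (forall i, w (d 0 i) <= lam) ->
  (lam + 10 <= E)%N -> fun_eq d E.
Proof.
elim: n d => [|n IH] d sd d0 wd dle lE.
  by move=> X X0; rewrite !bsum_size0 /norm_factor !big_ord0 expr0 !mulr1.
(* The diagonal entry split off is one of largest valuation, as both relations require. *)
pose k := [arg max_(i > ord0 : 'I_n.+1) `|w (d 0%R i)|%N].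
have hk i : w (d 0 i) <= w (d 0 k).
  rewrite /k; case: arg_maxnP => //= j _ hj; have := hj i isT; have := wd i; have := wd j.
  by move: (w _) (w _) => x y; lia.
pose e : 'rV[K]_n.+1 := \row_i d 0 (tperm ord0 k i).
have ed X : bsum E X (diag_mx d) = bsum E X (diag_mx e).
  rewrite -tperm_diag bsum_gl //; [exact: diag_hball | exact: gl_perm].
have vd : valsum d = valsum e.
  rewrite (reindex_inj (@perm_inj _ (tperm ord0 k))) /=.
  by apply: eq_bigr => i _; rewrite mxE.
pose t := e 0 ord0; pose f : 'rV[K]_n := \row_i e 0 (lift ord0 i).
have tE : t = d 0 k by rewrite /t mxE tpermL.
have fE i : f 0 i = d 0 (tperm ord0 k (lift ord0 i)) by rewrite !mxE.
have eE : diag_mx e = dblk t (diag_mx f).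
  have -> : e = row_mx t%:M f :> 'rV[K]_(1 + n).
    apply/rowP=> i; case: (splitP i) => j ij.
      have -> : i = lshift n j by apply: ord_inj.
      rewrite row_mxEl !ord1 [RHS]mxE eqxx mulr1n /t; congr (e _ _); exact: ord_inj.
    have -> : i = rshift 1 j by apply: ord_inj.
    rewrite row_mxEr [RHS]mxE; congr (e _ _); exact: ord_inj.
  apply: (etrans (@diag_mx_row _ n 1 t%:M f)); rewrite /dblk; congr block_mx.
  by apply/matrixP=> i j; rewrite !ord1 !mxE !eqxx.
have ve : valsum e = (`|w t| + valsum f)%N.
  by rewrite big_ord_recl; congr addn; apply: eq_bigr => i _; rewrite [f _ _]mxE.
move=> X X0; rewrite !ed vd ve eE; apply: fun_eq_step => //.
- by rewrite tE.
- by rewrite tE.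
- by rewrite tE.
- by move=> i; rewrite fE.
- by move=> i; rewrite fE.
- by move=> i; rewrite fE.
- by move=> i; rewrite fE tE.
- by rewrite tE; have := dle k; have := wd k; move: (w _) => z; lia.
- by apply: IH => // i; rewrite fE.
Qed.

End FunctionalEquation.

(** * Local fields and the unramified extension *)

Section NormalizedValuation.
Variables (F : fieldType) (v : F -> int).
Hypothesis hv : normalized_valuation v.

Lemma v_geP N x : reflect (v_ge v N x) ((x == 0) || (N <= v x)).
Proof. by apply: (iffP orP) => -[h|h]; [left; exact/eqP | right | left; exact/eqP | right]. Qed.

Lemma valuation1 : v 1 = 0.
Proof.
have := valuationM hv (oner_neq0 F) (oner_neq0 F); rewrite mulr1.
by move/eqP; rewrite -subr_eq0 opprD addrA subrr sub0r oppr_eq0 => /eqP.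
Qed.

Lemma v_geM M N x y : v_ge v M x -> v_ge v N y -> v_ge v (M + N) (x * y).
Proof.
move=> [->|hx]; first by rewrite mul0r; left.
have [->|x0] := eqVneq x 0; first by rewrite mul0r; left.
move=> [->|hy]; first by rewrite mulr0; left.
have [->|y0] := eqVneq y 0; first by rewrite mulr0; left.
by right; rewrite (valuationM hv) // lerD.
Qed.

Lemma v_ge_mono M N x : N <= M -> v_ge v M x -> v_ge v N x.
Proof. by move=> NM [->|h]; [left|right; exact: le_trans h]. Qed.

Lemma v_geN N x : v_ge v N x -> v_ge v N (- x).
Proof.
move=> h; rewrite -mulN1r -[N]add0r; apply: v_geM => //; right.
have m1 : (-1 : F) != 0 by rewrite oppr_eq0 oner_neq0.
by have := valuationM hv m1 m1; rewrite mulrNN mulr1 valuation1; lia.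
Qed.

Lemma v_ge_trans N x y z : v_ge v N (x - y) -> v_ge v N (y - z) -> v_ge v N (x - z).
Proof.
move=> hxy hyz; have -> : x - z = (x - y) + (y - z) by rewrite addrA subrK.
exact: (valuationD hv).
Qed.

Lemma v_ge_sym N x y : v_ge v N (x - y) -> v_ge v N (y - x).
Proof. by move=> h; rewrite -opprB; exact: v_geN. Qed.

Lemma v_ge_all0 x : (forall N, v_ge v N x) -> x = 0.
Proof. by move=> h; case: (h (v x + 1)) => // /[!gerDl]. Qed.

(* The iteration y -> y^2 + a converges. *)
Lemma quadratic_root (a : F) : valuation_complete v -> v_ge v 1 a ->
  exists y : F, y * y - y + a = 0.
Proof.
move=> complete ha; pose u i : F := iter i (fun y : F => y * y + a) 0.
have uS i : u i.+1 = u i * u i + a by [].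
have u1 i : v_ge v 1 (u i).
  elim: i => [|i IH]; first by left.
  by apply: (valuationD hv) => //; apply: v_ge_mono (v_geM IH IH).
(* The difference of consecutive terms is the previous one times a sum in the maximal ideal, so each
   step gains one unit of valuation. *)
have step i : v_ge v i.+1%:Z (u i.+1 - u i).
  elim: i => [|i IH]; first by rewrite /u /= mul0r add0r subr0.
  have -> : u i.+2 - u i.+1 = (u i.+1 - u i) * (u i.+1 + u i).
    rewrite !uS; move: (u i) => x; ring.
  by rewrite -addn1 PoszD; apply: v_geM => //; exact: (valuationD hv).
have far i d : v_ge v i.+1%:Z (u (i + d)%N - u i).
  elim: d => [|d IH]; first by rewrite addn0 subrr; left.
  rewrite addnS; apply: v_ge_trans IH; apply: v_ge_mono (step _); lia.
have [|l hl] := complete u.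
  move=> N; exists `|N|%N => i j hi hj.
  have close h : (`|N| <= h)%N -> v_ge v N (u h - u `|N|%N).
    by move=> Nh; rewrite -(subnKC Nh); apply: v_ge_mono (far _ _); lia.
  apply: (@v_ge_trans _ _ (u `|N|%N)); first exact: close.
  by apply: v_ge_sym; exact: close.
exists l; apply: v_ge_all0 => N.
have [m hm] := hl (`|N|%:Z + 1).
pose i := maxn m `|N|%N.
have hi := hm i (leq_maxl _ _); have si := step i.
have hl1 : v_ge v 1 l.
  have -> : l = u i - (u i - l) by rewrite opprB addrC subrK.
  apply: (valuationD hv); first exact: u1.
  by apply: v_geN; apply: v_ge_mono hi; lia.
have -> : l * l - l + a = (u i - l) * (- (l + u i) + 1) + (u i.+1 - u i).
  by rewrite uS; move: (u i) => x; ring.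
apply: (valuationD hv).
  rewrite -[N]addr0; apply: v_geM; first by apply: v_ge_mono hi; lia.
  apply: (valuationD hv); last by right; rewrite valuation1.
  apply: v_geN; apply: (@v_ge_mono 1) => //; exact: (valuationD hv).
by apply: v_ge_mono si; rewrite /i; lia.
Qed.

End NormalizedValuation.

Lemma even_involution (T : eqType) (s : seq T) (g : T -> T) : uniq s ->
  {in s, forall x, [/\ g x \in s, g x != x & g (g x) = x]} -> ~~ odd (size s).
Proof.
have [n sn] := ubnP (size s); elim: n s sn => // n IH [//|x s] sn /= /andP[xs us] h.
have [gs gx ggx] := h x (mem_head _ _).
move: gs; rewrite inE (negPf gx) /= => gs.
have ssz : (0 < size s)%N by case: (s) gs.
have := IH (rem (g x) s); rewrite size_rem // rem_uniq // => IH'.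
suff : ~~ odd (size s).-1 by case: (size s) ssz => //= m _ hm; rewrite negbK.
apply: IH' => //; first by move: sn => /=; case: (size s) ssz => //= m _; lia.
move=> y; rewrite mem_rem_uniq // inE /= => /andP[ygx ys].
have [gys gy ggy] := h y (mem_behead (s := x :: s) ys).
have yx : y != x by apply: contraNneq xs => <-.
split=> //; rewrite mem_rem_uniq // inE /=; apply/andP; split.
  by apply: contraNneq yx => e; rewrite -ggy e ggx.
move: gys; rewrite inE => /predU1P[e|//].
by move: ygx; rewrite -ggy e eqxx.
Qed.

Section LocalField.
Variables (k : fieldType) (v : k -> int) (q : nat).
Hypotheses (hk : local_field0 v q) (hq : odd q).
Let hv := local_field_valuation hk.

Lemma residue_transversal : exists s : seq k, [/\ uniq s, size s = q,
  {in s, forall x, v_ge v 0 x},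
  {in s &, forall x y, v_ge v 1 (x - y) -> x = y} &
  forall x, v_ge v 0 x -> exists2 y, y \in s & v_ge v 1 (x - y)].
Proof.
have /card_esym/card_set_bijP[f [fun_f inj_f surj_f]] := local_field_residue hk.
pose cl (x : k) : set k := [set y | v_ge v 1 (y - x)].
pose r i : k := xget 0 [set x | v_ge v 0 x /\ cl x = f i].
have rP i : (i < q)%N -> v_ge v 0 (r i) /\ cl (r i) = f i.
  move=> iq; have [x hx e] := fun_f i iq.
  by apply: (@xgetPex _ 0 [set x | v_ge v 0 x /\ cl x = f i]); exists x.
have clrefl x : cl x x by rewrite /cl /= subrr; left.
have rinj i j : (i < q)%N -> (j < q)%N -> v_ge v 1 (r i - r j) -> i = j.
  move=> iq jq h; apply: inj_f; [exact: mem_set | exact: mem_set |].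
  have [_ <-] := rP i iq; have [_ <-] := rP j jq.
  apply/seteqP; split=> y; rewrite /cl /= => hy.
    exact: (v_ge_trans hv hy h).
  by apply: (v_ge_trans hv hy); exact: v_ge_sym.
exists (map r (iota 0 q)); split.
- rewrite map_inj_in_uniq ?iota_uniq // => i j; rewrite !mem_iota /= !add0n => iq jq e.
  by apply: rinj => //; rewrite e subrr; left.
- by rewrite size_map size_iota.
- by move=> _ /mapP[j + ->]; rewrite mem_iota /= add0n => /rP[].
- move=> _ _ /mapP[a + ->] /mapP[b + ->]; rewrite !mem_iota /= !add0n => aq bq.
  by move/(rinj _ _ aq bq) ->.
- move=> x hx; have [i iq e] := surj_f (cl x) (ex_intro2 _ _ x hx erefl).
  exists (r i); first by apply: map_f; rewrite mem_iota /= add0n.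
  have [_ e2] := rP i iq; have : cl (r i) x by rewrite e2 e; exact: clrefl.
  by [].
Qed.

Lemma residue_gt1 : (1 < q)%N.
Proof.
have [s [us sz s0 sinj cov]] := residue_transversal.
have [|x xs h0] := cov 0; first by left.
have [|y ys h1] := cov 1; first by right; rewrite (valuation1 hv).
rewrite ltn_neqAle odd_gt0 // andbT; apply/negP => /eqP q1.
have xy : x = y by move: xs ys; case: s {us s0 sinj cov} sz => [|a [|b s]] //=; rewrite -?q1 // !inE => _ /eqP -> /eqP ->.
have : v_ge v 1 (1 - 0).
  have -> : 1 - 0 = (1 - y) + - (0 - x) by rewrite xy; ring.
  by apply: (valuationD hv) => //; exact: v_geN.
by rewrite subr0 => -[/eqP|]; rewrite ?oner_eq0 // (valuation1 hv).
Qed.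

Lemma two_neq0 : 2%:R != 0 :> k.
Proof.
have := local_field_pchar hk; move/(_ 2%N); rewrite !inE /= => h.
by apply/negP => /eqP e; move: h; rewrite e eqxx.
Qed.

(** If 2 were in the maximal ideal, x -> x + 1 would be an involution of the residue classes without
    fixed points, and q would be even. *)
Lemma valuation2 : v 2%:R = 0.
Proof.
have h2 : v_ge v 0 2%:R.
  by rewrite -[2%:R]/(1 + 1); apply: (valuationD hv); right; rewrite (valuation1 hv).
case: h2 => [/eqP|h2]; first by rewrite (negPf two_neq0).
apply/eqP; rewrite eq_le h2 andbT leNgt; apply/negP => h.
have h1 : v_ge v 1 2%:R by right.
have [s [us sz s0 sinj cov]] := residue_transversal.
have cov1 x : exists y, v_ge v 0 x -> y \in s /\ v_ge v 1 (x + 1 - y).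
  have [hx|nx] := pselect (v_ge v 0 x); last by exists 0.
  have [|y ys hy] := cov (x + 1); last by exists y.
  by apply: (valuationD hv) => //; right; rewrite (valuation1 hv).
have [g hg] := choice cov1.
suff : ~~ odd (size s) by rewrite sz hq.
apply: (@even_involution _ _ g) => // x xs.
have [gs gx] := hg x (s0 x xs); have [ggs ggx] := hg _ (s0 _ gs).
split=> //.
  apply/eqP=> e; move: gx; rewrite e addrAC subrr add0r => -[/eqP|]; first by rewrite oner_eq0.
  by rewrite (valuation1 hv).
apply: sinj => //.
have -> : g (g x) - x = - (g x + 1 - g (g x)) + (- (x + 1 - g x) + 2%:R).
  by move: (g x) (g (g x)) => a b; rewrite -[2%:R]/(1 + 1); ring.
by apply: (valuationD hv); [exact: v_geN | apply: (valuationD hv) => //; exact: v_geN].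
Qed.

End LocalField.

Section QuadraticExtension.
Variables (k : fieldType) (v : k -> int) (q : nat).
Hypothesis hk : local_field0 v q.
Variables (k' : fieldExtType k) (w : k' -> int).
Hypothesis hk' : unramified_quadratic v w.
Variable star : {lrmorphism k' -> k'}.
Hypothesis hstar : exists x, star x != x.
Let hw := unramified_valuation hk'.

Lemma star_base (a : k) : star a%:A = a%:A.
Proof. by rewrite linearZ /= rmorph1. Qed.

Lemma quadratic_basis x : star x != x -> forall y, exists a b : k, y = a%:A + b *: x.
Proof.
move=> nx y.
have fr : free [:: x; 1].
  rewrite free_cons seq1_free oner_neq0 andbT span_seq1.
  by apply: contra nx => /vlineP[a ->]; rewrite star_base.
have : basis_of {:k'} [:: x; 1].
  by rewrite basisEfree fr subvf (unramified_degree hk').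
move/span_basis; rewrite span_cons span_seq1 => e.
have : y \in (<[x]> + <[1]>)%VS by rewrite e memvf.
by case/memv_addP=> _ /vlineP[b ->] [_ /vlineP[a ->] ->]; exists a, b; rewrite addrC.
Qed.

(** [star] is only given as a nontrivial k-morphism. An element x that it moves satisfies a
    quadratic equation over k, whose other root is star x; thus star x = s - x with s in k. *)
Lemma starK : involutive star.
Proof.
have [x nx] := hstar; have bas := quadratic_basis nx.
have [d [s ex]] := bas (x * x).
have : star x * star x = d%:A + s *: star x.
  by rewrite -rmorphM ex rmorphD /= star_base linearZ.
have {}ex : x * x = d%:A + s%:A * x by rewrite mulr_algl.
rewrite -[s *: _]mulr_algl => ex'.
have sx : star x = s%:A - x.
  have : (star x - x) * (star x - (s%:A - x)) = 0.
    have -> : (star x - x) * (star x - (s%:A - x)) = star x * star x - s%:A * star x - (x * x - s%:A * x).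
      by move: (star x) (s%:A) => z t; ring.
    by rewrite ex' ex; ring.
  by move/eqP; rewrite mulf_eq0 subr_eq0 (negPf nx) subr_eq0 => /eqP.
have ssx : star (star x) = x by rewrite sx rmorphB /= star_base sx opprB addrC subrK.
move=> y; have [a [b ->]] := bas y.
by rewrite !(rmorphD star) /= !linearZ /= !rmorph1 ssx.
Qed.

Lemma star_fixed y : star y = y -> exists a : k, y = a%:A.
Proof.
have [x nx] := hstar; have [a [b ->]] := quadratic_basis nx y.
rewrite rmorphD /= star_base linearZ /= => /addrI /eqP.
rewrite -subr_eq0 -scalerBr scaler_eq0 subr_eq0 (negPf nx) orbF => /eqP ->.
by exists a; rewrite scale0r addr0.
Qed.

Lemma in_baseK (a : k) : in_base (a%:A : k') = a.
Proof.
rewrite /in_base; have : [set b | b%:A = a%:A :> k'] (xget 0 [set b | b%:A = a%:A :> k']).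
  by apply: (@xgetPex _ 0); exists a.
by move/(fmorph_inj (in_alg k')).
Qed.

Lemma in_base_alg y : star y = y -> (in_base y)%:A = y.
Proof. by move=> /star_fixed[a ->]; rewrite in_baseK. Qed.

Lemma w_alg (a : k) N : v_ge w N (a%:A) <-> v_ge v N a.
Proof.
have [->|a0] := eqVneq a 0; first by rewrite scale0r; split=> _; left.
have aA0 : a%:A != 0 :> k' by rewrite scaler_eq0 oner_eq0 orbF.
by split=> -[/eqP|h]; rewrite ?(negPf a0) ?(negPf aA0) //; right; move: h; rewrite (unramified_extends hk').
Qed.

(* If x and its conjugate had different valuations, Hensel's lemma would split
   the minimal polynomial of x over k. *)
Lemma w_star x : w (star x) = w x.
Proof.
have key y : y != 0 -> w y <= w (star y).
  move=> y0; rewrite leNgt; apply/negP => wy.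
  have sy0 : star y != 0 by rewrite fmorph_eq0.
  have ny : star y != y by apply: contraTneq wy => ->; rewrite ltxx.
  have sfix : star (y + star y) = y + star y by rewrite rmorphD /= starK addrC.
  have dfix : star (y * star y) = y * star y by rewrite rmorphM /= starK mulrC.
  pose s := in_base (y + star y); pose d := in_base (y * star y).
  have sE : s%:A = y + star y by exact: in_base_alg.
  have dE : d%:A = y * star y by exact: in_base_alg.
  have ws : ~ v_ge w (w (star y) + 1) (s%:A : k').
    rewrite sE => h; have : v_ge w (w (star y) + 1) (star y).
      have e : star y = (y + star y) + - y by rewrite addrAC subrr add0r.
      rewrite [X in v_ge _ _ X]e.
      by apply: (valuationD hw) => //; apply: (v_geN hw); right; lia.
    by case=> [/eqP|]; rewrite ?(negPf sy0) // gerDl.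
  have s0 : s != 0.
    by apply: contra_notN ws => /eqP ->; rewrite scale0r; left.
  have vs : v s <= w (star y).
    have : ~ v_ge v (w (star y) + 1) s by move/(w_alg s).
    by move=> h; rewrite leNgt; apply/negP => lt; apply: h; right; lia.
  have d0 : d != 0.
    have : d%:A != 0 :> k' by rewrite dE mulf_neq0.
    by apply: contra => /eqP ->; rewrite scale0r.
  have vd : v d = w y + w (star y).
    by rewrite -(unramified_extends hk' d0) dE (valuationM hw).
  have hv := local_field_valuation hk.
  have vV z : z != 0 -> v z^-1 = - v z.
    move=> z0; have z1 : z^-1 != 0 by rewrite invr_eq0.
    by have := valuationM hv z0 z1; rewrite mulfV // (valuation1 hv); lia.
  (* Putting Z = s Y turns Z^2 - s Z + d, with trace s and norm d of y, into s^2 (Y^2 - Y + d /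
     s^2). From v s <= w (star y) < w y it follows that d / s^2 lies in the maximal ideal. *)
  have [|r hr] := quadratic_root hv (local_field_complete hk) (a := d / (s * s)).
    right; rewrite (valuationM hv) ?invr_eq0 ?mulf_neq0 // vV ?mulf_neq0 // (valuationM hv) // vd; lia.
  have rt : ((s * r)%:A - y) * ((s * r)%:A - star y) = 0.
    have -> : ((s * r)%:A - y) * ((s * r)%:A - star y) =
       (s * r)%:A * (s * r)%:A - (s%:A) * (s * r)%:A + d%:A by rewrite sE dE; ring.
    have -> : (s * r)%:A * (s * r)%:A - s%:A * (s * r)%:A + d%:A =
       (s * r * (s * r) - s * (s * r) + d)%:A :> k'.
      by rewrite scalerDl scalerBl -!(rmorphM (in_alg k')).
    have -> : s * r * (s * r) - s * (s * r) + d = s * s * (r * r - r + d / (s * s)).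
      by field; exact: s0.
    by rewrite hr mulr0 scale0r.
  move/eqP: rt; rewrite mulf_eq0 !subr_eq0 => /orP[]/eqP e; move: ny.
    by rewrite -e star_base eqxx.
  by rewrite -[y]starK -e !star_base eqxx.
have [->|x0] := eqVneq x 0; first by rewrite rmorph0.
apply/eqP; rewrite eq_le key // andbT -{2}[x]starK; apply: key.
by rewrite fmorph_eq0.
Qed.

(** x - star x is traceless and nonzero. Since [varpi] still has valuation 1 in k', a power of it
    normalizes the valuation. *)
Lemma traceless_unit (varpi : k) : varpi != 0 -> v varpi = 1 ->
  exists th : k', [/\ th != 0, w th = 0 & star th = - th].
Proof.
move=> p0 vp; have [x nx] := hstar.
have t0 : x - star x != 0 by rewrite subr_eq0 eq_sym.
have pA0 : varpi%:A != 0 :> k' by rewrite scaler_eq0 oner_eq0 orbF.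
have pz z : varpi%:A ^ z != 0 :> k' by exact: expfz_neq0.
have wp1 : w varpi%:A = 1 by rewrite (unramified_extends hk').
have wV z : z != 0 -> w z^-1 = - w z.
  move=> z0; have z1 : z^-1 != 0 by rewrite invr_eq0.
  by have := valuationM hw z0 z1; rewrite mulfV // (valuation1 hw); lia.
have wpn (m : nat) : w (varpi%:A ^+ m) = m%:Z.
  elim: m => [|m IH]; first by rewrite expr0 (valuation1 hw).
  by rewrite exprS (valuationM hw) ?expf_neq0 // IH wp1.
have wpz z : w (varpi%:A ^ z) = z.
  case: z => m; first exact: wpn.
  by rewrite NegzE -exprnN wV ?expf_neq0 // wpn.
exists (varpi%:A ^ (- w (x - star x)) * (x - star x)); split.
- by rewrite mulf_neq0.
- by rewrite (valuationM hw) // wpz addNr.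
- by rewrite rmorphM rmorphB /= starK rmorphXz ?unitfE //= star_base -mulrN opprB.
Qed.

End QuadraticExtension.

Local Open Scope complex_scope.

(** * Elementary divisors, and integrals of functions with finitely many values *)

Section ElementaryDivisors.
Variable D : herm_setting.
Local Notation K := (hs_K D).
Local Notation w := (@hs_w D).
Local Notation pi := (hs_pi D).

Definition divisor_row n (d : 'I_n -> option int) : 'rV[K]_n :=
  \row_i if d i is Some e then pi ^ e else 0.

Lemma ord_elementary n (U V : 'M[K]_n) d : U \in gl n -> V \in gl n ->
  ord (U *m diag_mx (divisor_row d) *m V) =
  (\sum_i (if d i is Some (Negz m) then m.+1 else 0))%N.
Proof.
move=> hU hV; apply: ordP; rewrite idx_gl // idx_diag; congr (_ ^+ _).
apply: eq_bigr => i _; rewrite mxE /vden.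
case: (d i) => [[e|e]|]; last by rewrite rpred0.
  by rewrite (pball_mono _ (piX_ball D e)).
by rewrite in_pball (negPf (piX_neq0 D _)) w_piX.
Qed.

Lemma elementary_exists n (R : 'M[K]_n) : adjmx R = R ->
  exists U V d, [/\ U \in gl n, V \in gl n & R = U *m diag_mx (divisor_row d) *m V].
Proof.
move/hermitian_diagP=> [U [d [hU _ ->]]].
pose e i : option int := if d 0 i == 0 then None else Some (w (d 0 i)).
(* The unit parts of the diagonal entries, with 1 in place of a zero entry, so that [diag_mx u] can
   be absorbed into the right factor. *)
pose u : 'rV[K]_n := \row_i if d 0 i == 0 then 1 else pi ^ (- w (d 0 i)) * d 0 i.
have hu : diag_mx u \in gl n.
  have u1 i : u 0 i != 0 /\ w (u 0 i) = 0.
    rewrite mxE; have [_|di] := eqVneq (d 0 i) 0; first by rewrite oner_neq0 w1.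
    by rewrite mulf_neq0 ?piX_neq0 // hs_wM ?piX_neq0 // w_piX addNr.
  apply: (@gl_intro _ _ _ (diag_mx (\row_i (u 0 i)^-1))).
  - rewrite mulmx_diag; apply/matrixP=> i j; rewrite !mxE.
    case: (u1 i) => ui _; move: ui; rewrite mxE => ui.
    by rewrite mulfV.
  - apply/mballP=> i j; rewrite mxE; case: eqP => _; last by rewrite mulr0n rpred0.
    by case: (u1 i) => _ e0; rewrite mulr1n in_pball e0 lexx orbT.
  - apply/mballP=> i j; rewrite mxE; case: eqP => _; last by rewrite mulr0n rpred0.
    by rewrite mxE mulr1n; case: (u1 i) => u0 e0; rewrite in_pball wV // e0 oppr0 lexx orbT.
exists U, (diag_mx u *m adjmx U), e; split=> //; first by rewrite glM // gl_adj.
rewrite mulmxA -(mulmxA U (diag_mx (divisor_row e))) mulmx_diag; congr (_ *m diag_mx _ *m _).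
apply/rowP=> i; rewrite !mxE /e; case: eqP => [->|_]; first by rewrite mul0r.
by rewrite mulrA -expfzDr ?hs_pi_neq0 // subrr expr0z mul1r.
Qed.

End ElementaryDivisors.

Lemma Rintegral_pieces d (T : measurableType d) (R : realType)
    (mu : {measure set T -> \bar R}) (I : eqType) (F : I -> set T) (s : seq I)
    (g : T -> R) (c : I -> R) (m : R) :
  (forall i, measurable (F i)) -> uniq s -> trivIset [set` s] F ->
  measurable_fun (\big[setU/set0]_(i <- s) F i) g ->
  {in s, forall i, mu (F i) = m%:E} ->
  {in s, forall i x, F i x -> g x = c i} ->
  \int[mu]_(x in \big[setU/set0]_(i <- s) F i) g x = m * \sum_(i <- s) c i.
Proof.
move=> mF us tF mg muF gF.
rewrite /Rintegral integral_bigsetU_EFin //; last exact/measurable_realfun.measurable_EFinP.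
rewrite big_seq (eq_bigr (fun i => (m * c i)%:E)) => [|i si].
  by rewrite -big_seq sumEFin /= mulr_sumr.
rewrite (eq_integral (cst (c i)%:E)) => [|x]; last first.
  by move=> /set_mem Fx; rewrite (gF i si x Fx).
by rewrite integral_cst // (muF i si) mulrC EFinM.
Qed.

Lemma sum_complex (R : realType) (I : Type) (r : seq I) (F : I -> R[i]) :
  \sum_(i <- r) F i = (\sum_(i <- r) complex.Re (F i)) +i* (\sum_(i <- r) complex.Im (F i)).
Proof.
elim: r => [|x r IH]; first by rewrite !big_nil.
by rewrite !big_cons IH; case: (F x).
Qed.

Lemma mulr_complex (R : realType) (m a b : R) : m%:C * (a +i* b) = (m * a) +i* (m * b).
Proof. by apply/eqP; rewrite eq_complex /= !mul0r subr0 addr0 !eqxx. Qed.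

(** * Integral and nonintegral hermitian matrices *)

Section HermitianMatrix.
Variable D : herm_setting.
Local Notation K := (hs_K D).
Local Notation C := (hs_C D).
Local Notation w := (@hs_w D).
Local Notation star := (@hs_star D).
Local Notation q := (hs_q D).
Local Notation Psi := (@hs_psi D).

Lemma gl_w_det n (U : 'M[K]_n) : U \in gl n -> w (\det U) = 0.
Proof.
move=> /glP[uU U0 V0].
have d0 : \det U != 0 by move: uU; rewrite unitmxE unitfE.
have := det_ball U0; have := det_ball V0; rewrite det_inv !in_pball invr_eq0 (negPf d0) /=.
rewrite wV // oppr_ge0 => h1 h2; apply: le_anti; rewrite h1; exact: h2.
Qed.

Lemma bsum_fun_eq n (T : 'M[K]_n) : T \in hball n 0 -> T \in unitmx ->
  exists lam l : nat, [/\ invmx T \in mball n n (- lam%:Z), w (\det T) = l &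
  forall X : C, X != 0 ->
    bsum (lam + 10) X T * @norm_factor D n ((q ^ 2)%:R ^- n / X) =
    (- ((- q%:R) ^+ n * X)) ^+ l * bsum (lam + 10) ((q ^ 2)%:R ^- n / X) T *
    @norm_factor D n X].
Proof.
move=> hT uT; have [U [d [hU sd eT]]] := hermitian_diagP (hball_adj hT).
have uU := gl_unit hU; have hUa := gl_adj hU; have uUa := gl_unit hUa.
have ed : invmx U *m T *m adjmx (invmx U) = diag_mx d.
  by rewrite eT adjmx_inv !mulmxA mulVmx // mul1mx mulmxK.
have hd : diag_mx d \in hball n 0.
  by rewrite -ed; apply: hball_congr => //; apply: gl_ball; exact: glV.
have d0 i : d 0 i != 0.
  move: uT; rewrite eT !unitmx_mul uU uUa andbT /= unitmxE det_diag unitfE.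
  by move/prodf_neq0; apply.
have wd i : 0 <= w (d 0 i).
  have /mballP/(_ i i) := hball_mball hd.
  by rewrite mxE eqxx mulr1n in_pball (negPf (d0 i)).
have [e he] := mball_bound (invmx T).
(* This [lam] bounds both the denominators of T^-1 and every w d_i. *)
exists (e + \sum_i `|w (d 0%R i)|)%N, (\sum_i `|w (d 0%R i)|)%N; split.
- by apply: mball_mono he; lia.
- rewrite eT !det_mulmx det_diag.
  have nz (A : 'M[K]_n) : A \in gl n -> \det A != 0 by move/gl_unit; rewrite unitmxE unitfE.
  have pnz : \prod_i d 0 i != 0 by apply/prodf_neq0.
  rewrite hs_wM ?mulf_neq0 ?nz // hs_wM ?nz // !gl_w_det // add0r addr0.
  suff [] : (\prod_i d 0 i != 0) /\ w (\prod_i d 0 i) = (\sum_i `|w (d 0%R i)|)%N by [].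
  apply: (big_rec2 (fun (a : K) (m : nat) => a != 0 /\ w a = m)).
    by rewrite oner_neq0 w1.
  move=> i m a _ [a0 wa]; rewrite mulf_neq0 //; split=> //.
  by rewrite hs_wM // wa PoszD; congr (_ + _); rewrite gez0_abs.
- move=> X X0; have bE Y : bsum (e + \sum_i `|w (d 0%R i)| + 10) Y T =
      bsum (e + \sum_i `|w (d 0%R i)| + 10) Y (diag_mx d).
    by rewrite -(bsum_gl _ Y hd hUa) adjmxK eT.
  rewrite !bE; apply: (@fun_eq_diag _ _ _ _ (e + \sum_i `|w (d 0%R i)|)%N) => //.
  move=> i; rewrite (bigD1 i) //=; have := wd i; lia.
Qed.

Lemma phase_nonint n (T : 'M[K]_n) : adjmx T = T -> T \notin mball n n 0 ->
  exists2 S, S \in hball n 0 & phase T S != 1.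
Proof.
move=> sT nT; have [i [j Tij]] : exists i j, T i j \notin pball 0.
  move: nT; rewrite inE negb_forall => /existsP[ a ]; rewrite negb_forall => /existsP[ b ] h.
  by exists a, b.
have T0 : T i j != 0 by apply: contraNneq Tij => ->; rewrite rpred0.
have wT : w (T i j) <= -1.
  by move: Tij; rewrite !in_pball (negPf T0) /=; move: (w _) => z; lia.
have [x [sx x0 wx px]] := psi_witness D.
pose c := 2%:R^-1 * (x / T i j).
pose Z : 'M[K]_n := c *: delta_mx j i.
have hZ : Z \in mball n n 0.
  rewrite -[0]addr0; apply: mballZ.
    by rewrite pball_half in_pball hs_wM ?invr_eq0 // wV // wx subr_ge0 wT orbT.
  apply/mballP=> a b; rewrite mxE; case: (_ && _); rewrite ?rpred0 //; exact: pball1.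
(* tr(T Z) = x / 2 lies in the fixed field, so the symmetrized matrix has tr(T S) = x. *)
exists (Z + adjmx Z).
  rewrite in_hball adjmxD adjmxK addrC eqxx /=.
  by apply: (@rpredD _ (mball n n 0)) => //; rewrite mball_adj.
have trZ : \tr (T *m Z) = 2%:R^-1 * x.
  rewrite -scalemxAr mxtraceZ mxtrace_mulC /mxtrace (bigD1 j) //= big1 ?addr0.
    rewrite mxE (bigD1 i) //= big1 ?addr0 ?mxE ?eqxx ?mul1r //.
      by rewrite /c; field; rewrite hs_2_neq0 T0.
    by move=> a ai; rewrite mxE eqxx (negPf ai) mul0r.
  move=> a aj; rewrite mxE big1 // => b _; rewrite mxE (negPf aj) /= mul0r //.
have -> : phase T (Z + adjmx Z) = Psi x.
  rewrite /phase mulmxDr mxtraceD; congr Psi.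
  have -> : \tr (T *m adjmx Z) = star (\tr (T *m Z)).
    by rewrite -tr_adj adjmxM sT mxtrace_mulC.
  by rewrite trZ rmorphM star_half /= sx; field; rewrite hs_2_neq0.
by [].
Qed.

Lemma term_periodic n N (T R S : 'M[K]_n) (X : C) : adjmx T = T -> 0 <= N ->
  T \in mball n n (- N) -> adjmx R = R -> S \in hball n N ->
  X ^+ ord (R + S) * phase T (R + S) = X ^+ ord R * phase T R.
Proof.
move=> sT N0 hT sR hS.
have -> : ord (R + S) = ord R by apply: ord_addint; exact: mball_mono (hball_mball hS).
rewrite phaseD ?(hball_adj hS) // (@phase_int _ _ T S) ?mulr1 ?(hball_adj hS) //.
by rewrite -(addNr N); apply: mballM => //; exact: hball_mball.
Qed.

(** The phase of a nonintegral T is only periodic modulo pi^N, hence the finer quotient. Translation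
    by the integral S of [phase_nonint] keeps [ord] and multiplies the phase by a constant other
    than 1. *)
Lemma nonint_sum0 n (N E : nat) (T : 'M[K]_n) (X : C) : adjmx T = T ->
  T \in mball n n (- N%:Z) -> T \notin mball n n 0 ->
  qsum (hball n (- E%:Z)) (hball n N) (fun R => X ^+ ord R * phase T R) = 0.
Proof.
move=> sT hT nT; have [S hS pS] := phase_nonint sT nT.
apply: (@qsum_twist0 _ _ _ _ S (phase T S)) => //.
- by apply: hball_mono; lia.
- exact: fin_hball.
- by apply: hball_mono hS; lia.
- by move=> R S' hR hS'; apply: (term_periodic X sT _ hT (hball_adj hR) hS').
- move=> R hR.
  have -> : ord (R + S) = ord R by apply: ord_addint; exact: hball_mball.
  rewrite phaseD ?(hball_adj hS) ?(hball_adj hR) // mulrA; exact: mulrC.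
Qed.

End HermitianMatrix.

(** * Complex powers and the Siegel integral *)

Section ComplexPower.
Variable R : realType.
Implicit Types (a : R) (s t : R[i]).

Lemma cpowD a s t : cpow a (s + t) = cpow a s * cpow a t.
Proof.
case: s t => [x y] [x' y']; rewrite /cpow /= !mulrDl expRD cosD sinD.
apply/eqP; rewrite eq_complex /=; apply/andP; split; apply/eqP; ring.
Qed.

Lemma cpow0 a : cpow a 0 = 1.
Proof. by rewrite /cpow /= !mul0r expR0 cos0 sin0 mul1r. Qed.

Lemma cpow_neq0 a s : cpow a s != 0.
Proof.
apply/negP=> /eqP h; have := cpowD a s (- s); rewrite subrr cpow0 h mul0r => /eqP.
by rewrite oner_eq0.
Qed.

Lemma cpowN a s : cpow a (- s) = (cpow a s)^-1.
Proof.
apply: (mulfI (cpow_neq0 a s)); rewrite -cpowD subrr cpow0 mulfV //; exact: cpow_neq0.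
Qed.

Lemma cpow_nat a (m : nat) : 0 < a -> cpow a m%:R = (a ^+ m)%:C.
Proof.
move=> a0; elim: m => [|m IH]; first by rewrite cpow0 expr0.
rewrite -addn1 natrD cpowD IH exprD expr1 rmorphM; congr (_ * _).
by rewrite /cpow /= mul1r mul0r cos0 sin0 lnK ?posrE // mulr1.
Qed.

Lemma cpowM a b s : 0 < a -> 0 < b -> cpow (a * b) s = cpow a s * cpow b s.
Proof.
move=> a0 b0; rewrite /cpow lnM ?posrE // !mulrDr expRD cosD sinD.
apply/eqP; rewrite eq_complex /=; apply/andP; split; apply/eqP; ring.
Qed.

Lemma cpow1 s : cpow (1 : R) s = 1.
Proof. by rewrite /cpow ln1 !mulr0 expR0 cos0 sin0 mul1r. Qed.

Lemma cpowX a (m : nat) s : 0 < a -> cpow (a ^+ m) s = cpow a s ^+ m.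
Proof.
move=> a0; elim: m => [|m IH]; first exact: cpow1.
by rewrite !exprS cpowM ?exprn_gt0 // IH.
Qed.

Lemma cpowV a s : 0 < a -> cpow a^-1 s = (cpow a s)^-1.
Proof.
move=> a0; apply: (mulfI (cpow_neq0 a s)).
by rewrite -cpowM ?invr_gt0 // mulfV ?gt_eqF // cpow1 mulfV ?cpow_neq0.
Qed.

End ComplexPower.

(** * The local field as an instance of the abstract setting *)

Section Setting.
Variables (R : realType) (k : fieldType) (v : k -> int) (q : nat).
Hypotheses (hk : local_field0 v q) (hq : odd q).
Variable varpi : k.
Hypotheses (hvarpi0 : varpi != 0) (hvarpi : v varpi = 1).
Variables (k' : fieldExtType k) (w : k' -> int).
Hypothesis hk' : unramified_quadratic v w.
Variable star : {lrmorphism k' -> k'}.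
Hypothesis hstar : exists x, star x != x.
Variable psi : k -> R[i].
Hypothesis hpsi : character_conductor_O v psi.
Variables (th : k') (s : seq k).
Hypothesis hth : [/\ th != 0, w th = 0 & star th = - th].
Hypothesis hs : [/\ uniq s, size s = q, {in s, forall x, v_ge v 0 x},
  {in s &, forall x y, v_ge v 1 (x - y) -> x = y} &
  forall x, v_ge v 0 x -> exists2 y, y \in s & v_ge v 1 (x - y)].
Let hw := unramified_valuation hk'.

Lemma algB (a b : k) : a%:A - b%:A = (a - b)%:A :> k'.
Proof. by rewrite scalerBl. Qed.

Lemma alg_inj : injective (fun a : k => a%:A : k').
Proof. by move=> a b; move/(fmorph_inj (in_alg k')). Qed.

Lemma in_baseD x y : star x = x -> star y = y ->
  in_base (x + y) = in_base x + in_base y.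
Proof.
move=> /(star_fixed hk' hstar)[a ->] /(star_fixed hk' hstar)[b ->].
by rewrite -scalerDl !in_baseK.
Qed.

Lemma in_base_ge N x : star x = x -> v_ge w N x <-> v_ge v N (in_base x).
Proof. by move=> /(star_fixed hk' hstar)[a ->]; rewrite in_baseK; exact: (w_alg hk'). Qed.

Lemma two_alg : 2%:R = 2%:R%:A :> k'.
Proof. by rewrite scaler_nat. Qed.

(** Transparent, so that the projections reduce to k', w and [star]. The character of k becomes a
    function on k' through [in_base]. *)
Definition local_setting : herm_setting.
Proof.
refine (@HermSetting k' w star varpi%:A th q (map (fun a => a%:A) s) R[i]
  (psi \o @in_base k k') (valuationM hw) _ (starK hk' hstar)
  (w_star hk hk' hstar) _ _ (star_base star varpi) _ _ _ _ _
  (residue_gt1 hk hq) _ _ _ _ _ _ _ _ _).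
- by move=> N x y /v_geP hx /v_geP hy; apply/v_geP; exact: (valuationD hw).
- by rewrite scaler_eq0 oner_eq0 orbF.
- by rewrite (unramified_extends hk').
- by rewrite two_alg scaler_eq0 oner_eq0 orbF (two_neq0 hk).
- by rewrite two_alg (unramified_extends hk') ?(two_neq0 hk) // (valuation2 hk hq).
- by case: hth.
- by case: hth.
- by case: hth.
- by rewrite map_inj_uniq; [case: hs | exact: alg_inj].
- by rewrite size_map; case: hs.
- move=> _ /mapP[a sa ->]; have [_ _ s0 _ _] := hs; split; first exact: star_base.
  by apply/v_geP/(w_alg hk'); exact: s0.
- move=> _ _ /mapP[a sa ->] /mapP[b sb ->] /v_geP; rewrite algB => /(w_alg hk').
  by have [_ _ _ inj _] := hs; move/(inj _ _ sa sb) ->.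
- move=> x /(star_fixed hk' hstar)[a ->] /v_geP/(w_alg hk').
  have [_ _ _ _ cov] := hs => /cov[b sb h].
  by exists b%:A; [exact: map_f | apply/v_geP; rewrite algB; apply/(w_alg hk')].
- by move=> x y sx sy /=; rewrite in_baseD // (characterD hpsi).
- by move=> x sx; exact: (character_norm1 hpsi).
- by move=> x sx /v_geP h; apply: (character_trivial hpsi); apply/in_base_ge.
- have [a ha na] := character_nontrivial hpsi; exists a%:A; split.
  + exact: star_base.
  + by apply/v_geP/(w_alg hk').
  + by rewrite /= in_baseK.
Defined.

Local Notation D := local_setting.

Lemma integral_mxP n (A : 'M[k']_n) : integral_mx w A <-> A \in (mball n n 0 : {pred 'M[hs_K D]_n}).
Proof.
by split=> [h|/mballP h i j]; [apply/mballP => i j|]; [apply/v_geP | apply/v_geP; exact: h].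
Qed.

Lemma GL_integralP n (U : 'M[k']_n) : GL_integral w U <-> U \in (gl n : {pred 'M[hs_K D]_n}).
Proof.
split=> [[h1 /integral_mxP h2 /integral_mxP h3]|/glP[h1 h2 h3]]; first by apply/glP.
by split=> //; apply/integral_mxP.
Qed.

(** Existence of elementary divisors excludes the default value of [xget]; whichever divisors are
    chosen, [ord_elementary] identifies their negative part with [ord]. *)
Lemma nuE n (A : 'M[hs_K D]_n) : adjmx A = A ->
  nu q varpi w (A : 'M[k']_n) = (q ^ ord A)%N.
Proof.
move=> sA; have [U [V [d [hU hV eA]]]] := elementary_exists sA.
have [d' [U' [V' [/GL_integralP hU' /GL_integralP hV' eA']]] e'] :
    [set N | exists2 d, elementary_divisors varpi w A d &
    N = (q ^ \sum_i (if d i is Some (Negz m) then m.+1 else 0))%N] (nu q varpi w A).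
  apply: (@xgetPex _ 1%N); eexists; exists d; last by [].
  by exists U, V; split=> //; exact/GL_integralP.
rewrite /= in e'; rewrite e'; congr (_ ^ _)%N.
by rewrite -(ord_elementary d' hU' hV'); congr (ord _).
Qed.

Variables (n : nat) (mu : {measure set (herm_borel w star n) -> \bar R}).
Hypothesis hmu : canonical_haar mu.
Local Notation H := (herm star n).

Definition hmx (A : H) : 'M[hs_K D]_n := \val A.

Lemma hmx_adj (A : H) : adjmx (hmx A) = hmx A.
Proof. by have := valP A; rewrite is_hermE => /eqP e; rewrite /hmx [RHS]e. Qed.

Lemma herm_geP N (A : H) : herm_ge w N A <-> hmx A \in hball n N.
Proof.
rewrite in_hball hmx_adj eqxx /=.
by split=> [h|/mballP h i j]; [apply/mballP => i j|]; [apply/v_geP | apply/v_geP; exact: h].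
Qed.

Lemma hmxD (A B : H) : hmx (A + B) = hmx A + hmx B. Proof. by []. Qed.
Lemma hmxB (A B : H) : hmx (A - B) = hmx A - hmx B. Proof. by []. Qed.

(** A set stable under translation by a ball is open. *)
Lemma measurable_periodic N (U : set (herm_borel w star n)) :
  (forall A B : H, U A -> herm_ge w N B -> U (A + B : H)) -> measurable U.
Proof.
move=> hU; apply: sub_sigma_algebra => A UA; exists N => B hB.
have -> : B = A + (B - A) by rewrite addrC subrK.
exact: hU.
Qed.

Definition hcoset N (x : 'M[hs_K D]_n) : set (herm_borel w star n) :=
  [set A | hmx A - x \in hball n N].

Lemma measurable_hcoset N x : measurable (hcoset N x).
Proof.
apply: (@measurable_periodic N) => A B hA /herm_geP hB.
rewrite /hcoset /= hmxD addrAC; exact: (@rpredD _ (hball n N)).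
Qed.

Lemma measurable_ball N :
  measurable ([set A | herm_ge w N A] : set (herm_borel w star n)).
Proof.
apply: (@measurable_periodic N) => A B /= /herm_geP hA /herm_geP hB; apply/herm_geP.
by rewrite hmxD; exact: (@rpredD _ (hball n N)).
Qed.

Lemma hmx_surj (x : 'M[hs_K D]_n) : adjmx x = x -> exists A : H, hmx A = x.
Proof.
move=> sx; have hx : (x : 'M[k']_n) \in @is_herm k k' star n by rewrite is_hermE; apply/eqP.
by exists (Sub x hx).
Qed.

Lemma mu_hcoset N x : adjmx x = x ->
  mu (hcoset N x) = mu [set A | herm_ge w N A].
Proof.
move=> /hmx_surj[A hA]; rewrite -[RHS](haar_translation hmu A) //; last exact: measurable_ball.
congr (mu _); apply/seteqP; split=> [B hB|_ [B /herm_geP hB <-]].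
  exists (B - A : H); last by rewrite addrC subrK.
  by apply/herm_geP; rewrite hmxB hA.
by rewrite /hcoset /= hmxD hA addrAC subrr add0r.
Qed.

(** Finiteness suffices: for N > 0 this volume only multiplies a sum that vanishes. *)
Lemma mu_ball_fin N : 0 <= N -> exists m : R, mu [set A | herm_ge w N A] = m%:E.
Proof.
move=> N0; exists (fine (mu [set A | herm_ge w N A])); rewrite fineK //.
rewrite ge0_fin_numE //; apply: (@le_lt_trans _ _ 1%E); last exact: ltry.
rewrite -(haar_normalized hmu); apply: le_measure; rewrite ?inE.
- exact: measurable_ball.
- exact: measurable_ball.
- by move=> A /= /herm_geP hA; apply/herm_geP; exact: hball_mono hA.
Qed.

(** The integrand is constant on the cosets of the small ball. These are finite in number and have
    equal volume by translation invariance. *)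
Lemma cintegral_qsum (N M : int) (m : R) (F : 'M[hs_K D]_n -> R[i]) : M <= N ->
  mu [set A | herm_ge w N A] = m%:E ->
  (forall x y, x \in hball n M -> y \in hball n N -> F (x + y) = F x) ->
  cintegral mu [set A | herm_ge w M A] (fun A : herm_borel w star n => F (hmx A)) =
  m%:C * qsum (hball n M) (hball n N) F.
Proof.
move=> MN mN hF.
have fin := @fin_hball D n M N.
have sub : {subset (hball n N : {pred 'M[hs_K D]_n}) <= hball n M} by exact: hball_mono.
pose r := coset_reps (hball n M) (hball n N : {pred 'M[hs_K D]_n}).
have sM x : x \in r -> x \in hball n M by exact: coset_reps_sub.
have cover : [set A : herm_borel w star n | herm_ge w M A] =
    \big[setU/set0]_(x <- r) hcoset N x.
  rewrite -bigcup_seq; apply/seteqP; split=> [A /= /herm_geP hA|A [x /= xs hA]].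
    exists (coset_rep (hball n N) (hmx A)).
      by apply/(coset_repsP _ fin); exists (hmx A).
    by rewrite /hcoset /= -opprB (@rpredN _ (@hball D n N)) coset_repP.
  apply/herm_geP; rewrite -[hmx A](subrK x); apply: (@rpredD _ (hball n M)).
    exact: sub.
  exact: sM.
have Fc x A : x \in r -> hcoset N x A -> F (hmx A) = F x.
  by move=> xs hA; rewrite -[hmx A](subrK x) addrC hF // sM.
have key (g : R[i] -> R) :
    \int[mu]_(A in [set A | herm_ge w M A]) g (F (hmx A)) = m * \sum_(x <- r) g (F x).
  rewrite cover; apply: Rintegral_pieces.
  - exact: measurable_hcoset.
  - exact: coset_reps_uniq.
  - move=> x y xs ys [A [hx hy]]; apply: (coset_reps_eq fin xs ys).
    have -> : x - y = (hmx A - y) - (hmx A - x) by rewrite opprB [RHS]addrC addrA subrK.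
    exact: (@rpredB _ (hball n N)).
  - move=> _ Y _; rewrite -cover; apply: (@measurable_periodic N).
    move=> A B [/= /herm_geP hA YA] /herm_geP hB; split.
      by apply/herm_geP; rewrite hmxD; apply: (@rpredD _ (hball n M)) => //; exact: sub.
    by rewrite /preimage /= hmxD hF.
  - by move=> x xs; rewrite mu_hcoset // (hball_adj (sM x xs)).
  - by move=> x xs A hA; rewrite (Fc x A).
rewrite /cintegral !key /qsum -/r.
by rewrite (sum_complex r) mulr_complex.
Qed.


Lemma siegel_integralE (T : H) (X : hs_C D) t e : cpow q%:R (- t) = X ->
  siegel_integral q varpi mu psi T t e =
  cintegral mu [set A | herm_ge w (- e%:Z) A]
    (fun A : herm_borel w star n => X ^+ ord (hmx A) * phase (hmx T) (hmx A)).
Proof.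
move=> hX; rewrite /siegel_integral; congr cintegral; apply/funext => A.
congr (_ * _); rewrite -hX -cpowX ?ltr0n ?(ltnW (residue_gt1 hk hq)) // -natrX.
by rewrite (nuE (A := hmx A)) // hmx_adj.
Qed.

Lemma siegel_integral_int (T : H) t e : hmx T \in hball n 0 ->
  siegel_integral q varpi mu psi T t e = bsum e (cpow q%:R (- t) : hs_C D) (hmx T).
Proof.
move=> hT; rewrite (siegel_integralE T (X := cpow q%:R (- t)) e erefl).
rewrite (@cintegral_qsum 0 _ 1 (fun M : 'M[hs_K D]_n => (cpow q%:R (- t) : hs_C D) ^+ ord M * phase (hmx T) M)) ?mul1r //; first exact: haar_normalized.
move=> x y hx hy; apply: (@term_periodic D n 0 (hmx T) x y (cpow q%:R (- t))); rewrite ?hmx_adj ?oppr0 //.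
  exact: hball_mball.
exact: (hball_adj hx).
Qed.

Lemma siegel_integral_nonint (T : H) t (N e : nat) : hmx T \in mball n n (- N%:Z) ->
  hmx T \notin mball n n 0 -> siegel_integral q varpi mu psi T t e = 0.
Proof.
move=> hT nT; have [m hm] := mu_ball_fin (isT : 0 <= N%:Z).
rewrite (siegel_integralE T (X := cpow q%:R (- t)) e erefl).
rewrite (@cintegral_qsum N _ m (fun M : 'M[hs_K D]_n => (cpow q%:R (- t) : hs_C D) ^+ ord M * phase (hmx T) M)) ?nonint_sum0 ?mulr0 ?hmx_adj //; first by lia.
move=> x y hx hy; apply: (term_periodic _ _ _ hT) => //; first by rewrite hmx_adj.
exact: (hball_adj hx).
Qed.

End Setting.

Lemma ccvg_eventually (R : realType) (u : nat -> R[i]) (l : R[i]) (N : nat) :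
  (forall e, (N <= e)%N -> u e = l) -> ccvg u l.
Proof.
move=> h; split; apply: (@cvg_near_cst _ _ _ _ _); near=> e;
  rewrite h //; near: e; exact: nbhs_infty_ge.
Unshelve. all: by end_near. Qed.

(** In the variable X = q^-s, the reflection s -> 2n - s is X -> q^(-2n) / X. *)
Lemma reflect_arg (R : realType) (q n : nat) (s : R[i]) : (0 < q)%N ->
  cpow (q%:R : R) (- (n.*2%:R - s)) = (q ^ 2)%:R ^- n / cpow q%:R (- s).
Proof.
move=> q0; rewrite opprB addrC cpowD !cpowN invrK cpow_nat ?ltr0n // rmorphXn /= rmorph_nat; congr (_^-1 * _).
by rewrite -muln2 mulnC exprM natrX.
Qed.

Lemma normalizing_product (R : realType) (q n : nat) (s : R[i]) : (0 < q)%N ->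
  \prod_(i < n) (1 - (-1) ^+ i * cpow (q%:R : R) (- s + i%:R)) =
  \prod_(i < n) (1 - (- q%:R) ^+ i * cpow q%:R (- s)).
Proof.
move=> q0; apply: eq_bigr => i _; congr (1 - _).
rewrite cpowD cpow_nat ?ltr0n // mulrCA mulrC; congr (_ * _).
by rewrite [in RHS]exprNn rmorphXn /= rmorph_nat.
Qed.

(** The source of the power of chi: - (-1)^n = (-1)^(n-1), and (-1)^l is chi(det T) when l = v(det
    T). *)
Lemma fun_eq_sign (F : fieldType) (q X : F) (n l : nat) : (0 < n)%N ->
  (- ((- q) ^+ n * X)) ^+ l = ((-1) ^+ l) ^+ n.-1 * (q ^+ n * X) ^+ l.
Proof.
case: n => // n _ /=; rewrite exprAC -exprMn; congr (_ ^+ l).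
rewrite (exprNn q) (exprS (-1)); move: ((-1) ^+ n) (q ^+ n.+1) => a b; ring.
Qed.

(* [hq]: the residual characteristic is odd.  With the factor |det(T/2)| the
   identity fails for even q: for n = 1, T = (1) the Siegel series is 1 - q^-s,
   the left-hand side is 1 and the right-hand side is |1/2|^(s-1).
   The conclusion is an equality of meromorphic functions of s: it is required
   at every s where no denominator vanishes, i.e. off a discrete set. *)
Theorem theorem4p4
  (R : realType)
  (k : fieldType) (v : k -> int) (q : nat) (hk : local_field0 v q)
  (hq : odd q)
  (varpi : k) (hvarpi0 : varpi != 0) (hvarpi : v varpi = 1)
  (k' : fieldExtType k) (w : k' -> int) (hk' : unramified_quadratic v w)
  (star : {lrmorphism k' -> k'}) (hstar : exists x, star x != x)
  (psi : k -> R[i]) (hpsi : character_conductor_O v psi)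
  (n : nat) (hn : (0 < n)%N)
  (mu : {measure set (herm_borel w star n) -> \bar R})
  (hmu : canonical_haar mu)
  (T : herm star n) (hT : \val T \in unitmx) :
  exists P Q : {poly R[i]},
    siegel_continuation q varpi mu psi T P Q /\
    let b := fun s : R[i] => P.[cpow q%:R (- s)] / Q.[cpow q%:R (- s)] in
    let c := fun s : R[i] =>
      \prod_(i < n) (1 - (-1) ^+ i * cpow q%:R (- s + i%:R)) in
    forall s : R[i],
      Q.[cpow q%:R (- s)] != 0 ->
      Q.[cpow q%:R (- (n.*2%:R - s))] != 0 ->
      c s != 0 -> c (n.*2%:R - s) != 0 ->
      b s / c s =
        chi R v (in_base (\det (\val T))) ^+ n.-1 *
        cpow (absval R v q (in_base (\det (2%:R^-1 *: \val T)))) (s - n%:R) *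
        (b (n.*2%:R - s) / c (n.*2%:R - s)).
Proof.
have q0 : (0 < q)%N := ltnW (residue_gt1 hk hq).
have [th hth] := traceless_unit hk' hstar hvarpi0 hvarpi.
have [r hr] := residue_transversal hk.
pose D := local_setting hk hq hvarpi0 hvarpi hk' hstar hpsi hth hr.
pose TM : 'M[hs_K D]_n := hmx hk hq hvarpi0 hvarpi hk' hstar hpsi hth hr T.
have sT : adjmx TM = TM by exact: hmx_adj.
(* For nonintegral T all truncated integrals vanish, so P = 0 and Q = 1. *)
have [iT|niT] := boolP (TM \in mball n n 0); last first.
  have [N hN] := mball_bound TM.
  exists 0, 1; split; last by move=> /= t *; rewrite !horner0 !mul0r mulr0.
  split; first exact: oner_neq0.
  exists 0 => t _; rewrite hornerC oner_neq0; split=> //.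
  apply: (@ccvg_eventually _ _ _ 0) => e _; rewrite horner0 mul0r.
  exact: (siegel_integral_nonint (hth := hth) (hs := hr) hmu t e hN niT).
have hTM : TM \in hball n 0 by rewrite in_hball sT eqxx.
have [lam [l [iTV wl FE]]] := bsum_fun_eq hTM hT.
(* The integrals are constant from e = lam + 10 on, for every s, and equal to a polynomial in q^-s;
   hence Q = 1. *)
exists (bpoly (lam + 10) TM : {poly R[i]}), 1; split.
  split; first exact: oner_neq0.
  exists 0 => t _; rewrite hornerC oner_neq0; split=> //.
  apply: (@ccvg_eventually _ _ _ (lam + 10)) => e he; rewrite divr1.
  transitivity (bsum (D := D) e (cpow q%:R (- t) : hs_C D) TM).
    exact: siegel_integral_int.
  rewrite (@bsum_stable D n TM lam (lam + 10)) //; last by rewrite leq_add2l.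
  exact: (esym (bpolyE (lam + 10) TM (cpow q%:R (- t) : hs_C D))).
move=> b c t _ _ c0 c1.
have dT0 : \det (\val T) != 0 by move: hT; rewrite unitmxE unitfE.
have sdT : star (\det (\val T)) = \det (\val T).
  have e : \det (adjmx TM) = \det (\val T) by rewrite sT.
  by rewrite -[RHS]e /adjmx det_map_mx det_tr.
have eA : (in_base (\det (\val T)))%:A = \det (\val T) by exact: (in_base_alg hk' hstar sdT).
set a := in_base _ in eA *.
have a0 : a != 0 by apply: contraNneq dT0 => a0; rewrite -eA a0 scale0r.
have va : v a = l by rewrite -(unramified_extends hk' a0) eA.
have two0 := two_neq0 hk; have hv := local_field_valuation hk.
(* Since q is odd, 2 is a unit, and passing from det T to det(T/2) does not change the valuation
   l. *)
have vhalf m : (2%:R : k) ^- m * a != 0 /\ v (2%:R ^- m * a) = l.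
  elim: m => [|m [IH0 IH]]; first by rewrite expr0 invr1 mul1r.
  have h0 : (2%:R : k)^-1 != 0 by rewrite invr_eq0.
  have vh : v 2%:R^-1 = 0.
    by have := valuationM hv two0 h0; rewrite mulfV // (valuation1 hv) (valuation2 hk hq) add0r => <-.
  by rewrite exprS invfM -mulrA mulf_neq0 // (valuationM hv) // vh add0r.
have -> : in_base (\det (2%:R^-1 *: \val T)) = 2%:R ^- n * a.
  rewrite detZ -eA -[RHS](in_baseK k'); congr in_base.
  rewrite -[RHS]/(in_alg k' (2%:R ^- n * a)) rmorphM fmorphV rmorphXn rmorph_nat.
  by rewrite exprVn.
have [h0 vh] := vhalf n.
have qR0 : 0 < q%:R :> R by rewrite ltr0n.
pose X : R[i] := cpow q%:R (- t).
have X0 : X != 0 by exact: cpow_neq0.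
(* |det(T/2)| = q^-l, and (q^-l)^(s-n) = (q^n q^-s)^l. *)
have abs_pow : cpow (absval R v q (2%:R ^- n * a)) (t - n%:R) = (q%:R ^+ n * X) ^+ l.
  rewrite /absval (negPf h0) vh -exprnN cpowV ?exprn_gt0 // cpowX // -exprVn -cpowN opprB.
  by rewrite cpowD cpow_nat // rmorphXn /= rmorph_nat.
have bE s : b s = (bpoly (lam + 10) TM : {poly R[i]}).[cpow q%:R (- s)].
  by rewrite /b hornerC divr1.
have cE s : c s = \prod_(i < n) (1 - (- q%:R) ^+ i * cpow q%:R (- s)).
  exact: normalizing_product.
rewrite abs_pow /chi va -exprnP.
move: c0 c1; rewrite !bE !cE reflect_arg // -/X => c0 c1.
have fe : (bpoly (lam + 10) TM : {poly R[i]}).[X] *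
    \prod_(i < n) (1 - (- q%:R) ^+ i * ((q ^ 2)%:R ^- n / X)) =
    (- ((- q%:R) ^+ n * X)) ^+ l *
    (bpoly (lam + 10) TM : {poly R[i]}).[(q ^ 2)%:R ^- n / X] *
    \prod_(i < n) (1 - (- q%:R) ^+ i * X).
  have e Y : (bpoly (lam + 10) TM : {poly R[i]}).[Y] = bsum (D := D) (lam + 10) Y TM.
    exact: (bpolyE (D := D) (lam + 10) TM Y).
  by rewrite !e; exact: (FE X X0).
rewrite (fun_eq_sign q%:R X l hn) in fe.
by apply/eqP; rewrite mulrA eqr_div //; apply/eqP.
Qed.
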